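(* Let $\lambda(n):=\pi\sqrt{24n-1}/6$ and $q(n):=\frac{\log(24n-1)}{|\log(\log(24n-1))-1.1714|}$. Then for all integers $n\geq 1$, $$S(n)=2\sqrt{3}\,e^{\lambda(n)}+E(n),\qquad |E(n)|<(4.30\times 10^{23})\,2^{q(n)}(24n-1)^2e^{\lambda(n)/2}.$$
   Context: Let $E_4(z)=1+240\sum_{m\ge1}\sigma_3(m)e^{2\pi i mz}$ and $\eta(z)=e^{\pi i z/12}\prod_{m\ge1}(1-e^{2\pi i mz})$ on the upper half-plane $\mathbb{H}$. Define the weight-zero weakly holomorphic modular form for $\Gamma_0(6)$ $$f(z):=\frac{1}{24}\frac{E_4(z)-4E_4(2z)-9E_4(3z)+36E_4(6z)}{(\eta(z)\eta(2z)\eta(3z)\eta(6z))^2}.$$ For $n\ge1$ let $\mathcal{Q}_n$ be the set of positive definite integral binary quadratic forms $Q=[a,b,c]=aX^2+bXY+cY^2$ of discriminant $b^2-4ac=-24n+1$ with $6\mid a$ and $b\equiv 1\pmod{12}$; $\Gamma_0(6)$ acts on $\mathcal{Q}_n$ by $Q\mapsto Q\circ\sigma$, $(Q\circ\sigma)(X,Y)=Q(\alpha X+\beta Y,\gamma X+\delta Y)$ for $\sigma=\begin{pmatrix}\alpha&\beta\\\gamma&\delta\end{pmatrix}$. For $Q=[a,b,c]$ let $\tau_Q=\frac{-b+\sqrt{-24n+1}}{2a}\in\mathbb{H}$ be its Heegner point. Define $S(n):=\sum_{[Q]\in\mathcal{Q}_n/\Gamma_0(6)} f(\tau_Q)$,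 the sum over $\Gamma_0(6)$-equivalence classes (well defined since $f$ is $\Gamma_0(6)$-invariant). *)

(* Defs.v *)
From HB Require Import structures.
From mathcomp Require Import all_boot all_order all_algebra.
From mathcomp Require Import complex ring.
From mathcomp Require Import all_classical all_reals all_analysis.
Set Implicit Arguments.
Unset Strict Implicit.
Unset Printing Implicit Defensive.
Import Order.TTheory GRing.Theory Num.Theory.
Import numFieldNormedType.Exports.
Local Open Scope classical_set_scope.
Local Open Scope complex_scope.
Local Open Scope ring_scope.

(* Limits in R[i] are taken in R[i]^o, the alias of R[i] that carries the
   topology of the norm. *)

Definition cexp (R : realType) (z : R[i]) : R[i] :=
  (expR (complex.Re z))%:C * (cos (complex.Im z) +i* sin (complex.Im z)).

Definition sigma (k m : nat) : nat := (\sum_(d <- divisors m) d ^ k)%N.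

Definition E4 (R : realType) (z : R[i]) : R[i] :=
  1 + 240 * limn (fun N => \sum_(1 <= m < N.+1)
    (sigma 3 m)%:R * cexp (2 * pi%:C * 'i%C * m%:R * z) : R[i]^o).

Definition eta (R : realType) (z : R[i]) : R[i] :=
  cexp (pi%:C * 'i%C * z / 12) *
  limn (fun N => \prod_(1 <= m < N.+1)
    (1 - cexp (2 * pi%:C * 'i%C * m%:R * z)) : R[i]^o).

Definition f (R : realType) (z : R[i]) : R[i] :=
  24^-1 * ((E4 z - 4 * E4 (2 * z) - 9 * E4 (3 * z) + 36 * E4 (6 * z))
           / (eta z * eta (2 * z) * eta (3 * z) * eta (6 * z)) ^+ 2).

(* (a, b, c) encodes the integral form aX^2 + bXY + cY^2. *)
Definition bqf : Type := int * int * int.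

Definition bqf_eval (Q : bqf) (x y : int) : int :=
  let: (a, b, c) := Q in a * x ^+ 2 + b * x * y + c * y ^+ 2.

Definition bqf_disc (Q : bqf) : int :=
  let: (a, b, c) := Q in b ^+ 2 - 4 * a * c.

Definition bqf_posdef (Q : bqf) : Prop :=
  forall x y : int, (x, y) <> (0, 0) -> 0 < bqf_eval Q x y.

Definition Gamma0 (N : nat) : set 'M[int]_2 :=
  [set s : 'M[int]_2 | \det s = 1 /\ (N%:Z %| (s 1 0)%R)%Z].

Definition bqf_act (Q : bqf) (s : 'M[int]_2) : bqf :=
  let: (a, b, c) := Q in
  (a * s 0 0 ^+ 2 + b * s 0 0 * s 1 0 + c * s 1 0 ^+ 2,
   2 * a * s 0 0 * s 0 1 + b * (s 0 0 * s 1 1 + s 0 1 * s 1 0)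
     + 2 * c * s 1 0 * s 1 1,
   a * s 0 1 ^+ 2 + b * s 0 1 * s 1 1 + c * s 1 1 ^+ 2).

Lemma bqf_actE (Q : bqf) (s : 'M[int]_2) (x y : int) :
  bqf_eval (bqf_act Q s) x y =
  bqf_eval Q (s 0 0 * x + s 0 1 * y) (s 1 0 * x + s 1 1 * y).
Proof. by case: Q => -[a b] c /=; ring. Qed.

Definition Qforms (n : nat) : set bqf :=
  [set Q | [/\ bqf_posdef Q,
               bqf_disc Q = - (24 * n%:Z) + 1,
               (6 %| Q.1.1)%Z
             & (Q.1.2 = 1 %[mod 12])%Z]].

Definition Gamma0_6_class (Q : bqf) : set bqf :=
  [set bqf_act Q s | s in Gamma0 6].

Definition Qclasses (n : nat) : set (set bqf) := Gamma0_6_class @` Qforms n.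

(* The discriminant D of Q is negative, so sqrt D is i * sqrt (- D). *)
Definition heegner (R : realType) (Q : bqf) : R[i] :=
  (- (Q.1.2)%:~R + 'i%C * (Num.sqrt (- (bqf_disc Q)%:~R : R))%:C)
  / (2 * (Q.1.1)%:~R).

(* xget picks an element of the class C; its default value is never used, as
   classes are nonempty.  A sum \sum_(_ \in _) over a set is 0 by convention
   when its summand has infinite support, which does not occur here because
   there are finitely many classes. *)
Definition Ssum (R : realType) (n : nat) : R[i] :=
  \sum_(C \in Qclasses n) f (heegner R (xget (0, 0, 0) C)).

Definition lambda (R : realType) (n : nat) : R :=
  pi * Num.sqrt (24 * n%:R - 1) / 6.

Definition q (R : realType) (n : nat) : R :=
  ln (24 * n%:R - 1) / `| ln (ln (24 * n%:R - 1)) - 11714 / 10000 |.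

(* Main.v *)
(* The Atkin-Lehner involutions of Gamma0(6) map f to f or - f, so by reduction
   theory each class can be replaced by a form [6 A, B, C] with 3 A^2 <= 24 n - 1
   whose Heegner point has imaginary part sqrt (24 n - 1) / (12 A).  There f z is
   e^(- 2 pi i z) up to a bounded error.  Forms with A >= 2 contribute
   O(e^(lambda n / 2)) each, and there are O(n^2) of them.  For n >= 2 exactly four
   classes have A = 1, one for each involution; with zeta = e^(pi i / 6) they
   contribute e^(lambda n) (zeta - zeta^7 - zeta^5 + zeta^11) =
   2 sqrt 3 e^(lambda n).

   The modularity of f comes from that of E4 and eta^2.  Absolutely convergent
   rearrangements of Lipschitz's formulas give E4(-1/z) = z^4 E4(z) and the
   quasi-modularity of G2; integrating the latter yields the law of eta^2. *)
Require Import Defs.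
From mathcomp Require Import all_boot all_order all_algebra.
From mathcomp Require Import complex ring lra zify.
From mathcomp Require Import all_classical all_reals all_analysis.
Set Implicit Arguments.
Unset Strict Implicit.
Unset Printing Implicit Defensive.
Import Order.TTheory GRing.Theory Num.Theory.
Import numFieldNormedType.Exports.
Local Open Scope classical_set_scope.
Local Open Scope complex_scope.
Local Open Scope ring_scope.

(** * Limits, series and derivatives in R[i] *)

Section Modulus.
Context {R : realType}.
Implicit Types (x y z : R[i]) (a b : R).

Definition nm z : R := ComplexField.Normc.normc z.
Definition rp z : R := complex.Re z.
Definition ip z : R := complex.Im z.
Arguments rp !z /.
Arguments ip !z /.

Lemma nmE z : `|z| = (nm z)%:C. Proof. by case: z. Qed.

Lemma nm_def z : nm z = Num.sqrt (rp z ^+ 2 + ip z ^+ 2).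
Proof. by case: z. Qed.

Lemma nm_sqr z : nm z ^+ 2 = rp z ^+ 2 + ip z ^+ 2.
Proof. by rewrite nm_def sqr_sqrtr// addr_ge0// sqr_ge0. Qed.

Lemma nm_ge0 z : 0 <= nm z. Proof. by rewrite nm_def sqrtr_ge0. Qed.
Lemma nmM x y : nm (x * y) = nm x * nm y.
Proof. exact: ComplexField.Normc.normcM. Qed.
Lemma nmV x : nm x^-1 = (nm x)^-1. Proof. exact: ComplexField.Normc.normcV. Qed.
Lemma nmf x y : nm (x / y) = nm x / nm y. Proof. by rewrite nmM nmV. Qed.
Lemma nm0 : nm 0 = 0. Proof. exact: ComplexField.Normc.normc0. Qed.
Lemma nm1 : nm 1 = 1. Proof. exact: ComplexField.Normc.normc1. Qed.
Lemma nmN x : nm (- x) = nm x. Proof. exact: normcN. Qed.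
Lemma nmBC x y : nm (x - y) = nm (y - x). Proof. by rewrite -nmN opprB. Qed.
Lemma nmD x y : nm (x + y) <= nm x + nm y. Proof. exact: le_normcD. Qed.
Lemma nmB x y : nm (x - y) <= nm x + nm y.
Proof. by rewrite -(nmN y); apply: nmD. Qed.
Lemma nm_subl x y : nm x - nm y <= nm (x + y).
Proof. by rewrite lerBlDr -{1}(addrK y x); apply: nmB. Qed.
Lemma nm_subB x y : nm x - nm y <= nm (x - y).
Proof. by rewrite -(nmN y); apply: nm_subl. Qed.
Lemma nm_tri x y z : nm (x - z) <= nm (x - y) + nm (y - z).
Proof. by have -> : x - z = (x - y) + (y - z) by [ring]; apply: nmD. Qed.

Lemma nm_eq0 z : (nm z == 0) = (z == 0).
Proof.
apply/eqP/eqP => [|->]; last exact: nm0.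
exact: ComplexField.Normc.eq0_normc.
Qed.
Lemma nm_gt0 z : (0 < nm z) = (z != 0).
Proof. by rewrite lt_neqAle nm_ge0 andbT eq_sym nm_eq0. Qed.

Lemma nmX z n : nm (z ^+ n) = nm z ^+ n.
Proof. by elim: n => [|n IH]; rewrite ?expr0 ?nm1// !exprS nmM IH. Qed.

Lemma nmC a : nm a%:C = `|a|.
Proof. by rewrite nm_def /= expr0n addr0 sqrtr_sqr. Qed.

Lemma real_complex_nat n : (n%:R : R)%:C = n%:R :> R[i].
Proof. by rewrite rmorph_nat. Qed.

Lemma nmn n : nm n%:R = n%:R.
Proof. by rewrite -real_complex_nat nmC ger0_norm. Qed.

Lemma nmi : nm 'i%C = 1.
Proof. by rewrite nm_def /= expr0n expr1n add0r sqrtr1. Qed.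

Lemma nm_Re z : `|rp z| <= nm z.
Proof.
rewrite -(@ler_pXn2r _ 2)// ?nnegrE ?nm_ge0//.
by rewrite real_normK ?num_real// nm_sqr lerDl sqr_ge0.
Qed.

Lemma nm_Im z : `|ip z| <= nm z.
Proof.
rewrite -(@ler_pXn2r _ 2)// ?nnegrE ?nm_ge0//.
by rewrite real_normK ?num_real// nm_sqr lerDr sqr_ge0.
Qed.

Lemma nm_ReIm z : nm z <= `|rp z| + `|ip z|.
Proof.
rewrite -(@ler_pXn2r _ 2)// ?nnegrE ?nm_ge0 ?addr_ge0//.
rewrite sqrrD !real_normK ?num_real// nm_sqr -addrA lerD2l lerDr.
by rewrite mulrn_wge0// mulr_ge0.
Qed.

Lemma nm_sum (I : Type) (r : seq I) (P : pred I) (F : I -> R[i]) :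
  nm (\sum_(i <- r | P i) F i) <= \sum_(i <- r | P i) nm (F i).
Proof.
elim/big_ind2 : _ => [|x a y b xa yb|//]; first by rewrite nm0.
exact: le_trans (nmD _ _) (lerD xa yb).
Qed.

Lemma rpD x y : rp (x + y) = rp x + rp y.
Proof. by case: x; case: y. Qed.
Lemma ipD x y : ip (x + y) = ip x + ip y.
Proof. by case: x; case: y. Qed.
Lemma rpN x : rp (- x) = - rp x. Proof. by case: x. Qed.
Lemma ipN x : ip (- x) = - ip x. Proof. by case: x. Qed.
Lemma rpM x y : rp (x * y) =
  rp x * rp y - ip x * ip y.
Proof. by case: x; case: y. Qed.
Lemma ipM x y : ip (x * y) =
  rp x * ip y + ip x * rp y.
Proof. by case: x; case: y. Qed.
Lemma rp_sum (I : Type) (r : seq I) (F : I -> R[i]) :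
  rp (\sum_(i <- r) F i) = \sum_(i <- r) rp (F i).
Proof. by elim/big_ind2 : _ => // x a y b; rewrite rpD => -> ->. Qed.
Lemma ip_sum (I : Type) (r : seq I) (F : I -> R[i]) :
  ip (\sum_(i <- r) F i) = \sum_(i <- r) ip (F i).
Proof. by elim/big_ind2 : _ => // x a y b; rewrite ipD => -> ->. Qed.
Lemma complex_eqP x y :
  rp x = rp y -> ip x = ip y -> x = y.
Proof. by case: x; case: y => a b c d /= -> ->. Qed.

End Modulus.

Section Limits.
Context {R : realType}.
Implicit Types (u v : nat -> R[i]) (x y z l : R[i]) (a b : R).

Definition lim_to u l := (fun n => nm (u n - l)) @ \oo --> (0 : R).

Lemma lim_toP u l : lim_to u l <->
  forall e : R, 0 < e -> exists N, forall n, (N <= n)%N -> nm (u n - l) < e.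
Proof.
split=> [/cvgrPdist_lt ul e e0|H].
  have [N _ HN] := ul e e0; exists N => n Nn; have := HN n Nn.
  by rewrite sub0r normrN ger0_norm ?nm_ge0.
apply/cvgrPdist_lt => e e0; have [N HN] := H e e0; exists N => // n /= Nn.
by rewrite sub0r normrN ger0_norm ?nm_ge0// HN.
Qed.

Lemma lim_to_squeeze u l (b : nat -> R) :
  (\forall n \near \oo, nm (u n - l) <= b n) -> b @ \oo --> (0 : R) ->
  lim_to u l.
Proof.
move=> ub b0; apply: (squeeze_cvgr _ (cvg_cst 0) b0).
by apply: filterS ub => n ->; rewrite nm_ge0.
Qed.

Lemma lim_to_cst l : lim_to (fun=> l) l.
Proof. by rewrite /lim_to; under eq_fun do rewrite subrr nm0; apply: cvg_cst. Qed.

Lemma lim_toD u v l m : lim_to u l -> lim_to v m -> lim_to (u \+ v) (l + m).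
Proof.
move=> ul vm.
have h : (fun n => nm (u n - l) + nm (v n - m)) @ \oo --> (0 + 0 : R).
  exact: cvgD.
rewrite addr0 in h.
apply: lim_to_squeeze h; apply: nearW => n /=.
by rewrite opprD addrACA; apply: nmD.
Qed.

Lemma lim_toM u v l m : lim_to u l -> lim_to v m -> lim_to (u \* v) (l * m).
Proof.
move=> ul vm.
have h : (fun n => nm (u n - l) * nm (v n - m) + nm m * nm (u n - l)
    + nm l * nm (v n - m)) @ \oo --> (0 * 0 + nm m * 0 + nm l * 0 : R).
  by apply: cvgD; [apply: cvgD; [exact: cvgM|]|]; apply: cvgM => //; apply: cvg_cst.
rewrite !mulr0 !addr0 in h.
apply: lim_to_squeeze h; apply: nearW => n /=.
have -> : u n * v n - l * m = (u n - l) * (v n - m) + m * (u n - l) + l * (v n - m).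
  by ring.
by rewrite (le_trans (nmD _ _))// nmM lerD2r (le_trans (nmD _ _))// !nmM.
Qed.

Lemma lim_toZ c u l : lim_to u l -> lim_to (fun n => c * u n) (c * l).
Proof. by move=> ul; apply: lim_toM ul; apply: lim_to_cst. Qed.

Lemma lim_toN u l : lim_to u l -> lim_to (fun n => - u n) (- l).
Proof.
move=> /(lim_toZ (- 1)); rewrite mulN1r => h.
by under eq_fun do rewrite -mulN1r.
Qed.

Lemma lim_toB u v l m : lim_to u l -> lim_to v m ->
  lim_to (fun n => u n - v n) (l - m).
Proof. by move=> ul /lim_toN vm; apply: lim_toD. Qed.

Lemma lim_to_unique u l m : lim_to u l -> lim_to u m -> l = m.
Proof.
move=> ul um; apply/eqP; rewrite -subr_eq0 -nm_eq0; apply/eqP.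
have h : (fun n => nm (u n - l) + nm (u n - m)) @ \oo --> (0 + 0 : R).
  exact: cvgD.
rewrite addr0 in h.
apply: (@cvg_unique _ (@Rhausdorff R) ((fun=> nm (l - m)) @ \oo)) => //.
  exact: cvg_cst.
apply: (squeeze_cvgr _ (cvg_cst 0) h); apply: nearW => n.
by rewrite nm_ge0 /= (le_trans (nm_tri l (u n) m))// nmBC lexx.
Qed.

Lemma lim_to_near u v l : (\forall n \near \oo, u n = v n) ->
  lim_to u l -> lim_to v l.
Proof.
move=> uv ul; apply: lim_to_squeeze ul.
by apply: filterS uv => n ->.
Qed.

Lemma lim_to_shift u l k : lim_to u l -> lim_to (fun n => u (n + k)%N) l.
Proof.
move=> /lim_toP ul; apply/lim_toP => e /ul[N HN]; exists N => n Nn.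
by apply: HN; rewrite (leq_trans Nn)// leq_addr.
Qed.

Lemma lim_to_sub u l (k : nat -> nat) : (forall n, (n <= k n)%N) ->
  lim_to u l -> lim_to (u \o k) l.
Proof.
move=> nk /lim_toP ul; apply/lim_toP => e /ul[N HN]; exists N => n Nn.
by apply: HN; rewrite (leq_trans Nn).
Qed.

Lemma lim_to_unshift u l k : lim_to (fun n => u (n + k)%N) l -> lim_to u l.
Proof.
move=> /lim_toP ul; apply/lim_toP => e /ul[N HN]; exists (N + k)%N => n Nn.
have kn : (k <= n)%N by rewrite (leq_trans _ Nn)// leq_addl.
have nk : (N <= n - k)%N by rewrite leq_subRL// addnC.
by have := HN _ nk; rewrite subnK.
Qed.

Lemma lim_to_le u l x b : (\forall n \near \oo, nm (u n - x) <= b) ->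
  lim_to u l -> nm (l - x) <= b.
Proof.
move=> ub /lim_toP ul; apply/ler_addgt0Pr => e /ul[N HN].
case: ub => M _ HM; set n := maxn N M.
have h1 := HN n (leq_maxl _ _); have h2 := HM n (leq_maxr _ _).
by rewrite (le_trans (nm_tri l (u n) x))// addrC lerD// nmBC ltW.
Qed.

Lemma lim_to_Re_Im u l : (fun n => rp (u n)) @ \oo --> rp l ->
  (fun n => ip (u n)) @ \oo --> ip l -> lim_to u l.
Proof.
move=> /cvgr_dist_lt hr /cvgr_dist_lt hi; apply/lim_toP => e e0.
have e2 : 0 < e / 2 by rewrite divr_gt0.
have [N _ HN] := hr _ e2; have [M _ HM] := hi _ e2.
exists (maxn N M) => n; rewrite geq_max => /andP[/HN h1 /HM h2].
rewrite nmBC (le_lt_trans (nm_ReIm _))// rpD rpN ipD ipN.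
by move: h1 h2; set p := `|_|; set q := `|_|; lra.
Qed.

Lemma lim_to_limn u l : lim_to u l -> limn (u : nat -> R[i]^o) = l.
Proof.
move=> ul; have h : (u : nat -> R[i]^o) @ \oo --> (l : R[i]^o).
  apply/cvgrPdist_lt => e; rewrite ltcE /= => /andP[/eqP e0 e1].
  have [N HN] := (lim_toP u l).1 ul _ e1; exists N => // n /= /HN.
  by rewrite distrC nmE ltcE /= -e0 eqxx.
exact/cvg_lim.
Qed.

End Limits.

Section Series.
Context {R : realType}.
Implicit Types (u v : nat -> R[i]) (g h : nat -> R).

Definition csum u l := lim_to (fun N => \sum_(0 <= i < N) u i) l.

Definition rsummable g :=
  (forall n, 0 <= g n) /\ exists G, forall N, \sum_(0 <= i < N) g i <= G.

Lemma rsummableP g : rsummable g -> exists s,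
  [/\ (fun N => \sum_(0 <= i < N) g i) @ \oo --> (s : R), 0 <= s &
      forall N, \sum_(0 <= i < N) g i <= s].
Proof.
case=> g0 [G HG]; set u := (fun N => \sum_(0 <= i < N) g i : R).
have nd : nondecreasing_seq u by apply: nondecreasing_series => n _ _; apply: g0.
have cu : cvgn u by apply: nondecreasing_is_cvgn => //; exists G => _ [N _ <-]; apply: HG.
exists (limn u); have le N := nondecreasing_cvgn_le nd cu N.
by split=> //; have := le 0%N; rewrite /u big_geq.
Qed.

Lemma rsummable_le g h : (forall n, 0 <= g n) -> (forall n, g n <= h n) ->
  rsummable h -> rsummable g.
Proof.
move=> g0 gh [_ [G HG]]; split=> //; exists G => N.
by apply: le_trans (HG N); apply: ler_sum.
Qed.

Lemma rsummableZ c g : 0 <= c -> rsummable g -> rsummable (fun n => c * g n).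
Proof.
move=> c0 [g0 [G HG]]; split=> [n|]; first by rewrite mulr_ge0.
by exists (c * G) => N; rewrite -mulr_sumr ler_wpM2l.
Qed.

Lemma csum_exists u g : rsummable g -> (forall n, nm (u n) <= g n) ->
  exists l, csum u l.
Proof.
move=> [g0 [G HG]] ug.
have main (p : R[i] -> R) : (forall x, `|p x| <= nm x) ->
    cvgn (series (p \o u)).
  move=> hp; apply: normed_cvg; apply: nondecreasing_is_cvgn.
    by apply: nondecreasing_series => n _ _; apply: normr_ge0.
  exists G => _ [N _ <-]; apply: le_trans (HG N).
  by apply: ler_sum => i _; apply: le_trans (ug i); apply: hp.
have hr := main _ nm_Re; have hi := main _ nm_Im.
exists (limn (series (@rp R \o u)) +i* limn (series (@ip R \o u))).
apply: lim_to_Re_Im => /=.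
  by under eq_fun do rewrite rp_sum.
by under eq_fun do rewrite ip_sum.
Qed.

Lemma csum_unique u l m : csum u l -> csum u m -> l = m.
Proof. exact: lim_to_unique. Qed.

Lemma csum_ext u v l : (forall n, u n = v n) -> csum u l -> csum v l.
Proof. by move=> /funext ->. Qed.

Lemma csumD u v l m : csum u l -> csum v m -> csum (fun n => u n + v n) (l + m).
Proof.
move=> /lim_toD/[apply]; apply: lim_to_near; apply: nearW => N /=.
by rewrite -big_split.
Qed.

Lemma csumZ c u l : csum u l -> csum (fun n => c * u n) (c * l).
Proof.
move=> /(lim_toZ c); apply: lim_to_near; apply: nearW => N /=.
by rewrite mulr_sumr.
Qed.

Lemma csumN u l : csum u l -> csum (fun n => - u n) (- l).
Proof.
by move=> /(csumZ (-1)); rewrite mulN1r; apply: csum_ext => n; rewrite mulN1r.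
Qed.

Lemma csumB u v l m : csum u l -> csum v m -> csum (fun n => u n - v n) (l - m).
Proof. by move=> h /csumN; apply: csumD. Qed.

Lemma csum_le u l g G : (forall n, nm (u n) <= g n) ->
  (forall N, \sum_(0 <= i < N) g i <= G) -> csum u l -> nm l <= G.
Proof.
move=> ug HG ul; rewrite -(subr0 l); apply: (lim_to_le _ ul); apply: nearW => N.
rewrite subr0 (le_trans (nm_sum _ _ _))//; apply: le_trans (HG N).
exact: ler_sum.
Qed.

Lemma lim_to_sum (n : nat) (u : nat -> nat -> R[i]) (l : nat -> R[i]) :
  (forall i, lim_to (u i) (l i)) ->
  lim_to (fun N => \sum_(0 <= i < n) u i N) (\sum_(0 <= i < n) l i).
Proof.
move=> ul; elim: n => [|n IH].
  rewrite big_geq//; under eq_fun do rewrite big_geq//; exact: lim_to_cst.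
rewrite big_nat_recr//=; under eq_fun do rewrite big_nat_recr//=.
exact: lim_toD.
Qed.

Lemma csum0 u l : csum u l -> csum (fun n => u n.+1) (l - u 0%N).
Proof.
move=> /(lim_to_shift 1) h; have := lim_toB h (lim_to_cst (u 0%N)).
apply: lim_to_near; apply: nearW => N /=.
by rewrite addn1 big_nat_recl//= addrC addKr.
Qed.

Lemma csum_recl u l : csum (fun n => u n.+1) l -> csum u (u 0%N + l).
Proof.
move=> h; apply: (@lim_to_unshift _ _ _ 1).
apply: lim_to_near (lim_toD (lim_to_cst (u 0%N)) h); apply: nearW => N /=.
by rewrite addn1 big_nat_recl.
Qed.

End Series.

Section Fubini.
Context {R : realType}.
Variables (a : nat -> nat -> R[i]) (g h : nat -> R).
Hypothesis (gs : rsummable g) (hs : rsummable h).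
Hypothesis adom : forall m n, nm (a m n) <= g m * h n.

Let sq N := \sum_(0 <= m < N) \sum_(0 <= n < N) a m n.

Lemma square_sum_cvg : exists L, lim_to sq L.
Proof.
case: (gs) => g0 [G HG]; case: (hs) => h0 [H HH].
pose GH N := (\sum_(0 <= m < N) g m) * (\sum_(0 <= n < N) h n).
have [||L HL] := @csum_exists _ (fun N => sq N.+1 - sq N)
    (fun N => GH N.+1 - GH N).
- split=> [n|].
    rewrite /GH subr_ge0 ler_pM ?sumr_ge0//.
      by rewrite big_nat_recr//= lerDl.
    by rewrite big_nat_recr//= lerDl.
  exists (G * H) => N; rewrite telescope_sumr// {2}/GH !big_geq// mul0r subr0.
  by rewrite ler_pM// sumr_ge0.
- move=> N; rewrite /sq /GH big_nat_recr//=.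
  under eq_bigr do rewrite big_nat_recr//=.
  rewrite big_split/=.
  set S := \sum_(0 <= m < N) \sum_(0 <= n < N) a m n.
  set T := \sum_(0 <= m < N) a m N; set U := \sum_(0 <= n < N.+1) a N n.
  have -> : S + T + U - S = T + U by ring.
  rewrite /T /U [\sum_(0 <= i < N.+1) g i]big_nat_recr//=.
  rewrite [\sum_(0 <= i < N.+1) h i]big_nat_recr//=.
  set gg := \sum_(_ <= _ < _) g _; set hh := \sum_(_ <= _ < _) h _.
  have -> : (gg + g N) * (hh + h N) - gg * hh = gg * h N + (g N * hh + g N * h N).
    by ring.
  rewrite (le_trans (nmD _ _))// lerD//.
    rewrite (le_trans (nm_sum _ _ _))// mulr_suml.
    by apply: ler_sum => i _; apply: adom.
  rewrite big_nat_recr//= (le_trans (nmD _ _))// lerD//.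
  rewrite (le_trans (nm_sum _ _ _))// mulr_sumr.
  by apply: ler_sum => i _; apply: adom.
exists L; apply: lim_to_near HL; apply: nearW => N.
by rewrite telescope_sumr// {2}/sq big_geq// subr0.
Qed.

Lemma row_sum_cvg (A : nat -> R[i]) L : (forall m, csum (a m) (A m)) ->
  lim_to sq L -> csum A L.
Proof.
move=> HA HL; have [G [_ G0 HG]] := rsummableP gs.
have [H [cH H0 HH]] := rsummableP hs.
have g0 := gs.1; have h0 := hs.1.
have key : lim_to (fun M => (\sum_(0 <= m < M) A m) - sq M) 0.
  apply: (@lim_to_squeeze _ _ _ (fun M => G * (H - \sum_(0 <= n < M) h n))).
    apply: nearW => M; rewrite subr0.
    have h1 : lim_to (fun N => \sum_(0 <= m < M) \sum_(0 <= n < N) a m n)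
        (\sum_(0 <= m < M) A m).
      by apply: lim_to_sum.
    apply: (lim_to_le _ h1); exists M => // N /= MN.
    rewrite /sq -sumrB (le_trans (nm_sum _ _ _))//.
    apply: (@le_trans _ _ (\sum_(0 <= m < M) g m * (H - \sum_(0 <= n < M) h n))).
      apply: ler_sum => m _; rewrite (@big_cat_nat _ _ _ M)//= addrAC subrr add0r.
      rewrite (le_trans (nm_sum _ _ _))//.
      apply: (@le_trans _ _ (\sum_(M <= n < N) g m * h n)).
        by apply: ler_sum => n _.
      rewrite -mulr_sumr ler_wpM2l// lerBrDl.
      by apply: le_trans (HH N); rewrite [leRHS](@big_cat_nat _ _ _ M).
    by rewrite -mulr_suml ler_wpM2r ?subr_ge0.
  have : (fun M => G * (H - \sum_(0 <= n < M) h n)) @ \oo --> G * (H - H).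
    by apply: cvgM; [exact: cvg_cst|apply: cvgB => //; exact: cvg_cst].
  by rewrite subrr mulr0.
have := lim_toD key HL; rewrite add0r; apply: lim_to_near.
by apply: nearW => M /=; rewrite subrK.
Qed.

End Fubini.

Lemma csum_exchange {R : realType} (a : nat -> nat -> R[i]) (g h : nat -> R)
    (A B : nat -> R[i]) : rsummable g -> rsummable h ->
  (forall m n, nm (a m n) <= g m * h n) ->
  (forall m, csum (a m) (A m)) -> (forall n, csum (a^~ n) (B n)) ->
  exists L, [/\ csum A L, csum B L &
    lim_to (fun N => \sum_(0 <= m < N) \sum_(0 <= n < N) a m n) L].
Proof.
move=> gs hs ad HA HB; have [L HL] := square_sum_cvg gs hs ad.
exists L; split=> //; first exact: (row_sum_cvg gs hs ad HA HL).
apply: (@row_sum_cvg _ (fun n m => a m n) h g) => //.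
  by move=> m n; rewrite mulrC.
by apply: lim_to_near HL; apply: nearW => N; rewrite exchange_big.
Qed.

Section Calculus.
Context {R : realType}.
Implicit Types (F G : R[i] -> R[i]) (z d : R[i]).

(* A quadratic bound on the error is stronger than differentiability; it holds
   for all functions considered here and is preserved by the usual rules. *)
Definition cder F z d := exists K e : R, [/\ 0 < e, 0 <= K &
  forall h, nm h <= e -> nm (F (z + h) - F z - d * h) <= K * nm h ^+ 2].

Lemma cder_lip F z d : cder F z d -> exists K e : R, [/\ 0 < e, 0 <= K &
  forall h, nm h <= e -> nm (F (z + h) - F z) <= K * nm h].
Proof.
move=> [K [e [e0 K0 H]]]; exists (K * e + nm d), e; split=> //.
  by rewrite addr_ge0 ?nm_ge0// mulr_ge0// ltW.
move=> h he; rewrite -(subrK (d * h) (_ - _)) (le_trans (nmD _ _))// mulrDl nmM lerD//.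
rewrite (le_trans (H _ he))// expr2 mulrA ler_wpM2r ?nm_ge0//.
by rewrite ler_wpM2l.
Qed.

Lemma cder_cst c z : cder (fun=> c) z 0.
Proof.
exists 0, 1; split=> // h _; by rewrite subrr mul0r subr0 nm0 mul0r.
Qed.

Lemma cder_id z : cder id z 1.
Proof.
exists 0, 1; split=> // h _; by rewrite /= mul1r addrAC addrK subrr nm0 mul0r.
Qed.

Lemma cderD F G z d d' : cder F z d -> cder G z d' ->
  cder (fun x => F x + G x) z (d + d').
Proof.
move=> [K [e [e0 K0 H]]] [K' [e' [e0' K0' H']]].
exists (K + K'), (Num.min e e'); split; rewrite ?lt_min ?e0 ?addr_ge0// => h.
rewrite le_min => /andP[/H h1 /H' h2]; rewrite [leRHS]mulrDl.
apply: le_trans (lerD h1 h2); apply: le_trans (nmD _ _).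
by rewrite le_eqVlt; apply/orP; left; apply/eqP; congr nm; ring.
Qed.

Lemma cderM F G z d d' : cder F z d -> cder G z d' ->
  cder (fun x => F x * G x) z (d * G z + F z * d').
Proof.
move=> dF dG; have [K1 [e1 [e10 K10 H1]]] := cder_lip dF.
have [K2 [e2 [e20 K20 H2]]] := cder_lip dG.
case: dF => [K [e [e0 K0 H]]]; case: dG => [K' [e' [e0' K0' H']]].
exists (K * nm (G z) + nm (F z) * K' + K1 * K2),
  (Num.min (Num.min e e') (Num.min e1 e2)).
split; rewrite ?lt_min ?e0 ?e0' ?e10//.
  by rewrite !addr_ge0// mulr_ge0// nm_ge0.
move=> h; rewrite !le_min => /andP[/andP[/H h1 /H' h2] /andP[/H1 h3 /H2 h4]].
have -> : F (z + h) * G (z + h) - F z * G z - (d * G z + F z * d') * h =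
  (F (z + h) - F z - d * h) * G z + F z * (G (z + h) - G z - d' * h)
  + (F (z + h) - F z) * (G (z + h) - G z) by ring.
rewrite (le_trans (nmD _ _))// [leRHS]mulrDl lerD//.
  rewrite (le_trans (nmD _ _))// [leRHS]mulrDl !nmM lerD//.
    by rewrite mulrAC ler_wpM2r ?nm_ge0.
  by rewrite -mulrA ler_wpM2l ?nm_ge0.
rewrite nmM; have := ler_pM (nm_ge0 _) (nm_ge0 _) h3 h4.
by move/le_trans; apply; rewrite mulrACA expr2.
Qed.

Lemma cderV z : z != 0 -> cder (fun x => x^-1) z (- (z ^+ 2)^-1).
Proof.
move=> z0; have nz : 0 < nm z by rewrite nm_gt0.
exists (2 / nm z ^+ 3), (nm z / 2); split; rewrite ?divr_gt0 ?divr_ge0 ?exprn_ge0 ?nm_ge0//.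
move=> h hz.
have zh : nm z / 2 <= nm (z + h).
  by apply: le_trans (nm_subl _ _); move: hz; set p := nm z; set p' := nm h; lra.
have zh0 : z + h != 0 by rewrite -nm_gt0 (lt_le_trans _ zh)// divr_gt0.
have -> : (z + h)^-1 - z^-1 - - (z ^+ 2)^-1 * h = h ^+ 2 / (z ^+ 2 * (z + h)).
  by field; rewrite ?z0 ?zh0.
rewrite nmf nmM !nmX mulrC ler_wpM2r ?exprn_ge0 ?nm_ge0//.
rewrite -[2]invrK -invfM lef_pV2 ?posrE ?mulr_gt0 ?exprn_gt0 ?invr_gt0 ?nm_gt0//.
by rewrite exprSr mulrCA ler_wpM2l ?exprn_ge0 ?nm_ge0// mulrC.
Qed.

Lemma cder_comp F G z d d' : cder F z d -> cder G (F z) d' ->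
  cder (fun x => G (F x)) z (d' * d).
Proof.
move=> dF [K' [e' [e0' K0' H']]].
have [K1 [e1 [e10 K10 H1]]] := cder_lip dF.
case: dF => [K [e [e0 K0 H]]].
exists (K' * K1 ^+ 2 + nm d' * K), (Num.min (Num.min e e1) (e' / (K1 + 1))).
have K11 : 0 < K1 + 1 by rewrite ltr_wpDl.
split; rewrite ?lt_min ?e0 ?e10 ?divr_gt0//.
  by rewrite !addr_ge0// mulr_ge0// ?exprn_ge0 ?nm_ge0.
move=> h; rewrite !le_min => /andP[/andP[/H h1 /H1 h3]].
rewrite ler_pdivlMr// => h4; set k := F (z + h) - F z in h1 h3 *.
have ke : nm k <= e'.
  apply: le_trans h3 (le_trans _ h4).
  by rewrite mulrDr mulr1 mulrC lerDl nm_ge0.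
have := H' _ ke; rewrite {1}/k [F z + _]addrC subrK => h5.
have -> : G (F (z + h)) - G (F z) - d' * d * h =
  (G (F (z + h)) - G (F z) - d' * k) + d' * (k - d * h) by ring.
rewrite (le_trans (nmD _ _))// [leRHS]mulrDl nmM lerD//.
  apply: le_trans h5 _; rewrite -mulrA -exprMn ler_wpM2l//.
  by rewrite lerXn2r ?nnegrE ?nm_ge0 ?mulr_ge0 ?nm_ge0.
by rewrite -mulrA ler_wpM2l ?nm_ge0.
Qed.

Lemma cder_eq F z d d' : cder F z d -> d = d' -> cder F z d'.
Proof. by move=> h <-. Qed.

Lemma cderZ c F z d : cder F z d -> cder (fun x => c * F x) z (c * d).
Proof.
by move=> h; apply: cder_eq (cderM (cder_cst c z) h) _; rewrite mul0r add0r.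
Qed.

Lemma cderN F z d : cder F z d -> cder (fun x => - F x) z (- d).
Proof.
move=> h; have -> : (fun x => - F x) = (fun x => (-1) * F x).
  by apply/funext => x; rewrite mulN1r.
by apply: cder_eq (cderZ _ h) _; rewrite mulN1r.
Qed.

Lemma cder_linear a b z : cder (fun x => a * x + b) z a.
Proof.
apply: cder_eq (cderD (cderZ a (cder_id z)) (cder_cst b z)) _.
by rewrite mulr1 addr0.
Qed.

Lemma real_quadratic_cst (g : R -> R) :
  (forall t : R, 0 <= t <= 1 -> exists K e : R, [/\ 0 < e, 0 <= K &
     forall s : R, `|s| <= e -> `|g (t + s) - g t| <= K * s ^+ 2]) -> g 1 = g 0.
Proof.
move=> H.
have dg (t : R) : 0 <= t <= 1 -> is_derive t 1 g 0.
  move=> /H[K [e [e0 K0 Ht]]].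
  have lim0 : (fun s => s^-1 *: ((g \o shift t) (s *: (1 : R)) - g t)) @ 0^' --> (0 : R).
    apply/cvgrPdist_le => r r0.
    have m0 : 0 < Num.min e (r / (K + 1)).
      by rewrite lt_min e0 divr_gt0// ltr_wpDl.
    exists (Num.min e (r / (K + 1))) => //= s /=.
    rewrite sub0r normrN lt_min => /andP[s1 s2] s0.
    have -> : s^-1 *: ((g \o shift t) (s *: (1 : R)) - g t) =
        s^-1 * (g (t + s) - g t).
      by rewrite /= /GRing.scale /= mulr1 [s + t]addrC.
    rewrite sub0r normrN normrM normrV ?unitfE//.
    rewrite ler_pdivrMl ?normr_gt0//.
    have := Ht s (ltW s1) => /le_trans; apply.
    rewrite -real_normK ?num_real// expr2 mulrCA ler_wpM2l//.
    have K1 : 0 < K + 1 by rewrite ltr_wpDl.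
    move: s2; rewrite ltr_pdivlMr// => /ltW; apply: le_trans.
    by rewrite mulrDr mulr1 mulrC lerDl.
  by split; [apply: cvgP lim0|apply: cvg_lim lim0].
have [||c _ ] := @MVT_segment R g (fun=> 0) 0 1 ler01.
- by move=> x; rewrite in_itv/= => /andP[x0 x1]; apply: dg; rewrite !ltW.
- apply: derivable_within_continuous => x; rewrite in_itv/= => x01.
  by case: (dg x x01).
- by rewrite mul0r => /eqP; rewrite subr_eq0 => /eqP.
Qed.

Lemma cder0_cst F z0 z1 :
  (forall t : R, 0 <= t <= 1 -> cder F (z0 + t%:C * (z1 - z0)) 0) -> F z1 = F z0.
Proof.
move=> H.
pose pth (t : R) := z0 + t%:C * (z1 - z0).
have main (p : R[i] -> R) : (forall x, `|p x| <= nm x) ->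
    (forall x y, p (x - y) = p x - p y) -> p (F z1) = p (F z0).
  move=> hp hB.
  have p1 : pth 1 = z1 by rewrite /pth mul1r addrC subrK.
  have p0 : pth 0 = z0 by rewrite /pth mul0r addr0.
  rewrite -p1 -p0.
  apply: (@real_quadratic_cst (fun t => p (F (pth t)))) => t /H[K [e [e0 K0 Ht]]].
  exists (K * nm (z1 - z0) ^+ 2), (e / (nm (z1 - z0) + 1)).
  have d1 : 0 < nm (z1 - z0) + 1 by rewrite ltr_wpDl ?nm_ge0.
  split; first by rewrite divr_gt0.
    by rewrite mulr_ge0// exprn_ge0 ?nm_ge0.
  move=> s; rewrite ler_pdivlMr// => hs.
  have hn : nm (s%:C * (z1 - z0)) = `|s| * nm (z1 - z0) by rewrite nmM nmC.
  have -> : pth (t + s) = pth t + s%:C * (z1 - z0).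
    by rewrite /pth rmorphD/= mulrDl addrA.
  rewrite -hB; apply: le_trans (hp _) _.
  have hse : nm (s%:C * (z1 - z0)) <= e.
    by rewrite hn; apply: le_trans hs; rewrite ler_wpM2l// lerDl.
  have := Ht _ hse; rewrite mul0r subr0 hn => /le_trans; apply.
  rewrite exprMn real_normK ?num_real//.
  by rewrite le_eqVlt; apply/orP; left; apply/eqP; ring.
apply: complex_eqP; apply: main => //.
- exact: nm_Re.
- by move=> x y; rewrite rpD rpN.
- exact: nm_Im.
- by move=> x y; rewrite ipD ipN.
Qed.

End Calculus.

(** * The complex exponential *)

Section RealBounds.
Context {R : realType}.
Implicit Types (a b t : R).

Lemma mvt_bound (g h : R -> R) (K M : R) (k : nat) :
  (forall x : R, is_derive x 1 g (h x)) -> g 0 = 0 ->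
  (forall t, `|t| <= M -> `|h t| <= K * `|t| ^+ k) -> 0 <= K ->
  forall t, `|t| <= M -> `|g t| <= K * `|t| ^+ k.+1.
Proof.
move=> dg g0 hK K0.
have cg : continuous g.
  by move=> x; apply/differentiable_continuous/derivable1_diffP; case: (dg x).
have key t c : `|c| <= `|t| -> g t = h c * t -> `|t| <= M ->
    `|g t| <= K * `|t| ^+ k.+1.
  move=> ct -> tM; rewrite normrM exprSr mulrA ler_wpM2r//.
  apply: le_trans (hK c (le_trans ct tM)) _.
  by rewrite ler_wpM2l// lerXn2r ?nnegrE.
move=> t tM; have [t0|t0] := leP 0 t.
  have [c] := MVT_segment t0 (fun x _ => dg x) (continuous_subspaceT cg).
  - rewrite in_itv/= => /andP[c0 ct]; rewrite g0 !subr0 => gE.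
    by apply: (key _ c) => //; rewrite !ger0_norm.
have [c] := MVT_segment (ltW t0) (fun x _ => dg x) (continuous_subspaceT cg).
- rewrite in_itv/= => /andP[c0 ct]; rewrite g0 !sub0r mulrN => /oppr_inj gE.
  apply: (key _ c) => //; rewrite !ler0_norm//; last exact: ltW.
  by rewrite lerN2.
Qed.

Lemma sin_bound1 b : `|sin b| <= `|b|.
Proof.
have dg (x : R) : is_derive x 1 (@sin R) (cos x) by apply: is_derive_sin.
rewrite -[leRHS]mul1r -[`|b|]expr1; apply: (mvt_bound dg (sin0 _) _ ler01 (lexx _)).
by move=> t _; rewrite expr0 mul1r cos_max.
Qed.

Lemma cos_bound2 b : `|cos b - 1| <= `|b| ^+ 2.
Proof.
have dg (x : R) : is_derive x 1 (fun x => cos x - 1 : R) (- sin x).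
  by apply: is_derive_eq; rewrite subr0.
have g0 : cos 0 - 1 = 0 :> R by rewrite cos0 subrr.
rewrite -[leRHS]mul1r; apply: (mvt_bound dg g0 _ ler01 (lexx _)).
by move=> t _; rewrite expr1 mul1r normrN sin_bound1.
Qed.

Lemma sin_bound3 b : `|sin b - b| <= `|b| ^+ 3.
Proof.
have dg (x : R) : is_derive x 1 (fun x => sin x - x : R) (cos x - 1).
  by apply: is_derive_eq.
have g0 : sin 0 - 0 = 0 :> R by rewrite sin0 subrr.
rewrite -[leRHS]mul1r; apply: (mvt_bound dg g0 _ ler01 (lexx _)).
by move=> t _; rewrite mul1r cos_bound2.
Qed.

Lemma cos_bound4 b : `|cos b - 1 + b ^+ 2 / 2| <= `|b| ^+ 4.
Proof.
have dg (x : R) : is_derive x 1 (fun x => cos x - 1 + x ^+ 2 / 2 : R) (x - sin x).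
  by apply: is_derive_eq; rewrite /GRing.scale/=; field.
have g0 : cos 0 - 1 + 0 ^+ 2 / 2 = 0 :> R.
  by rewrite cos0 subrr expr0n mul0r addr0.
rewrite -[leRHS]mul1r; apply: (mvt_bound dg g0 _ ler01 (lexx _)).
by move=> t _; rewrite mul1r distrC sin_bound3.
Qed.

Lemma expR_bound1 M a : 0 <= M -> `|a| <= M -> `|expR a - 1| <= expR M * `|a|.
Proof.
move=> M0 aM.
have dg (x : R) : is_derive x 1 (fun x => expR x - 1 : R) (expR x).
  by apply: is_derive_eq; rewrite subr0.
have g0 : expR 0 - 1 = 0 :> R by rewrite expR0 subrr.
rewrite -[`|a|]expr1; apply: (mvt_bound dg g0 _ (expR_ge0 _) aM) => t tM.
by rewrite expr0 mulr1 ger0_norm ?expR_ge0// ler_expR (le_trans (ler_norm _)).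
Qed.

Lemma expR_bound2 M a : 0 <= M -> `|a| <= M ->
  `|expR a - 1 - a| <= expR M * `|a| ^+ 2.
Proof.
move=> M0 aM.
have dg (x : R) : is_derive x 1 (fun x => expR x - 1 - x : R) (expR x - 1).
  by apply: is_derive_eq; rewrite subr0.
have g0 : expR 0 - 1 - 0 = 0 :> R by rewrite expR0 !subr0 subrr.
apply: (mvt_bound dg g0 _ (expR_ge0 _) aM) => t tM.
by rewrite expr1 expR_bound1.
Qed.

Lemma expR_bound3 M a : 0 <= M -> `|a| <= M ->
  `|expR a - 1 - a - a ^+ 2 / 2| <= expR M * `|a| ^+ 3.
Proof.
move=> M0 aM.
have dg (x : R) : is_derive x 1 (fun x => expR x - 1 - x - x ^+ 2 / 2 : R) (expR x - 1 - x).
  by apply: is_derive_eq; rewrite /GRing.scale/=; field.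
have g0 : expR 0 - 1 - 0 - 0 ^+ 2 / 2 = 0 :> R.
  by rewrite expR0 expr0n mul0r !subr0 subrr.
apply: (mvt_bound dg g0 _ (expR_ge0 _) aM) => t tM.
exact: expR_bound2.
Qed.

Lemma sin_ge_half a : 0 <= a <= pi / 2 -> a / 2 <= sin a.
Proof.
move=> /andP[a0 api]; have a2 : 0 <= a / 2 by rewrite divr_ge0.
have pi0 := @pi_ge0 R.
have [c] := MVT_segment a2 (fun x _ => is_derive_sin x)
  (continuous_subspaceT (@continuous_sin R)).
rewrite in_itv/= sin0 !subr0 => /andP[c0 ca] E.
have cc : cos (a / 2) <= cos c.
  have [->//|ca'] := eqVneq c (a / 2).
  by apply/ltW; rewrite ltr_cos ?in_itv/= ?lt_neqAle ?ca' ?ca//; apply/andP; split; lra.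
have aE : a = (a / 2) *+ 2 by rewrite mulr2n; field.
have sE : sin a = cos (a / 2) * sin (a / 2) + cos (a / 2) * sin (a / 2).
  by rewrite {1}aE sin_mulr2n mulr2n.
have h0 : 0 <= cos (a / 2) by apply: cos_ge0_pihalf; apply/andP; split; lra.
have ha : 0 <= cos a by apply: cos_ge0_pihalf; apply/andP; split; lra.
have ha2 : cos a = cos (a / 2) ^+ 2 + cos (a / 2) ^+ 2 - 1.
  by rewrite -mulr2n -cos_mulr2n -aE.
have h1 : cos (a / 2) ^+ 2 <= cos (a / 2) * cos c by rewrite expr2 ler_wpM2l.
rewrite sE E; move: ha ha2 h1; set p := cos (a / 2); set qq := cos c => h2 h3 h4.
have : a / 2 * (1 / 2) <= a / 2 * (p * qq) by apply: ler_wpM2l => //; lra.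
lra.
Qed.

Lemma expR_sub_ge b : b ^+ 2 <= (expR b - expR (- b)) ^+ 2.
Proof.
wlog b0 : b / 0 <= b.
  move=> H; have [/H//|b0] := leP 0 b.
  have -> : expR b - expR (- b) = - (expR (- b) - expR (- - b)) by rewrite opprK opprB.
  by rewrite sqrrN -[b ^+ 2]sqrrN; apply: H; rewrite oppr_ge0 ltW.
rewrite lerXn2r ?nnegrE//.
  by rewrite subr_ge0 ler_expR; lra.
have := expR_ge1Dx b; have : expR (- b) <= 1 by rewrite expR_le1; lra.
lra.
Qed.

End RealBounds.

Section ComplexExp.
Context {R : realType}.
Implicit Types (z v w : R[i]).

Lemma cexpE z : cexp z = (expR (rp z))%:C * (cos (ip z) +i* sin (ip z)).
Proof. by []. Qed.

Lemma cexpD z w : cexp (z + w) = cexp z * cexp w.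
Proof.
by rewrite !cexpE; apply: complex_eqP; rewrite !(rpM, ipM) !(rpD, ipD) expRD /= ?cosD ?sinD; ring.
Qed.

Lemma cexp0 : cexp (0 : R[i]) = 1.
Proof. by rewrite cexpE /= expR0 cos0 sin0 mul1r. Qed.

Lemma cexpNM z : cexp (- z) * cexp z = 1.
Proof. by rewrite -cexpD addNr cexp0. Qed.

Lemma cexp_neq0 z : cexp z != 0.
Proof.
apply/eqP => h; have := cexpNM z; rewrite h mulr0 => /esym/eqP.
by rewrite oner_eq0.
Qed.

Lemma cexpN z : cexp (- z) = (cexp z)^-1.
Proof. by apply: (mulIf (cexp_neq0 z)); rewrite cexpNM mulVf ?cexp_neq0. Qed.

Lemma cexpMn z n : cexp (n%:R * z) = cexp z ^+ n.
Proof.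
elim: n => [|n IH]; first by rewrite mul0r cexp0.
by rewrite exprS -IH -natr1 mulrDl mul1r addrC cexpD.
Qed.

Lemma nm_cexp z : nm (cexp z) = expR (rp z).
Proof.
rewrite cexpE nmM nmC ger0_norm ?expR_ge0// nm_def /= cos2Dsin2 sqrtr1 mulr1//.
Qed.

Lemma cexp_taylor3 (M : R) : 0 <= M -> exists K : R, 0 <= K /\
  forall v, nm v <= M -> nm (cexp v - 1 - v - v ^+ 2 / 2) <= K * nm v ^+ 3.
Proof.
move=> M0; pose E := expR M.
have E0 : 0 <= E by apply: expR_ge0.
exists (E * M + E + E + E + E); split; first by rewrite !addr_ge0 ?mulr_ge0.
move=> v vM; set a := rp v; set b := ip v.
set r := nm v in vM *; have r0 : 0 <= r by apply: nm_ge0.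
have ar : `|a| <= r by apply: nm_Re.
have br : `|b| <= r by apply: nm_Im.
have aM := le_trans ar vM; have bM := le_trans br vM.
have eM : expR a <= E by rewrite ler_expR (le_trans (ler_norm _)).
have Xr (x : R) k : `|x| <= r -> `|x| ^+ k <= r ^+ k.
  by move=> xr; rewrite lerXn2r ?nnegrE.
have half z : (z / 2 : R[i]) = (2^-1)%:C * z.
  by rewrite mulrC -[2]real_complex_nat -fmorphV.
have Re2 : rp (v ^+ 2 / 2) = (a ^+ 2 - b ^+ 2) / 2.
  by rewrite half expr2 !(rpM, ipM) /= -/a -/b; field.
have Im2 : ip (v ^+ 2 / 2) = a * b.
  by rewrite half expr2 !(rpM, ipM) /= -/a -/b; field.
have e1 : `|expR a * (cos b - 1 + b ^+ 2 / 2)| <= E * M * r ^+ 3.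
  rewrite normrM ger0_norm ?expR_ge0// -mulrA.
  apply: ler_pM => //.
  apply: le_trans (cos_bound4 b) _; rewrite [`|b| ^+ 4]exprS.
  by apply: ler_pM => //; rewrite ?exprn_ge0// Xr.
have e2 : `|expR a - 1 - a - a ^+ 2 / 2| <= E * r ^+ 3.
  apply: le_trans (expR_bound3 M0 aM) _.
  by rewrite ler_wpM2l ?expR_ge0 ?Xr.
have e3 : `|(expR a - 1) * (b ^+ 2 / 2)| <= E * r ^+ 3.
  rewrite normrM [r ^+ 3]exprS mulrA; apply: ler_pM => //.
    apply: le_trans (expR_bound1 M0 aM) _.
    by rewrite ler_wpM2l ?expR_ge0.
  rewrite normrM normrX [`|_^-1|]ger0_norm ?invr_ge0//.
  have := Xr _ 2%N br; have : 0 <= `|b| ^+ 2 by rewrite exprn_ge0.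
  lra.
have e4 : `|expR a * (sin b - b)| <= E * r ^+ 3.
  rewrite normrM ger0_norm ?expR_ge0//; apply: ler_pM => //.
  by apply: le_trans (sin_bound3 b) _; rewrite Xr.
have e5 : `|(expR a - 1 - a) * b| <= E * r ^+ 3.
  rewrite normrM exprSr mulrA; apply: ler_pM => //.
  apply: le_trans (expR_bound2 M0 aM) _.
  by rewrite ler_wpM2l ?expR_ge0 ?Xr.
have HR : rp (cexp v - 1 - v - v ^+ 2 / 2) =
  expR a * (cos b - 1 + b ^+ 2 / 2) + (expR a - 1 - a - a ^+ 2 / 2)
  - (expR a - 1) * (b ^+ 2 / 2).
  by rewrite cexpE !(rpD, rpN) Re2 rpM /= -/a -/b; field.
have HI : ip (cexp v - 1 - v - v ^+ 2 / 2) =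
  expR a * (sin b - b) + (expR a - 1 - a) * b.
  by rewrite cexpE !(ipD, ipN) Im2 ipM /= -/a -/b; field.
apply: le_trans (nm_ReIm _) _; rewrite HR HI.
apply: le_trans (lerD (ler_normB _ _) (ler_normD _ _)) _.
have := ler_normD (expR a * (cos b - 1 + b ^+ 2 / 2)) (expR a - 1 - a - a ^+ 2 / 2).
move: e1 e2 e3 e4 e5; lra.
Qed.

Lemma cder_cexp z : cder (@cexp R) z (cexp z).
Proof.
have [K [K0 HK]] := @cexp_taylor3 1 ler01.
exists (nm (cexp z) * (K + 1)), 1; split=> //.
  by rewrite mulr_ge0 ?nm_ge0// addr_ge0.
move=> h h1; have -> : cexp (z + h) - cexp z - cexp z * h =
    cexp z * ((cexp h - 1 - h - h ^+ 2 / 2) + h ^+ 2 / 2).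
  by rewrite cexpD; field.
rewrite nmM -mulrA ler_wpM2l ?nm_ge0// (le_trans (nmD _ _))// mulrDl mul1r lerD//.
  apply: le_trans (HK h h1) _; rewrite ler_wpM2l// exprS ler_piMl//.
  by rewrite exprn_ge0// nm_ge0.
rewrite nmf nmX nmn ler_pdivrMr// ler_peMr ?exprn_ge0 ?nm_ge0//.
by rewrite ler1n.
Qed.

Definition ee z : R[i] := cexp (2 * pi%:C * 'i%C * z).

Lemma eeD z w : ee (z + w) = ee z * ee w.
Proof. by rewrite /ee mulrDr cexpD. Qed.

Lemma ee_neq0 z : ee z != 0. Proof. exact: cexp_neq0. Qed.

Lemma eeN z : ee (- z) = (ee z)^-1. Proof. by rewrite /ee mulrN cexpN. Qed.

Lemma eeMn n z : ee (n%:R * z) = ee z ^+ n.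
Proof. by rewrite /ee mulrCA cexpMn. Qed.

Lemma ee_term m z : cexp (2 * pi%:C * 'i%C * m%:R * z) = ee z ^+ m.
Proof. by rewrite -eeMn /ee mulrA. Qed.

Lemma ee1 : ee 1 = 1.
Proof.
rewrite /ee mulr1 cexpE -real_complex_nat !(rpM, ipM) /= !(mulr0, mul0r, subr0, addr0, mulr1).
by rewrite expR0 mul1r mulr_natl cos2pi sin2pi.
Qed.

Lemma ee_half : ee (1 / 2) = -1.
Proof.
rewrite /ee; have -> : 2 * pi%:C * 'i%C * (1 / 2) = pi%:C * 'i%C :> R[i] by field.
rewrite cexpE !(rpM, ipM) /= !(mulr0, mul0r, subr0, addr0, mulr1).
rewrite expR0 mul1r cospi sinpi; by apply: complex_eqP; rewrite /= ?oppr0.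
Qed.

Lemma ee_int (k : int) : ee k%:~R = 1.
Proof.
case: k => n; first by rewrite -[n%:~R]mulr1 -pmulrn eeMn ee1 expr1n.
by rewrite NegzE mulrNz eeN -[n.+1%:~R]mulr1 -pmulrn eeMn ee1 expr1n invr1.
Qed.

Lemma eeDint z (k : int) : ee (z + k%:~R) = ee z.
Proof. by rewrite eeD ee_int mulr1. Qed.

Lemma nm_ee z : nm (ee z) = expR (- (2 * pi * ip z)).
Proof.
rewrite nm_cexp; congr expR; rewrite -real_complex_nat !(rpM, ipM) /=; ring.
Qed.

Lemma nm_ee_lt1 z : 0 < ip z -> nm (ee z) < 1.
Proof.
by move=> z0; rewrite nm_ee expR_lt1 oppr_lt0 !mulr_gt0// pi_gt0.
Qed.

Lemma cder_ee z : cder (@ee) z (2 * pi%:C * 'i%C * ee z).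
Proof.
have h := cder_comp (cder_linear (2 * pi%:C * 'i%C) 0 z) (@cder_cexp _).
have E : (fun x => cexp (2 * pi%:C * 'i%C * x + 0)) = ee.
  by apply/funext => x; rewrite addr0.
by rewrite E in h; apply: cder_eq h _; rewrite addr0 mulrC.
Qed.

Definition csin v : R[i] := (cexp ('i%C * v) - cexp (- ('i%C * v))) / (2 * 'i%C).

Lemma i_neq0 : 'i%C != 0 :> R[i].
Proof. by rewrite -nm_eq0 nmi oner_eq0. Qed.

Lemma csin_ge v : `|rp v| <= pi / 2 -> nm v / 2 <= nm (csin v).
Proof.
move=> hv; set a := rp v in hv *; set b := ip v.
rewrite -(@ler_pXn2r _ 2)// ?nnegrE ?nm_ge0 ?divr_ge0 ?nm_ge0//.
rewrite exprMn nm_sqr nmf [X in _ <= X]exprMn nm_sqr nmM nmn nmi mulr1.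
rewrite !cexpE !(rpD, ipD, rpN, ipN) !(rpM, ipM, rpN, ipN) /= -/a -/b.
rewrite !(mulr0, mul0r, mul1r, sub0r, addr0, subr0, add0r, opprK, cosN, sinN).
have h1 := expR_sub_ge b.
have h2 : a ^+ 2 <= 4 * sin a ^+ 2.
  have [a0|a0] := leP 0 a.
    have : a / 2 <= sin a by apply: sin_ge_half; rewrite a0 (le_trans (ler_norm _)).
    by move=> h; have : 0 <= (2 * sin a - a) * (2 * sin a + a); [apply: mulr_ge0; lra|nra].
  have : (- a) / 2 <= sin (- a).
    by apply: sin_ge_half; rewrite oppr_ge0 ltW//= -ler0_norm// ltW.
  rewrite sinN => h.
  by have : 0 <= (- 2 * sin a + a) * (- 2 * sin a - a); [apply: mulr_ge0; lra|nra].
have h3 := expRxMexpNx_1 b; have h4 := cos2Dsin2 a.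
have := expR_gt0 b; have := expR_gt0 (- b).
move: h1 h2 h3 h4; set p := expR b; set p' := expR (- b); set s := sin a; set c := cos a.
move=> h1 h2 h3 h4 _ _.
have -> : (p' * c - p * c) ^+ 2 + (p' * s - p * - s) ^+ 2 =
    (p - p') ^+ 2 * (c ^+ 2 + s ^+ 2) + 4 * (p * p') * s ^+ 2 by ring.
rewrite h3 h4; lra.
Qed.

Lemma csin_taylor (M : R) : 0 <= M -> exists K : R, 0 <= K /\
  forall v, nm v <= M -> nm (v - csin v) <= K * nm v ^+ 3.
Proof.
move=> /cexp_taylor3[K [K0 HK]]; exists K; split=> // v vM.
set f1 := cexp ('i%C * v) - 1 - 'i%C * v - ('i%C * v) ^+ 2 / 2.
set f2 := cexp (- ('i%C * v)) - 1 - - ('i%C * v) - (- ('i%C * v)) ^+ 2 / 2.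
have -> : v - csin v = (f2 - f1) / (2 * 'i%C).
  by rewrite /csin /f1 /f2; field; exact: i_neq0.
rewrite nmf nmM nmn nmi mulr1 ler_pdivrMr//.
have h1 : nm f1 <= K * nm v ^+ 3.
  by apply: le_trans (HK _ _) _; rewrite nmM nmi mul1r.
have h2 : nm f2 <= K * nm v ^+ 3.
  by apply: le_trans (HK _ _) _; rewrite nmN nmM nmi mul1r.
apply: le_trans (nmB _ _) _; lra.
Qed.

(* Closed form of the sum of the (w + n)^-2 over all integers n, that is
   (pi / sin (pi w))^2, as a rational function of ee w. *)
Definition sqc w : R[i] := - (4 * pi%:C ^+ 2) * (ee w / (1 - ee w) ^+ 2).

Lemma i2 : 'i%C * 'i%C = -1 :> R[i].
Proof. by rewrite -expr2 sqr_i. Qed.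

Lemma sqcE w : sqc w = pi%:C ^+ 2 / csin (pi%:C * w) ^+ 2.
Proof.
rewrite /sqc /csin; set t := cexp ('i%C * (pi%:C * w)).
have t0 : t != 0 by apply: cexp_neq0.
have -> : ee w = t ^+ 2.
  by rewrite /ee /t -cexpMn; congr cexp; ring.
rewrite cexpN -/t expr_div_n [(2 * 'i%C) ^+ 2]exprMn sqr_i.
have -> : t - t^-1 = - (1 - t ^+ 2) / t by field.
have [->|t1] := eqVneq (1 - t ^+ 2) 0.
  by rewrite !(expr0n, invr0, mulr0, mul0r, oppr0).
by field; rewrite t1 t0.
Qed.

Lemma sqc_near : exists K : R, 0 <= K /\ forall u, u != 0 ->
  `|rp u| <= 1 / 2 -> `|ip u| <= 1 ->
  nm (sqc u - (u ^+ 2)^-1) <= K.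
Proof.
have [K [K0 HK]] := @csin_taylor (pi * 2) (mulr_ge0 (@pi_ge0 R) (ler0n _ 2)).
exists (pi ^+ 2 * (4 * K * (2 + K * (pi * 2) ^+ 2))); split.
  by do ?[done|exact: pi_ge0|apply: mulr_ge0|apply: addr_ge0|apply: exprn_ge0].
move=> u u0 h1 h2.
have pi0 : 0 < pi :> R by apply: pi_gt0.
set v := pi%:C * u.
have pc0 : pi%:C != 0 :> R[i] by apply/eqP => -[] /eqP; rewrite gt_eqF.
have v0 : v != 0 by rewrite mulf_neq0.
have nv : 0 < nm v by rewrite nm_gt0.
have vM : nm v <= pi * 2.
  rewrite nmM nmC ger0_norm ?pi_ge0// ler_wpM2l ?pi_ge0//.
  by apply: le_trans (nm_ReIm _) _; lra.
have hs : nm v / 2 <= nm (csin v).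
  apply: csin_ge; rewrite rpM /= mul0r subr0 normrM ger0_norm ?pi_ge0//.
  by rewrite ler_wpM2l ?pi_ge0// -div1r.
have s0 : csin v != 0 by rewrite -nm_gt0 (lt_le_trans _ hs)// divr_gt0.
have ns : 0 < nm (csin v) by rewrite nm_gt0.
have -> : sqc u - (u ^+ 2)^-1 =
    pi%:C ^+ 2 * ((v - csin v) * (v + csin v) / (v ^+ 2 * csin v ^+ 2)).
  have -> : (u ^+ 2)^-1 = pi%:C ^+ 2 / v ^+ 2.
    by rewrite /v exprMn [X in _ * X]invfM [RHS]mulrA mulfV ?mul1r// expf_neq0.
  by rewrite sqcE -/v; field; rewrite v0 s0.
rewrite nmM nmX nmC ger0_norm ?pi_ge0// ler_wpM2l ?exprn_ge0 ?pi_ge0//.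
rewrite nmf ler_pdivrMr; last first.
  by rewrite nmM !nmX mulr_gt0// exprn_gt0.
have hK := HK _ vM.
have hD : nm (v + csin v) <= nm v * (2 + K * (pi * 2) ^+ 2).
  have -> : v + csin v = 2 * v - (v - csin v) by ring.
  apply: le_trans (nmB _ _) _; rewrite nmM nmn mulrDr mulrC lerD//.
  apply: le_trans hK _; rewrite [leRHS]mulrCA; apply: ler_wpM2l => //.
  rewrite [nm v ^+ 3]exprS; apply: ler_wpM2l; first exact: nm_ge0.
  by rewrite lerXn2r ?nnegrE ?nm_ge0// (le_trans (nm_ge0 v)).
rewrite nmM [nm (v ^+ 2 * _)]nmM !nmX.
apply: le_trans (ler_pM (nm_ge0 _) (nm_ge0 _) hK hD) _.
have -> : K * nm v ^+ 3 * (nm v * (2 + K * (pi * 2) ^+ 2)) =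
  4 * K * (2 + K * (pi * 2) ^+ 2) * (nm v ^+ 2 * (nm v / 2) ^+ 2) by field.
rewrite ler_wpM2l//.
  by do ?[done|exact: pi_ge0|apply: mulr_ge0|apply: addr_ge0|apply: exprn_ge0].
rewrite ler_wpM2l ?exprn_ge0 ?nm_ge0//.
by rewrite lerXn2r ?nnegrE ?nm_ge0 ?divr_ge0 ?nm_ge0.
Qed.

End ComplexExp.

(** * Lipschitz summation formulas *)

Section Bilateral.
Context {R : realType}.
Implicit Types (z v w : R[i]) (a : R[i] -> R[i]) (g : nat -> R).

Lemma rsummable_unshift g k : (forall n, 0 <= g n) ->
  rsummable (fun n => g (n + k)%N) -> rsummable g.
Proof.
move=> g0 [_ [G HG]]; split=> //; exists (\sum_(0 <= i < k) g i + G) => N.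
have G0 : 0 <= G by have := HG 0%N; rewrite big_geq.
have [Nk|/ltnW kN] := leqP N k.
  apply: (@le_trans _ _ (\sum_(0 <= i < k) g i)); last by rewrite lerDl.
  by rewrite [leRHS](@big_cat_nat _ _ _ N)//= lerDl sumr_ge0.
rewrite (@big_cat_nat _ _ _ k)//= lerD2l -{1}[k]add0n big_addn.
exact: HG.
Qed.

Lemma rsummable_inv2 : rsummable (fun n => (n.+1%:R ^+ 2)^-1 : R).
Proof.
split=> [n|]; first by rewrite invr_ge0 exprn_ge0.
have key N : \sum_(0 <= i < N.+1) (i.+1%:R ^+ 2)^-1 <= 2 - (N.+1%:R)^-1 :> R.
  elim: N => [|N IH].
    by rewrite big_nat_recr//= big_geq// add0r expr1n invr1; lra.
  rewrite big_nat_recr//=; apply: le_trans (lerD IH (lexx _)) _.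
  set x : R := N.+1%:R; have x0 : 1 <= x by rewrite ler1n.
  have x1 : 0 < x by apply: lt_le_trans x0.
  have -> : N.+2%:R = x + 1 :> R by rewrite natr1.
  have : ((x + 1) ^+ 2)^-1 <= (x * (x + 1))^-1.
    rewrite lef_pV2 ?posrE ?exprn_gt0 ?mulr_gt0 ?addr_gt0// expr2.
    by rewrite ler_wpM2r// ?lerDl// addr_ge0// ltW.
  have -> : (x * (x + 1))^-1 = x^-1 - (x + 1)^-1.
    by field; rewrite !gt_eqF// addr_gt0.
  by move=> h; apply: le_trans (lerD (lexx _) h) _; rewrite addrA subrK.
exists 2 => -[|N]; first by rewrite big_geq.
by apply: le_trans (key N) _; rewrite gerBl invr_ge0.
Qed.

Lemma nat_bound (x : R) : exists k : nat, x <= k%:R.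
Proof. by exists (Num.truncn x).+1; rewrite ltW// truncnS_gt. Qed.

Lemma rsummable_pair w : rsummable (fun n =>
  (nm (w + n%:R) ^+ 2)^-1 + (nm (w - n%:R) ^+ 2)^-1).
Proof.
have [k hk] := nat_bound (nm w + 1).
apply: (@rsummable_unshift _ k) => [n|].
  by rewrite addr_ge0// invr_ge0 exprn_ge0// nm_ge0.
apply: (rsummable_le _ _ (rsummableZ (ler0n _ 2) rsummable_inv2)) => n.
  by rewrite addr_ge0// invr_ge0 exprn_ge0// nm_ge0.
have h x : n.+1%:R <= nm x -> (nm x ^+ 2)^-1 <= (n.+1%:R ^+ 2)^-1 :> R.
  move=> hx; have n0 : 0 < n.+1%:R :> R by rewrite ltr0n.
  rewrite lef_pV2 ?posrE ?exprn_gt0 ?(lt_le_trans n0 hx)//.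
  by rewrite lerXn2r ?nnegrE ?nm_ge0.
have e : n.+1%:R <= (n + k)%:R - nm w.
  by rewrite lerBrDr natrD -natr1 -addrA lerD2l addrC.
rewrite mulr_natl mulr2n lerD//; apply: h; apply: le_trans e _.
  by rewrite -(@nmn R (n + k)) [w + _]addrC nm_subl.
by rewrite nmBC -(@nmn R (n + k)) nm_subB.
Qed.

Definition bil a w n := if n is 0%N then a w else a (w + n%:R) + a (w - n%:R).

Lemma bil_partial a w H :
  \sum_(0 <= j < H.+1) (a (w + j%:R) + a (w - 1 - j%:R)) =
  \sum_(0 <= n < H.+1) bil a w n + a (w - H.+1%:R).
Proof.
elim: H => [|H IH].
  by rewrite !big_nat_recr//= !big_geq// !add0r addr0 subr0.
rewrite big_nat_recr//= IH [in RHS]big_nat_recr//=.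
have -> : w - 1 - H.+1%:R = w - H.+2%:R by rewrite -[H.+2%:R]natr1; ring.
ring.
Qed.

Definition apart (d : R) w := 0 < d /\ forall k : int, d <= nm (w + k%:~R).

Lemma apartN d w n : apart d w -> d <= nm (w + n%:R) /\ d <= nm (w - n%:R).
Proof.
move=> [_ H]; split; first exact: (H n).
by have := H (- n%:Z); rewrite mulrNz.
Qed.

Lemma apart_Im w : ip w != 0 -> apart `|ip w| w.
Proof.
move=> w0; split=> [|k]; first by rewrite normr_gt0.
have -> : ip w = ip (w + k%:~R).
  have ipn n : ip (n%:R : R[i]) = 0 by rewrite -real_complex_nat.
  case: k => n; first by rewrite ipD -pmulrn ipn addr0.
  by rewrite NegzE mulrNz -pmulrn ipD ipN ipn subr0.
exact: nm_Im.
Qed.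

Lemma apart_half : apart (1 / 2) (1 / 2 : R[i]).
Proof.
split=> [|k]; first by lra.
apply: le_trans (nm_Re _).
have -> : rp (1 / 2 + k%:~R : R[i]) = 1 / 2 + k%:~R.
  have rpn n : rp (n%:R : R[i]) = n%:R by rewrite -real_complex_nat.
  rewrite rpD; congr (_ + _).
    have -> : 1 / 2 = (1 / 2)%:C :> R[i] by rewrite rmorphM fmorphV rmorph1 rmorph_nat.
    by [].
  case: k => n; first by rewrite -pmulrn rpn.
  by rewrite NegzE !mulrNz -!pmulrn rpN rpn.
have [k0|k0] := leP 0 k.
  have : 0 <= k%:~R :> R by rewrite ler0z.
  by move=> h; rewrite ger0_norm; lra.
have : k%:~R <= -1 :> R by rewrite -[-1]/((-1)%:~R) ler_int; lia.
by move=> h; rewrite ler0_norm; lra.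
Qed.

Lemma lim_inv w : lim_to (fun n => (w - n.+1%:R)^-1) 0.
Proof.
apply/lim_toP => e e0; have [k hk] := nat_bound (nm w + 1 + e^-1).
exists k => n kn; rewrite subr0 nmV.
have ei : 0 < e^-1 by rewrite invr_gt0.
have h : e^-1 < nm (w - n.+1%:R).
  rewrite nmBC; apply: lt_le_trans (nm_subB _ _); rewrite nmn.
  have : k%:R <= n%:R :> R by rewrite ler_nat.
  by rewrite -natr1; lra.
by rewrite -[ltRHS]invrK ltf_pV2 ?posrE// (lt_trans ei).
Qed.

Lemma lim_invX w k : lim_to (fun n => ((w - n.+1%:R) ^+ k.+1)^-1) 0.
Proof.
elim: k => [|k IH]; first by under eq_fun do rewrite expr1; apply: lim_inv.
under eq_fun do rewrite exprS invfM.
by have := lim_toM (lim_inv w) IH; rewrite mulr0.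
Qed.

Lemma bil_sum_exists a w C : 0 <= C ->
  (forall n, nm (bil a w n) <= C * ((nm (w + n%:R) ^+ 2)^-1 + (nm (w - n%:R) ^+ 2)^-1)) ->
  exists l, csum (bil a w) l.
Proof.
by move=> C0; apply: csum_exists; apply: rsummableZ => //; apply: rsummable_pair.
Qed.

Lemma bil2_exists w : exists l, csum (bil (fun x => (x ^+ 2)^-1) w) l.
Proof.
apply: (bil_sum_exists ler01) => -[|n]; rewrite mul1r /=.
  by rewrite addr0 nmV nmX lerDl invr_ge0 exprn_ge0// nm_ge0.
by apply: le_trans (nmD _ _) _; rewrite !nmV !nmX.
Qed.

Lemma bil4_exists d w : apart d w -> exists l, csum (bil (fun x => (x ^+ 4)^-1) w) l.
Proof.
move=> dw; have d0 := dw.1.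
have C0 : 0 <= (d ^+ 2)^-1 by rewrite invr_ge0 exprn_ge0// ltW.
have h x : d <= nm x -> (nm x ^+ 4)^-1 <= (d ^+ 2)^-1 * (nm x ^+ 2)^-1.
  move=> dx; have x0 := lt_le_trans d0 dx.
  rewrite (exprD _ 2 2) invfM ler_wpM2r ?invr_ge0 ?exprn_ge0 ?nm_ge0//.
  by rewrite lef_pV2 ?posrE ?exprn_gt0// lerXn2r ?nnegrE ?nm_ge0// ltW.
apply: (bil_sum_exists C0) => n; have [h1 h2] := apartN n dw.
rewrite mulrDr; case: n h1 h2 => [|n] h1 h2 /=.
  rewrite addr0 nmV nmX; rewrite addr0 in h1; apply: le_trans (h _ h1) _.
  by rewrite subr0 lerDl mulr_ge0// invr_ge0 exprn_ge0// nm_ge0.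
by apply: le_trans (nmD _ _) _; rewrite !nmV !nmX lerD// h.
Qed.

Lemma bil1_exists d w : apart d w -> exists l, csum (bil (fun x => x^-1) w) l.
Proof.
move=> dw; have d0 := dw.1.
apply: (@bil_sum_exists _ _ (nm w)); first exact: nm_ge0.
move=> n; have [h1 h2] := apartN n dw.
have x0 := lt_le_trans d0 h1; have y0 := lt_le_trans d0 h2.
case: n h1 h2 x0 y0 => [|n] h1 h2 x0 y0.
  rewrite /= nmV addr0 subr0; rewrite addr0 in x0.
  have -> : nm w * ((nm w ^+ 2)^-1 + (nm w ^+ 2)^-1) = (nm w)^-1 + (nm w)^-1.
    by field; rewrite gt_eqF.
  by rewrite lerDl invr_ge0 ltW.
rewrite /bil; set x := w + _ in x0 *; set y := w - _ in y0 *.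
have x0' : x != 0 by rewrite -nm_gt0.
have y0' : y != 0 by rewrite -nm_gt0.
have -> : x^-1 + y^-1 = w * (2 * (x^-1 * y^-1)).
  have -> : w = (x + y) / 2 by rewrite /x /y; field.
  by field; rewrite x0' y0'.
rewrite nmM ler_wpM2l ?nm_ge0// !nmM !nmV nmn -!exprVn.
have : 0 <= ((nm x)^-1 - (nm y)^-1) ^+ 2 by apply: sqr_ge0.
by rewrite sqrrB mulr2n; lra.
Qed.

Lemma bil_period a w l : lim_to (fun n => a (w - n.+1%:R)) 0 ->
  lim_to (fun n => a (w + n.+1%:R)) 0 ->
  csum (bil a w) l <-> csum (bil a (w + 1)) l.
Proof.
move=> h1 h2.
have key N : \sum_(0 <= n < N.+1) bil a (w + 1) n =
    \sum_(0 <= n < N.+1) bil a w n + a (w + N.+1%:R) - a (w - N%:R).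
  elim: N => [|N IH]; first by rewrite !big_nat1/= subr0; ring.
  rewrite big_nat_recr//= IH [in RHS]big_nat_recr//=.
  have -> : w + 1 + N.+1%:R = w + N.+2%:R by rewrite -[N.+2%:R]natr1; ring.
  have -> : w + 1 - N.+1%:R = w - N%:R by rewrite -[N.+1%:R]natr1; ring.
  ring.
have h3 : lim_to (fun n => a (w - n%:R)) 0.
  by apply: (@lim_to_unshift _ _ _ 1); under eq_fun do rewrite addn1.
split=> h; apply: (@lim_to_unshift _ _ _ 1).
  have := lim_toB (lim_toD (lim_to_shift 1 h) h2) h3; rewrite addr0 subr0.
  by apply: lim_to_near; apply: nearW => n /=; rewrite addn1 key.
have := lim_toD (lim_toB (lim_to_shift 1 h) h2) h3; rewrite addr0 subr0.
by apply: lim_to_near; apply: nearW => n /=; rewrite addn1 key; ring.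
Qed.

End Bilateral.

Section Lipschitz.
Context {R : realType}.
Implicit Types (z v w : R[i]) (s : R[i] -> R[i]).

Lemma ee_half2 w : ee (w / 2) ^+ 2 = ee w.
Proof. by rewrite -eeMn; congr ee; field. Qed.

Lemma ee_half_shift w : ee ((w + 1) / 2) = - ee (w / 2).
Proof. by rewrite mulrDl eeD ee_half mulrN1. Qed.

Lemma big_double (F : nat -> R[i]) m : \sum_(0 <= j < m + m) F j =
  \sum_(0 <= j < m) F j + \sum_(0 <= j < m) F (j + m)%N.
Proof.
rewrite (@big_cat_nat _ _ _ m) ?leq_addr//=; congr (_ + _).
by rewrite -{1}[m]add0n big_addn addnK.
Qed.

(* Herglotz's trick: the distribution relation writes s w as a sum of values of s
   near integers, where s is close to its principal part; the errors vanish in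
   the limit. *)
Section Dyadic.
Variables (p : nat) (s : R[i] -> R[i]) (K : R).
Hypothesis K0 : 0 <= K.
Hypothesis sdist : forall w, ee w != 1 ->
  s (w / 2) + s ((w + 1) / 2) = 2 ^+ p.+2 * s w.
Hypothesis sper : forall w (k : int), s (w + k%:~R) = s w.
Hypothesis snear : forall u, u != 0 -> `|rp u| <= 1 / 2 -> `|ip u| <= 1 ->
  nm (s u - (u ^+ p.+2)^-1) <= K / nm u ^+ p.

Lemma dyadic_distribution n w : ee w != 1 ->
  \sum_(0 <= j < 2 ^ n) s ((w + j%:R) / (2 ^ n)%:R) = (2 ^ n)%:R ^+ p.+2 * s w.
Proof.
move=> w1; elim: n => [|n IH].
  by rewrite expn0 big_nat1 addr0 divr1 expr1n mul1r.
have e2 : (2 ^ n.+1)%:R = (2 ^ n)%:R * 2 :> R[i] by rewrite expnSr natrM.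
have n0 : (2 ^ n)%:R != 0 :> R[i] by rewrite pnatr_eq0 expn_eq0.
have le2 : (2 ^ n.+1 = 2 ^ n + 2 ^ n)%N by rewrite expnS mul2n addnn.
rewrite [X in \sum_(0 <= _ < X) _]le2 big_double -big_split/= e2 exprMn [_ ^+ p.+2 * 2 ^+ _]mulrC -mulrA -IH mulr_sumr.
apply: eq_bigr => j _; rewrite -sdist.
  move: n0; rewrite natrD; set M := (2 ^ n)%:R => n0.
  by congr (s _ + s _); field; rewrite n0.
apply: contra w1 => /eqP h.
have := eeMn (2 ^ n) ((w + j%:R) / (2 ^ n)%:R); rewrite h expr1n.
have -> : (2 ^ n)%:R * ((w + j%:R) / (2 ^ n)%:R) = w + j%:R by field.
by rewrite (eeDint w j) => ->.
Qed.

Lemma dyadic_symmetric n w : ee w != 1 ->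
  \sum_(0 <= j < 2 ^ n) (s ((w + j%:R) / (2 ^ n.+1)%:R) +
    s ((w - 1 - j%:R) / (2 ^ n.+1)%:R)) = (2 ^ n.+1)%:R ^+ p.+2 * s w.
Proof.
move=> w1; rewrite -dyadic_distribution//.
have e2 : (2 ^ n.+1)%:R = (2 ^ n)%:R * 2 :> R[i] by rewrite expnSr natrM.
have n0 : (2 ^ n)%:R != 0 :> R[i] by rewrite pnatr_eq0 expn_eq0.
have le2 : (2 ^ n.+1 = 2 ^ n + 2 ^ n)%N by rewrite expnS mul2n addnn.
rewrite [X in \sum_(0 <= _ < X) s ((w + _) / _)]le2 big_double big_split/=; congr (_ + _).
rewrite [RHS]big_nat_rev/= !big_mkord; apply: eq_bigr => j _.
rewrite -(sper _ 1) add0n; congr s.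
have -> : (2 ^ n - j.+1 + 2 ^ n)%:R = (2 ^ n)%:R * 2 - j%:R - 1 :> R[i].
  rewrite natrD natrB ?ltn_ord// -natr1; ring.
by rewrite e2 -[1%:~R]/(1 : R[i]); field.
Qed.

Lemma dyadic_bound d w n : apart d w -> ee w != 1 -> 0 <= rp w <= 1 ->
  `|ip w| <= (2 ^ n.+1)%:R ->
  nm (\sum_(0 <= j < 2 ^ n) (((w + j%:R) ^+ p.+2)^-1 + ((w - 1 - j%:R) ^+ p.+2)^-1) - s w)
  <= K / d ^+ p / (2 ^ n.+1)%:R.
Proof.
move=> dw w1 /andP[wr0 wr1] wi; have d0 := dw.1.
set N : R := (2 ^ n.+1)%:R in wi *; pose NC : R[i] := (2 ^ n.+1)%:R.
have NE : NC = N%:C by rewrite real_complex_nat.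
have N0 : 0 < N by rewrite ltr0n expn_gt0.
have NC0 : NC != 0 by rewrite -nm_gt0 NE nmC normr_gt0 gt_eqF.
have NH : N = (2 ^ n)%:R * 2 by rewrite /N expnSr natrM.
have sw : s w = (NC ^+ p.+2)^-1 * \sum_(0 <= j < 2 ^ n) (s ((w + j%:R) / NC) +
    s ((w - 1 - j%:R) / NC)).
  by rewrite dyadic_symmetric// mulrA mulVf ?mul1r// expf_neq0.
have term x : d <= nm x -> `|rp x| <= (2 ^ n)%:R -> `|ip x| <= N ->
    nm ((x ^+ p.+2)^-1 - (NC ^+ p.+2)^-1 * s (x / NC)) <=
    (N ^+ 2)^-1 * (K / d ^+ p).
  move=> dx xr xi; have x0 : 0 < nm x by apply: lt_le_trans dx.
  have x0' : x != 0 by rewrite -nm_gt0.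
  have xN : x / NC = (N^-1)%:C * x by rewrite NE -fmorphV mulrC.
  have -> : (x ^+ p.+2)^-1 - (NC ^+ p.+2)^-1 * s (x / NC) =
     (NC ^+ p.+2)^-1 * (((x / NC) ^+ p.+2)^-1 - s (x / NC)).
    by rewrite mulrBr expr_div_n invf_div mulrA mulVf ?mul1r// expf_neq0.
  have Ni : 0 < N^-1 by rewrite invr_gt0.
  have h : nm (((x / NC) ^+ p.+2)^-1 - s (x / NC)) <= K / nm (x / NC) ^+ p.
    rewrite nmBC; apply: snear; first by rewrite mulf_neq0// invr_eq0.
      rewrite xN rpM /= mul0r subr0 normrM gtr0_norm// ler_pdivrMl//.
      by apply: le_trans xr _; rewrite NH; lra.
    rewrite xN ipM /= mul0r addr0 normrM gtr0_norm// ler_pdivrMl// mulr1//.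
  rewrite nmM nmV nmX NE nmC gtr0_norm// exprSr exprSr.
  have -> : N ^+ p * N * N = N ^+ p * N ^+ 2 by rewrite expr2 mulrA.
  rewrite -NE invfM mulrAC mulrC ler_wpM2l ?invr_ge0 ?exprn_ge0 ?(ltW N0)//.
  rewrite ler_pdivrMl ?exprn_gt0//; apply: le_trans h _.
  rewrite nmf NE nmC gtr0_norm// expr_div_n invf_div mulrCA ler_wpM2l ?exprn_ge0 ?(ltW N0)//.
  rewrite ler_wpM2l// lef_pV2 ?posrE ?exprn_gt0//.
  by rewrite lerXn2r ?nnegrE ?nm_ge0 ?(ltW d0).
rewrite sw mulr_sumr -sumrB (le_trans (nm_sum _ _ _))//.
apply: (@le_trans _ _ (\sum_(0 <= j < 2 ^ n) (N ^+ 2)^-1 * (K / d ^+ p) * 2)).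
  rewrite big_seq [leRHS]big_seq; apply: ler_sum => j.
  rewrite mem_index_iota => /andP[_ jn].
  have jr : j%:R + 1 <= (2 ^ n)%:R :> R by rewrite natr1 ler_nat.
  have rpn k : rp (k%:R : R[i]) = k%:R by rewrite -real_complex_nat.
  have ipn k : ip (k%:R : R[i]) = 0 by rewrite -real_complex_nat.
  have j0 : 0 <= j%:R :> R by [].
  rewrite mulrDr opprD addrACA (le_trans (nmD _ _))// mulr_natr mulr2n lerD//.
    apply: term; first by have [] := apartN j dw.
      by rewrite rpD rpn ger0_norm; lra.
    by rewrite ipD ipn addr0.
  have -> : w - 1 - j%:R = w - j.+1%:R by rewrite -natr1; ring.
  apply: term; first by have [] := apartN j.+1 dw.
    by rewrite rpD rpN rpn -natr1 ler0_norm; lra.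
  by rewrite ipD ipN ipn subr0.
rewrite sumr_const_nat subn0 -mulr_natr NH.
set M : R := (2 ^ n)%:R; have M0 : 0 < M by rewrite ltr0n expn_gt0.
rewrite le_eqVlt; apply/orP; left; apply/eqP; field.
by rewrite ?gt_eqF// exprn_gt0.
Qed.

Lemma bilateral_sum d w l : apart d w -> ee w != 1 -> 0 <= rp w <= 1 ->
  csum (bil (fun x => (x ^+ p.+2)^-1) w) l -> l = s w.
Proof.
move=> dw w1 wr hl; have d0 := dw.1.
pose b H := \sum_(0 <= j < H) (((w + j%:R) ^+ p.+2)^-1 + ((w - 1 - j%:R) ^+ p.+2)^-1).
have bl : lim_to b l.
  apply: (@lim_to_unshift _ _ _ 1).
  have := lim_toD (lim_to_shift 1 hl) (lim_invX w p.+1); rewrite addr0.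
  apply: lim_to_near; apply: nearW => n /=.
  by rewrite addn1 -bil_partial.
have b2 := @lim_to_sub _ b l (fun n => 2 ^ n)%N (fun n => ltnW (ltn_expl n (ltnSn 1))) bl.
apply: (lim_to_unique b2).
have [k hk] := nat_bound `|ip w|.
apply: (@lim_to_squeeze _ _ _ (fun n => K / d ^+ p * n.+1%:R^-1)).
  exists k => // n /= kn.
  have kN : (k <= 2 ^ n.+1)%N.
    by rewrite (leq_trans kn)// (leq_trans (leqnSn n))// ltnW// ltn_expl.
  apply: le_trans (dyadic_bound dw w1 wr _) _.
    by apply: le_trans hk _; rewrite ler_nat.
  rewrite ler_wpM2l ?divr_ge0 ?exprn_ge0 ?(ltW d0)//.
  by rewrite lef_pV2 ?posrE ?ltr0n ?expn_gt0// ler_nat ltnW// ltn_expl.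
rewrite -[0](mulr0 (K / d ^+ p)); apply: cvgM; first exact: cvg_cst.
exact: cvg_harmonic.
Qed.

End Dyadic.
End Lipschitz.

Section LipschitzSums.
Context {R : realType}.
Implicit Types (z v w : R[i]).

Definition ipw k (x : R[i]) := (x ^+ k)^-1.

Lemma lim_ipwB w k : lim_to (fun n => ipw k.+1 (w - n.+1%:R)) 0.
Proof. exact: lim_invX. Qed.

Lemma lim_ipwD w k : lim_to (fun n => ipw k.+1 (w + n.+1%:R)) 0.
Proof.
have := lim_invX (- w) k; rewrite /lim_to; apply: cvg_trans.
apply: near_eq_cvg; apply: nearW => n.
have -> : - w - n.+1%:R = - (w + n.+1%:R) by rewrite opprD.
by rewrite !subr0 !nmV !nmX nmN.
Qed.

Lemma bil_period_int k w l (m : int) :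
  csum (bil (ipw k.+1) w) l <-> csum (bil (ipw k.+1) (w + m%:~R)) l.
Proof.
have nat_case v (n : nat) :
    csum (bil (ipw k.+1) v) l <-> csum (bil (ipw k.+1) (v + n%:R)) l.
  elim: n => [|n IH]; first by rewrite addr0.
  rewrite IH -natr1 addrA; apply: bil_period; first exact: lim_ipwB.
  exact: lim_ipwD.
case: m => n; first exact: nat_case.
rewrite NegzE mulrNz -pmulrn; symmetry.
by have := nat_case (w - n.+1%:R) n.+1; rewrite subrK.
Qed.

Lemma floor_shift w : exists m : int, 0 <= rp (w - m%:~R) <= 1.
Proof.
exists (Num.floor (rp w)); have -> : rp (w - (Num.floor (rp w))%:~R) =
    rp w - (Num.floor (rp w))%:~R.
  rewrite rpD rpN; congr (_ - _); case: (Num.floor _) => n.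
    by rewrite -pmulrn -real_complex_nat.
  by rewrite NegzE !mulrNz -!pmulrn rpN -real_complex_nat.
have := Num.Theory.floor_le (rp w); have := Num.Theory.floorD1_gt (rp w).
by rewrite intrD; move=> h1 h2; apply/andP; split; lra.
Qed.

Lemma ee_eq1_half w : ee w != 1 -> ee (w / 2) ^+ 2 != 1.
Proof. by rewrite ee_half2. Qed.

Lemma sqc_dist w : ee w != 1 -> sqc (w / 2) + sqc ((w + 1) / 2) = 2 ^+ 2 * sqc w.
Proof.
move=> /ee_eq1_half; rewrite /sqc ee_half_shift -(ee_half2 w).
set t := ee (w / 2) => t1.
have a1 : 1 - t != 0 by apply: contra t1; rewrite subr_eq0 => /eqP <-; rewrite expr1n.
have a2 : 1 + t != 0.
  by apply: contra t1; rewrite addrC addr_eq0 => /eqP ->; rewrite sqrrN expr1n.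
have a3 : 1 - t ^+ 2 != 0 by rewrite subr_eq0 eq_sym.
by field; rewrite ?opprK ?a1 ?a2 ?a3.
Qed.

Lemma sqc_per w (k : int) : sqc (w + k%:~R) = sqc w.
Proof. by rewrite /sqc eeDint. Qed.

(* Closed form of the sum of the (w + n)^-4, that is
   (6 R + 36 R^2) (2 pi)^4 / 36 with R = ee w / (1 - ee w)^2. *)
Definition qtc w : R[i] := sqc w ^+ 2 - 2 / 3 * pi%:C ^+ 2 * sqc w.

Lemma qtc_dist w : ee w != 1 -> qtc (w / 2) + qtc ((w + 1) / 2) = 2 ^+ 4 * qtc w.
Proof.
move=> /ee_eq1_half; rewrite /qtc /sqc ee_half_shift -(ee_half2 w).
set t := ee (w / 2) => t1.
have a1 : 1 - t != 0 by apply: contra t1; rewrite subr_eq0 => /eqP <-; rewrite expr1n.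
have a2 : 1 + t != 0.
  by apply: contra t1; rewrite addrC addr_eq0 => /eqP ->; rewrite sqrrN expr1n.
have a3 : 1 - t ^+ 2 != 0 by rewrite subr_eq0 eq_sym.
by field; rewrite ?opprK ?a1 ?a2 ?a3.
Qed.

Lemma qtc_per w (k : int) : qtc (w + k%:~R) = qtc w.
Proof. by rewrite /qtc sqc_per. Qed.

Lemma qtc_near : exists K : R, 0 <= K /\ forall u, u != 0 ->
  `|rp u| <= 1 / 2 -> `|ip u| <= 1 ->
  nm (qtc u - (u ^+ 4)^-1) <= K / nm u ^+ 2.
Proof.
have [K [K0 HK]] := @sqc_near R.
have P0 : 0 <= pi ^+ 2 :> R by rewrite exprn_ge0// pi_ge0.
exists (2 * K + K ^+ 2 * 4 + pi ^+ 2 * (1 + K * 4)); split.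
  by do ?[done|apply: mulr_ge0|apply: addr_ge0|apply: exprn_ge0].
move=> u u0 h1 h2; have hB := HK u u0 h1 h2.
set B := sqc u - (u ^+ 2)^-1 in hB.
have nu : 0 < nm u by rewrite nm_gt0.
have u2 : nm u <= 2 by apply: le_trans (nm_ReIm _) _; lra.
have -> : qtc u - (u ^+ 4)^-1 = 2 * B / u ^+ 2 + B ^+ 2
    - 2 / 3 * pi%:C ^+ 2 * ((u ^+ 2)^-1 + B).
  by rewrite /qtc /B; field.
have v0 : 0 < (nm u ^+ 2)^-1 by rewrite invr_gt0 exprn_gt0.
have v1 : 1 <= 4 * (nm u ^+ 2)^-1.
  rewrite ler_pdivlMr ?exprn_gt0// mul1r -[4]/((2 * 2)%:R) natrM -expr2.
  by rewrite lerXn2r ?nnegrE ?nm_ge0.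
set V := (nm u ^+ 2)^-1 in v0 v1 *.
have b0 := nm_ge0 B.
have e1 : nm (2 * B / u ^+ 2) <= 2 * K * V.
  rewrite nmf nmM nmX nmn ler_wpM2r ?(ltW v0)//.
  by rewrite ler_wpM2l.
have e2 : nm (B ^+ 2) <= K ^+ 2 * (4 * V).
  rewrite nmX; apply: (@le_trans _ _ (K ^+ 2 * 1)).
    by rewrite mulr1 lerXn2r ?nnegrE.
  by rewrite ler_wpM2l// exprn_ge0.
have e3 : nm (2 / 3 * pi%:C ^+ 2 * ((u ^+ 2)^-1 + B)) <= pi ^+ 2 * (V + K * (4 * V)).
  rewrite nmM; apply: ler_pM; rewrite ?nm_ge0//.
    rewrite nmM nmX nmC ger0_norm ?pi_ge0// ler_piMl// nmf !nmn; lra.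
  apply: le_trans (nmD _ _) _; rewrite nmV nmX lerD//.
  apply: le_trans hB _; rewrite -[leLHS]mulr1 ler_wpM2l//.
apply: le_trans (nmB _ _) _; apply: le_trans (lerD (nmD _ _) (lexx _)) _.
have -> : (2 * K + K ^+ 2 * 4 + pi ^+ 2 * (1 + K * 4)) / nm u ^+ 2 =
  2 * K * V + K ^+ 2 * (4 * V) + pi ^+ 2 * (V + K * (4 * V)) by rewrite -/V; ring.
by rewrite !lerD.
Qed.

Lemma ee_neq1_Im w : ip w != 0 -> ee w != 1.
Proof.
move=> w0; apply/eqP => h; have := nm_ee w; rewrite h nm1.
rewrite -expR0 => /expR_inj/esym/eqP; rewrite oppr_eq0 !mulf_eq0 (negPf w0) orbF.
by rewrite !gt_eqF// pi_gt0.
Qed.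

Lemma ee_half_neq1 : ee (1 / 2 : R[i]) != 1.
Proof.
rewrite ee_half eq_sym -subr_eq0 opprK; by rewrite (_ : 1 + 1 = 2%:R)// pnatr_eq0.
Qed.

Lemma ip_int (m : int) : ip (m%:~R : R[i]) = 0.
Proof.
case: m => n; first by rewrite -pmulrn -real_complex_nat.
by rewrite NegzE mulrNz -pmulrn ipN -real_complex_nat /= oppr0.
Qed.

Lemma sqc_sum0 d w : apart d w -> ee w != 1 -> 0 <= rp w <= 1 ->
  csum (bil (ipw 2) w) (sqc w).
Proof.
move=> dw w1 wr; have [l hl] := bil2_exists w.
have [K [K0 HK]] := @sqc_near R.
rewrite -(@bilateral_sum _ 0 (@sqc R) K K0 sqc_dist sqc_per _ _ _ _ dw w1 wr hl)//.
by move=> u u0 h1 h2; rewrite expr0 divr1; apply: HK.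
Qed.

Lemma qtc_sum0 d w : apart d w -> ee w != 1 -> 0 <= rp w <= 1 ->
  csum (bil (ipw 4) w) (qtc w).
Proof.
move=> dw w1 wr; have [l hl] := bil4_exists dw.
have [K [K0 HK]] := qtc_near.
by rewrite -(@bilateral_sum _ 2 qtc K K0 qtc_dist qtc_per HK _ _ _ dw w1 wr hl).
Qed.

Lemma sqc_sum w : ip w != 0 -> csum (bil (ipw 2) w) (sqc w).
Proof.
move=> w0; have [m hm] := floor_shift w.
have h0 : ip (w - m%:~R) != 0 by rewrite ipD ipN ip_int subr0.
have := sqc_sum0 (apart_Im h0) (ee_neq1_Im h0) hm.
by move/(bil_period_int _ _ _ m); rewrite subrK -mulrNz sqc_per.
Qed.

Lemma qtc_sum w : ip w != 0 -> csum (bil (ipw 4) w) (qtc w).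
Proof.
move=> w0; have [m hm] := floor_shift w.
have h0 : ip (w - m%:~R) != 0 by rewrite ipD ipN ip_int subr0.
have := qtc_sum0 (apart_Im h0) (ee_neq1_Im h0) hm.
by move/(bil_period_int _ _ _ m); rewrite subrK -mulrNz qtc_per.
Qed.

Lemma rp_half : rp (1 / 2 : R[i]) = 1 / 2.
Proof.
by have -> : 1 / 2 = (1 / 2)%:C :> R[i] by rewrite rmorphM fmorphV rmorph1 rmorph_nat.
Qed.

Lemma ip_half : ip (1 / 2 : R[i]) = 0.
Proof.
by have -> : 1 / 2 = (1 / 2)%:C :> R[i] by rewrite rmorphM fmorphV rmorph1 rmorph_nat.
Qed.

Lemma half01 : 0 <= rp (1 / 2 : R[i]) <= 1.
Proof. by rewrite rp_half; apply/andP; split; lra. Qed.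

Lemma zeta_from_half k l : csum (bil (ipw k.*2.+2) (1 / 2)) l ->
  csum (fun n => ipw k.*2.+2 (n.+1%:R : R[i])) (l / (2 * (2 ^+ k.*2.+2 - 1))).
Proof.
set p := k.*2.+2 => hl; have p1 : p = k.*2.+1.+1 by [].
have [Z hZ] : exists Z, csum (fun n => ipw p (n.+1%:R : R[i])) Z.
  apply: (csum_exists rsummable_inv2) => n.
  rewrite nmV nmX nmn lef_pV2 ?posrE ?exprn_gt0// ler_weXn2l// ?ler1n//.
have bl : lim_to (fun H => \sum_(0 <= j < H.+1)
    2 * 2 ^+ p * ipw p ((j.*2.+1)%:R : R[i])) l.
  have h := lim_toD (lim_to_shift 1 hl) (lim_ipwB (1 / 2) k.*2.+1).
  rewrite addr0 in h; apply: lim_to_near h; apply: nearW => H /=.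
  rewrite addn1 -p1 -bil_partial; apply: eq_bigr => j _.
  have ej : (j.*2.+1)%:R = 2 * j%:R + 1 :> R[i] by rewrite -natr1 -mul2n natrM.
  have e1 : 1 / 2 + j%:R = (j.*2.+1)%:R / 2 :> R[i] by rewrite ej; field.
  have e2 : 1 / 2 - 1 - j%:R = - ((j.*2.+1)%:R / 2) :> R[i] by rewrite ej; field.
  rewrite e1 e2 /ipw.
  have -> : (- ((j.*2.+1)%:R / 2 : R[i])) ^+ p = ((j.*2.+1)%:R / 2) ^+ p.
    have pe : p = (2 * k.+1)%N by rewrite mul2n doubleS.
    by rewrite pe !exprM sqrrN.
  by rewrite expr_div_n invf_div; ring.
have bl' : lim_to (fun H => 2 * 2 ^+ p * \sum_(0 <= j < H) ipw p ((j.*2.+1)%:R : R[i])) l.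
  apply: (@lim_to_unshift _ _ _ 1); apply: lim_to_near bl.
  by apply: nearW => H /=; rewrite addn1 mulr_sumr.
have dbl := @lim_to_sub _ _ _ (fun n => n.*2) _ hZ.
have {}dbl := dbl (fun n => leq_trans (leq_addr n n) (eq_leq (addnn n))).
have h2 := lim_toB (lim_toZ (2 * 2 ^+ p) dbl) bl'.
have h3 := lim_toZ 2 hZ.
have E : 2 * 2 ^+ p * Z - l = 2 * Z.
  apply: (lim_to_unique h2); apply: lim_to_near h3; apply: nearW => H /=.
  have -> : \sum_(0 <= i < H.*2) ipw p (i.+1%:R : R[i]) =
    \sum_(0 <= j < H) ipw p ((j.*2.+1)%:R : R[i]) + \sum_(0 <= j < H) ipw p ((j.*2.+2)%:R : R[i]).
    elim: H => [|H IH]; first by rewrite !big_geq// addr0.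
    by rewrite doubleS !big_nat_recr//= IH; ring.
  have -> : \sum_(0 <= j < H) ipw p ((j.*2.+2)%:R : R[i]) =
      (2 ^+ p)^-1 * \sum_(0 <= j < H) ipw p (j.+1%:R : R[i]).
    rewrite mulr_sumr; apply: eq_bigr => j _.
    by rewrite /ipw -doubleS -mul2n natrM exprMn invfM.
  have : 2 ^+ p != 0 :> R[i] by rewrite expf_neq0// pnatr_eq0.
  by move=> h; field.
have n1 : 2 ^+ p - 1 != 0 :> R[i].
  rewrite -natrX subr_eq0 pnatr_eq1 neq_ltn; apply/orP; right.
  by rewrite p1 expnS mul2n -addnn (@leq_ltn_trans (2 ^ k.*2.+1))// ?expn_gt0// -[ltnLHS]addn0 ltn_add2l expn_gt0.
suff -> : l / (2 * (2 ^+ p - 1)) = Z by [].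
have -> : l = 2 * 2 ^+ p * Z - 2 * Z by rewrite -E; ring.
by field.
Qed.

Lemma zeta2 : csum (fun n => ipw 2 (n.+1%:R : R[i])) (pi%:C ^+ 2 / 6).
Proof.
have := @zeta_from_half 0 _ (sqc_sum0 apart_half ee_half_neq1 half01).
have -> : sqc (1 / 2) = pi%:C ^+ 2 :> R[i] by rewrite /sqc ee_half; field.
by congr csum; field.
Qed.

Lemma zeta4 : csum (fun n => ipw 4 (n.+1%:R : R[i])) (pi%:C ^+ 4 / 90).
Proof.
have := @zeta_from_half 1 _ (qtc_sum0 apart_half ee_half_neq1 half01).
have -> : qtc (1 / 2) = pi%:C ^+ 4 / 3 :> R[i].
  have -> : qtc (1 / 2) = (pi%:C ^+ 2) ^+ 2 - 2 / 3 * pi%:C ^+ 2 * pi%:C ^+ 2 :> R[i].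
    by rewrite /qtc /sqc ee_half; field.
  by field.
by congr csum; field.
Qed.

End LipschitzSums.

Section Cotangent.
Context {R : realType}.
Implicit Types (x z v w : R[i]) (a : R[i] -> R[i]).

Definition cotc w : R[i] := pi%:C * 'i%C * ((ee w + 1) * (ee w - 1)^-1).

Definition cotsum w : R[i] :=
  limn (fun N => \sum_(0 <= n < N) bil (ipw 1) w n : R[i]^o).

Lemma cotsumP d w : apart d w -> csum (bil (ipw 1) w) (cotsum w).
Proof. by move=> /bil1_exists[l hl]; rewrite /cotsum (lim_to_limn hl). Qed.

Lemma bil_add a b w n : bil (fun x => a x + b x) w n = bil a w n + bil b w n.
Proof. by case: n => //= n; ring. Qed.

Lemma bil_sub a b w n : bil (fun x => a x - b x) w n = bil a w n - bil b w n.
Proof. by case: n => //= n; ring. Qed.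

Lemma bil_scale c a w n : bil (fun x => c * a x) w n = c * bil a w n.
Proof. by case: n => //= n; ring. Qed.

Lemma bil_shift a w h n : bil a (w + h) n = bil (fun x => a (x + h)) w n.
Proof. by case: n => //= n; rewrite addrAC [w + h - _]addrAC. Qed.

Lemma cder_cotsum d w : apart d w -> csum (bil (ipw 2) w) (sqc w) ->
  cder cotsum w (- sqc w).
Proof.
move=> dw hs; have d0 := dw.1; have d20 : 0 < d / 2 by rewrite divr_gt0.
have [S [_ S0 HS]] := rsummableP (rsummable_pair w).
exists (2 / d * S), (d / 2); split=> //.
  by rewrite !mulr_ge0// invr_ge0 ltW.
move=> h hd.
have dwh : apart (d / 2) (w + h).
  split=> // k; rewrite addrAC; apply: le_trans (nm_subl _ _).
  by have := dw.2 k; lra.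
pose e (x : R[i]) := (x + h)^-1 - x^-1 + h * (x ^+ 2)^-1.
have he : csum (bil e w) (cotsum (w + h) - cotsum w + h * sqc w).
  have := csumD (csumB (cotsumP dwh) (cotsumP dw)) (csumZ h hs).
  by apply: csum_ext => n; rewrite /e bil_add bil_sub bil_scale bil_shift.
have eb x : d <= nm x -> nm (e x) <= 2 / d * nm h ^+ 2 * (nm x ^+ 2)^-1.
  move=> dx; have x0 : 0 < nm x by apply: lt_le_trans dx.
  have xh : d / 2 <= nm (x + h) by apply: le_trans (nm_subl _ _); lra.
  have xh0 : 0 < nm (x + h) by apply: lt_le_trans xh.
  have -> : e x = (x + h)^-1 * h ^+ 2 * (x ^+ 2)^-1.
    by rewrite /e; field; rewrite -!nm_gt0 x0 xh0.
  rewrite nmM [nm (_ * h ^+ 2)]nmM nmX !nmV nmX ler_wpM2r ?invr_ge0 ?exprn_ge0 ?nm_ge0//.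
  rewrite ler_wpM2r ?exprn_ge0 ?nm_ge0//.
  by rewrite -invf_div lef_pV2 ?posrE.
have -> : cotsum (w + h) - cotsum w - - sqc w * h =
  cotsum (w + h) - cotsum w + h * sqc w by ring.
have -> : 2 / d * S * nm h ^+ 2 = 2 / d * nm h ^+ 2 * S by ring.
apply: (@csum_le _ (bil e w) _ (fun n => 2 / d * nm h ^+ 2 *
   ((nm (w + n%:R) ^+ 2)^-1 + (nm (w - n%:R) ^+ 2)^-1))) he => [n|N].
  have [h1 h2] := apartN n dw; rewrite mulrDr.
  have C0 : 0 <= 2 / d * nm h ^+ 2.
    by rewrite mulr_ge0 ?exprn_ge0 ?nm_ge0// divr_ge0// ltW.
  case: n h1 h2 => [|n] h1 h2 /=.
    rewrite addr0 in h1 *; apply: le_trans (eb _ h1) _.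
    by rewrite subr0 lerDl mulr_ge0// invr_ge0 exprn_ge0// nm_ge0.
  by apply: le_trans (nmD _ _) _; rewrite lerD// eb.
rewrite -mulr_sumr ler_wpM2l//.
by rewrite mulr_ge0 ?exprn_ge0 ?nm_ge0// divr_ge0// ltW.
Qed.

Lemma cder_cotc w : ee w != 1 -> cder cotc w (- sqc w).
Proof.
move=> w1; have w1' : ee w - 1 != 0 by rewrite subr_eq0.
have h1 := cderD (cder_ee w) (cder_cst 1 w).
have h2 := cderD (cder_ee w) (cder_cst (- 1) w).
have h3 := cder_comp h2 (cderV w1').
apply: cder_eq (cderZ (pi%:C * 'i%C) (cderM h1 h3)) _.
have -> : sqc w = 4 * pi%:C ^+ 2 * ('i%C * 'i%C) * (ee w / (ee w - 1) ^+ 2).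
  by rewrite i2 /sqc -(sqrrN (1 - _)) opprB mulrN1.
by field.
Qed.

Lemma cotsum_half : cotsum (1 / 2) = 0.
Proof.
apply: (lim_to_unique (cotsumP apart_half)); apply: (@lim_to_unshift _ _ _ 1).
have := lim_toN (lim_ipwB (1 / 2 : R[i]) 0); rewrite oppr0.
apply: lim_to_near; apply: nearW => H /=; rewrite addn1.
have h0 : \sum_(0 <= j < H.+1)
    (ipw 1 (1 / 2 + j%:R) + ipw 1 (1 / 2 - 1 - j%:R)) = 0 :> R[i].
  rewrite big1// => j _.
  have -> : 1 / 2 - 1 - j%:R = - (1 / 2 + j%:R) :> R[i] by field.
  by rewrite /ipw !expr1 invrN subrr.
have := bil_partial (ipw 1) (1 / 2 : R[i]) H; rewrite h0 => /esym/eqP.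
by rewrite addr_eq0 => /eqP ->.
Qed.

Lemma cotc_half : cotc (1 / 2) = 0.
Proof. by rewrite /cotc ee_half addNr mul0r mulr0. Qed.

(* The difference of the two sides has zero derivative off the integers and
   vanishes at 1/2. *)
Lemma cot_sum w : ip w != 0 -> csum (bil (ipw 1) w) (cotc w).
Proof.
move=> w0; suff <- : cotsum w = cotc w by apply: cotsumP (apart_Im w0).
apply/eqP; rewrite -subr_eq0; apply/eqP.
rewrite (@cder0_cst _ (fun x => cotsum x - cotc x) (1 / 2) w); last first.
  move=> t _; set x := _ + _ * _.
  have [t0|t0] := eqVneq t 0.
    have -> : x = 1 / 2 by rewrite /x t0 mul0r addr0.
    have := cderD (cder_cotsum apart_half (sqc_sum0 apart_half ee_half_neq1 half01))
      (cderN (cder_cotc ee_half_neq1)).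
    by move/cder_eq; apply; rewrite subrr.
  have x0 : ip x != 0.
    rewrite /x ipD ipM ip_half /= ipD ipN ip_half subr0 mul0r addr0 add0r.
    by rewrite mulf_neq0.
  have := cderD (cder_cotsum (apart_Im x0) (sqc_sum x0)) (cderN (cder_cotc (ee_neq1_Im x0))).
  by move/cder_eq; apply; rewrite subrr.
by rewrite cotsum_half cotc_half subrr.
Qed.

End Cotangent.

(** * Inversion of Eisenstein series *)

Section EisensteinInversion.
Context {R : realType}.
Implicit Types (x z v w : R[i]) (a : R[i] -> R[i]).

Definition gq (n : nat) : R := (1 + n%:R ^+ 2)^-1.

Lemma gq_ge0 n : 0 <= gq n.
Proof. by rewrite invr_ge0 addr_ge0// exprn_ge0. Qed.

Lemma rsummable_gq : rsummable gq.
Proof.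
apply: (@rsummable_unshift _ _ 1); first exact: gq_ge0.
apply: (rsummable_le _ _ rsummable_inv2) => n; rewrite ?gq_ge0// addn1.
rewrite lef_pV2 ?posrE ?exprn_gt0 ?addr_gt0 ?exprn_gt0//.
by rewrite lerDr.
Qed.

Lemma quadratic_lower z : 0 < ip z -> exists C : R, 0 < C /\
  forall x y : R, x ^+ 2 + y ^+ 2 <= C * nm (x%:C * z + y%:C) ^+ 2.
Proof.
move=> z0; set u := rp z; set v := ip z in z0 *.
exists ((1 + 2 * u ^+ 2) / v ^+ 2 + 2); split.
  by rewrite addr_gt0// divr_gt0 ?exprn_gt0//; have := sqr_ge0 u; lra.
move=> x y; rewrite nm_sqr !(rpD, ipD, rpM, ipM) /= -/u -/v.
rewrite !mul0r subr0 !addr0.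
set A := x * u + y; have -> : y = A - x * u by rewrite /A; ring.
have e : (1 + 2 * u ^+ 2) / v ^+ 2 * (x * v) ^+ 2 = (1 + 2 * u ^+ 2) * x ^+ 2.
  by field; rewrite gt_eqF.
have h1 : 0 <= (1 + 2 * u ^+ 2) / v ^+ 2 * A ^+ 2.
  by rewrite mulr_ge0 ?sqr_ge0// divr_ge0 ?sqr_ge0// addr_ge0// mulr_ge0// sqr_ge0.
have h2 : 0 <= (A + x * u) ^+ 2 by apply: sqr_ge0.
have h3 : 0 <= (x * v) ^+ 2 by apply: sqr_ge0.
rewrite mulrDl !mulrDr e; nra.
Qed.

Lemma int_half (q : R) (n : nat) : q = n%:R \/ q = - n%:R ->
  [/\ q ^+ 2 = n%:R ^+ 2, (n%:R ^+ 2 + 1) / 8 <= (q - 1 / 2) ^+ 2 &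
      (n%:R ^+ 2 + 1) / 8 <= (q + 1 / 2) ^+ 2].
Proof.
have h1 : (n%:R ^+ 2 + 1) / 8 <= (n%:R - 1 / 2) ^+ 2 :> R.
  case: n => [|[|n]]; [lra|lra|].
  have : 0 <= n%:R :> R by []. rewrite -natr1 -natr1; nra.
have h2 : (n%:R ^+ 2 + 1) / 8 <= (n%:R + 1 / 2) ^+ 2 :> R.
  have : 0 <= n%:R :> R by []. nra.
case=> ->; split=> //; first by rewrite sqrrN.
  by rewrite -opprD sqrrN.
by have -> : - n%:R + 1 / 2 = - (n%:R - 1 / 2) :> R by [ring]; rewrite sqrrN.
Qed.

(* The telescoping function t approximates x^-2 with an error of order x^-4,
   which makes the double series absolutely convergent. *)
Definition tel (x : R[i]) := (x - 1 / 2)^-1 - (x + 1 / 2)^-1.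
Definition err (x : R[i]) := ipw 2 x - tel x.

Lemma tel_even x : tel (- x) = tel x.
Proof.
rewrite /tel; have -> : - x - 1 / 2 = - (x + 1 / 2) by ring.
have -> : - x + 1 / 2 = - (x - 1 / 2) by ring.
by rewrite !invrN opprK addrC.
Qed.

Lemma ipw_even k x : ipw k.*2 (- x) = ipw k.*2 x.
Proof. by rewrite /ipw -mul2n exprM sqrrN -exprM. Qed.

Lemma tel_bil_sum w : csum (bil tel w) 0.
Proof.
have key N : \sum_(0 <= n < N.+1) bil tel w n =
    ipw 1 (w + 1 / 2 - N.+1%:R) - ipw 1 (w - 1 / 2 + N.+1%:R).
  rewrite /ipw !expr1; elim: N => [|N IH].
    by rewrite big_nat1 /= /tel; congr (_ - _); congr (_^-1); field.
  rewrite big_nat_recr//= IH /tel.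
  have -> : w + N.+1%:R - 1 / 2 = w - 1 / 2 + N.+1%:R by ring.
  have -> : w - N.+1%:R + 1 / 2 = w + 1 / 2 - N.+1%:R by ring.
  have -> : w + N.+1%:R + 1 / 2 = w - 1 / 2 + N.+2%:R.
    by rewrite -[N.+2%:R]natr1; field.
  have -> : w - N.+1%:R - 1 / 2 = w + 1 / 2 - N.+2%:R.
    by rewrite -[N.+2%:R]natr1; field.
  ring.
apply: (@lim_to_unshift _ _ _ 1).
have := lim_toB (lim_ipwB (w + 1 / 2) 0) (lim_ipwD (w - 1 / 2) 0).
by rewrite subr0; apply: lim_to_near; apply: nearW => n; rewrite addn1 key.
Qed.

Lemma lattice_bounds z : 0 < ip z -> exists K : R, 0 <= K /\
  forall (m n : nat) (x : R[i]), x = m%:R * z + n%:R \/ x = m%:R * z - n%:R ->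
    nm (err x) <= K * (gq m * gq n) /\ nm (ipw 4 x) <= K * (gq m * gq n).
Proof.
move=> /quadratic_lower[C [C0 HC]].
exists (4 * C ^+ 2 + 4); split; first by rewrite addr_ge0// mulr_ge0// exprn_ge0// ltW.
move=> m n x hx.
have [y [hy xE]] : exists y : R, (y = n%:R \/ y = - n%:R) /\ x = (m%:R : R)%:C * z + y%:C.
  case: hx => ->.
    by exists n%:R; split; [left|rewrite !real_complex_nat].
  by exists (- n%:R); split; [right|rewrite rmorphN/= !real_complex_nat].
have [y2 ym yp] := int_half hy.
set M : R := m%:R in xE *; set N : R := n%:R in y2 ym yp *.
have M0 : 0 <= M ^+ 2 by apply: sqr_ge0.
have N0 : 0 <= N ^+ 2 by apply: sqr_ge0.
set s := 1 + M ^+ 2 + N ^+ 2; have s0 : 0 < s by rewrite /s; lra.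
have sg : (s ^+ 2)^-1 <= gq m * gq n.
  rewrite /gq -/M -/N -invfM lef_pV2 ?posrE ?exprn_gt0 ?mulr_gt0//; [|lra|lra].
  by rewrite /s; nra.
have [x0|x0] := eqVneq x 0.
  have [mn0 nn0] : M = 0 /\ N = 0.
    have := HC M y; rewrite -xE x0 nm0 expr0n mulr0 y2 => h.
    by split; apply/eqP; rewrite -sqrf_eq0; apply/eqP; lra.
  have gg : gq m * gq n = 1.
    by rewrite /gq -/M -/N mn0 nn0 expr0n addr0 invr1 mulr1.
  have e0 : err 0 = 4 :> R[i].
    by rewrite /err /ipw /tel expr0n/= invr0 !sub0r add0r; field.
  have i0 : ipw 4 0 = 0 :> R[i] by rewrite /ipw expr0n/= invr0.
  have C2 : 0 <= 4 * C ^+ 2 by rewrite mulr_ge0// sqr_ge0.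
  by rewrite gg mulr1 x0 e0 i0 nm0 nmn; split; lra.
have nx : 0 < nm x by rewrite nm_gt0.
have hx1 : s <= 2 * C * nm x ^+ 2.
  have h := HC M y; rewrite -xE y2 in h.
  suff : 1 <= M ^+ 2 + N ^+ 2 by rewrite /s; lra.
  have mn : (0 < m + n)%N.
    rewrite lt0n addn_eq0; apply/negP => /andP[/eqP m0 /eqP n0].
    move/eqP: x0; apply; rewrite xE /M m0 mul0r add0r; case: hy => ->; rewrite n0 ?oppr0//.
  rewrite /M /N -!natrX -natrD ler1n addn_gt0 !expn_gt0 !orbF.
  by move: mn; rewrite addn_gt0.
have bound4 : (nm x ^+ 4)^-1 <= 4 * C ^+ 2 * (s ^+ 2)^-1.
  rewrite -[4 * C ^+ 2]invrK -invfM lef_pV2 ?posrE ?exprn_gt0 ?mulr_gt0 ?invr_gt0 ?mulr_gt0 ?exprn_gt0//.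
  rewrite ler_pdivrMl ?mulr_gt0 ?exprn_gt0//.
  have -> : 4 * C ^+ 2 * nm x ^+ 4 = (2 * C * nm x ^+ 2) ^+ 2 by ring.
  by rewrite lerXn2r ?nnegrE ?mulr_ge0 ?exprn_ge0 ?(ltW s0) ?(ltW C0) ?nm_ge0.
have fin (A : R) : A <= 4 * C ^+ 2 * (s ^+ 2)^-1 -> A <= (4 * C ^+ 2 + 4) * (gq m * gq n).
  move=> /le_trans; apply; apply: ler_pM => //.
  - by rewrite mulr_ge0// exprn_ge0// ltW.
  - by rewrite invr_ge0 exprn_ge0// ltW.
  - by rewrite lerDl.
split; last by apply: fin; rewrite nmV nmX.
apply: fin.
have halfC : (1 / 2 : R)%:C = 1 / 2 :> R[i].
  by rewrite rmorphM fmorphV rmorph1 rmorph_nat.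
have hm : s <= 8 * C * nm (x - 1 / 2) ^+ 2.
  have := HC M (y - 1 / 2).
  have -> : M%:C * z + (y - 1 / 2)%:C = x - 1 / 2.
    by rewrite xE rmorphB/= halfC addrA.
  by rewrite /s; lra.
have hp : s <= 8 * C * nm (x + 1 / 2) ^+ 2.
  have := HC M (y + 1 / 2).
  have -> : M%:C * z + (y + 1 / 2)%:C = x + 1 / 2.
    by rewrite xE rmorphD/= halfC addrA.
  by rewrite /s; lra.
have xm0 : 0 < nm (x - 1 / 2).
  rewrite lt_neqAle nm_ge0 andbT; apply/eqP => h; rewrite -h expr0n mulr0 in hm; lra.
have xp0 : 0 < nm (x + 1 / 2).
  rewrite lt_neqAle nm_ge0 andbT; apply/eqP => h; rewrite -h expr0n mulr0 in hp; lra.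
have -> : err x = - (4^-1 * (x ^+ 2 * ((x - 1 / 2) * (x + 1 / 2)))^-1).
  have a1 : x * 2 + 1 != 0.
    have -> : x * 2 + 1 = (x + 1 / 2) * 2 by field.
    by rewrite mulf_neq0 ?pnatr_eq0// -nm_gt0.
  have a2 : x * 2 - 1 != 0.
    have -> : x * 2 - 1 = (x - 1 / 2) * 2 by field.
    by rewrite mulf_neq0 ?pnatr_eq0// -nm_gt0.
  by rewrite /err /ipw /tel; field; rewrite x0 a1 a2.
rewrite nmN nmM !nmV nmn nmM nmX [nm (_ * _)]nmM.
set p := nm (x - 1 / 2) in hm xm0 *; set p' := nm (x + 1 / 2) in hp xp0 *.
have pp : s <= 8 * C * (p * p').
  rewrite -(@ler_pXn2r _ 2)// ?nnegrE ?(ltW s0)//; last first.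
    by rewrite !mulr_ge0 ?(ltW C0) ?(ltW xm0) ?(ltW xp0).
  have -> : (8 * C * (p * p')) ^+ 2 = (8 * C * p ^+ 2) * (8 * C * p' ^+ 2) by ring.
  by rewrite [s ^+ 2]expr2; apply: ler_pM => //; rewrite (ltW s0).
rewrite -invfM -[4 * C ^+ 2]invrK -invfM lef_pV2 ?posrE; last 2 first.
- by rewrite !mulr_gt0// exprn_gt0.
- by rewrite mulr_gt0 ?invr_gt0 ?mulr_gt0 ?exprn_gt0.
rewrite ler_pdivrMl ?mulr_gt0 ?exprn_gt0//.
have -> : 4 * C ^+ 2 * (4 * (nm x ^+ 2 * (p * p'))) =
  (2 * C * nm x ^+ 2) * (8 * C * (p * p')) by ring.
by rewrite [s ^+ 2]expr2; apply: ler_pM => //; rewrite (ltW s0).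
Qed.

Definition fold2 a z (m n : nat) := if m is 0%N then bil a 0 n else 2 * bil a (m%:R * z) n.

Lemma fold2_bound a z (K : R) :
  (forall (m n : nat) (x : R[i]), x = m%:R * z + n%:R \/ x = m%:R * z - n%:R ->
    nm (a x) <= K * (gq m * gq n)) ->
  forall m n, nm (fold2 a z m n) <= (4 * K * gq m) * gq n.
Proof.
move=> H m n.
have h1 := H m n _ (or_introl erefl); have h2 := H m n _ (or_intror erefl).
have B0 : 0 <= K * (gq m * gq n) by apply: le_trans h1; apply: nm_ge0.
have hb : nm (bil a (m%:R * z) n) <= 2 * (K * (gq m * gq n)).
  case: n h1 h2 B0 => [|n] h1 h2 B0 /=; first by rewrite addr0 in h1; lra.
  by apply: le_trans (nmD _ _) _; lra.
rewrite -!mulrA; case: m h1 h2 B0 hb => [|m] h1 h2 B0 /=; last by rewrite nmM nmn; lra.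
rewrite mul0r; lra.
Qed.

Definition G4row z (m : nat) : R[i] :=
  if m is 0%N then pi%:C ^+ 4 / 45 else 2 * qtc (m%:R * z).
Definition G2row z (m : nat) : R[i] :=
  if m is 0%N then pi%:C ^+ 2 / 3 else 2 * sqc (m%:R * z).

Lemma ipMn m z : ip (m%:R * z) = m%:R * ip z.
Proof. by rewrite -real_complex_nat ipM /= mul0r addr0. Qed.

Lemma bil0_even k l : csum (fun n => ipw k.*2.+2 (n.+1%:R : R[i])) l ->
  csum (bil (ipw k.*2.+2) 0) (2 * l).
Proof.
move=> h; have -> : 2 * l = bil (ipw k.*2.+2) 0 0 + 2 * l.
  by rewrite /= /ipw expr0n invr0 add0r.
apply: csum_recl; apply: csum_ext (csumZ 2 h) => n /=.
by rewrite add0r sub0r (ipw_even k.+1); ring.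
Qed.

Lemma G4row_sum z m : 0 < ip z -> csum (fold2 (ipw 4) z m) (G4row z m).
Proof.
move=> z0; case: m => [|m] /=.
  by have := @bil0_even 1 _ zeta4; congr csum; field.
by apply: csumZ; apply: qtc_sum; rewrite ipMn mulf_neq0// ?gt_eqF// pnatr_eq0.
Qed.

Lemma G2row_sum z m : 0 < ip z -> csum (fold2 (ipw 2) z m) (G2row z m).
Proof.
move=> z0; case: m => [|m] /=.
  by have := @bil0_even 0 _ zeta2; congr csum; field.
by apply: csumZ; apply: sqc_sum; rewrite ipMn mulf_neq0// ?gt_eqF// pnatr_eq0.
Qed.

Lemma ip_gt0_neq0 z : 0 < ip z -> z != 0.
Proof. by move=> z0; apply/eqP => h; rewrite h ltxx in z0. Qed.

Lemma ip_inv z : ip (- z^-1) = ip z / nm z ^+ 2.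
Proof.
rewrite ipN invc_norm nmE -rmorphXn -fmorphV ipM /= mul0r addr0.
by have -> : ip z^* = - ip z by [case: z]; rewrite mulrN opprK mulrC.
Qed.

Lemma ip_inv_gt0 z : 0 < ip z -> 0 < ip (- z^-1).
Proof.
by move=> z0; rewrite ip_inv divr_gt0// exprn_gt0// nm_gt0 ip_gt0_neq0.
Qed.

Lemma ipwM k x y : ipw k (x * y) = ipw k x * ipw k y.
Proof. by rewrite /ipw exprMn invfM. Qed.

Lemma fold2_inv k z m n : z != 0 ->
  fold2 (ipw k.*2.+2) (- z^-1) m n = z ^+ k.*2.+2 * fold2 (ipw k.*2.+2) z n m.
Proof.
move=> z0; pose p := k.*2.+2; rewrite -/p.
have pe x : ipw p (- x) = ipw p x by exact: (ipw_even k.+1).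
have zp : z ^+ p != 0 by rewrite expf_neq0.
have zi : ipw p z = (z ^+ p)^-1 by [].
have zv : ipw p z^-1 = z ^+ p by rewrite /ipw exprVn invrK.
have i0 : ipw p (0 : R[i]) = 0 by rewrite /ipw expr0n invr0.
have key x : ipw p x = z ^+ p * ipw p (x * z).
  by rewrite ipwM zi mulrCA mulfV ?mulr1.
case: m n => [|m] [|n] /=; rewrite ?i0 ?mulr0// ?add0r ?sub0r ?pe.
- by rewrite key mulrC [n.+1%:R * z]mulrC [X in ipw p X]mulrC; ring.
- rewrite mulrN pe ipwM zv; ring.
- rewrite key [ipw p (_ - n.+1%:R)]key.
  have -> : (m.+1%:R * - z^-1 + n.+1%:R) * z = n.+1%:R * z - m.+1%:R.
    by field.
  have -> : (m.+1%:R * - z^-1 - n.+1%:R) * z = - (n.+1%:R * z + m.+1%:R).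
    by field.
  rewrite pe; ring.
Qed.

Lemma G4_inversion z : 0 < ip z -> exists L,
  csum (G4row z) L /\ csum (G4row (- z^-1)) (z ^+ 4 * L).
Proof.
move=> z0; have [K [K0 HK]] := lattice_bounds z0.
have zn := ip_gt0_neq0 z0.
have z40 : z ^+ 4 != 0 by rewrite expf_neq0.
have gK : rsummable (fun m => 4 * K * gq m).
  by apply: rsummableZ rsummable_gq; rewrite mulr_ge0.
have bnd : forall m n, nm (fold2 (ipw 4) z m n) <= 4 * K * gq m * gq n.
  by apply: fold2_bound => m n x hx; have [] := HK m n x hx.
have rows m := G4row_sum m z0.
have cols n : csum ((fold2 (ipw 4) z)^~ n) ((z ^+ 4)^-1 * G4row (- z^-1) n).
  apply: csum_ext (csumZ _ (G4row_sum n (ip_inv_gt0 z0))) => m.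
  by rewrite (@fold2_inv 1)// mulrA mulVf ?mul1r.
have [L [h1 h2 _]] := csum_exchange gK rsummable_gq bnd rows cols.
exists L; split=> //; apply: csum_ext (csumZ (z ^+ 4) h2) => n.
by rewrite mulrA mulfV ?mul1r.
Qed.

Lemma lim_cotc z : 0 < ip z ->
  lim_to (fun N => cotc ((N%:R + 1 / 2) / z)) (pi%:C * 'i%C).
Proof.
move=> z0; have zn := ip_gt0_neq0 z0.
set y := 2 * pi * ip (- z^-1).
have y0 : 0 < y by rewrite !mulr_gt0 ?pi_gt0// ip_inv_gt0.
have ne N : nm (ee ((N%:R + 1 / 2) / z)) = expR (y * (N%:R + 1 / 2)).
  rewrite nm_ee; congr expR.
  have -> : (N%:R + 1 / 2) / z = - ((N%:R + 1 / 2)%:C * - z^-1) :> R[i].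
    by rewrite rmorphD rmorphM fmorphV rmorph1 !rmorph_nat mulrN opprK.
  by rewrite ipN ipM /= mul0r addr0 /y; ring.
have ge N : y * N%:R <= nm (ee ((N%:R + 1 / 2) / z) - 1).
  apply: le_trans (nm_subB _ _); rewrite ne nm1.
  have := expR_ge1Dx (y * (N%:R + 1 / 2)).
  by rewrite mulrDr; lra.
apply/lim_toP => e e0.
have [k hk] := nat_bound ((nm (pi%:C * 'i%C : R[i]) * 2 / e + 1) / y).
exists k => N kN.
have h1 : nm (pi%:C * 'i%C : R[i]) * 2 / e + 1 <= y * N%:R.
  have : k%:R <= N%:R :> R by rewrite ler_nat.
  by move=> h; rewrite [y * _]mulrC -ler_pdivrMr// (le_trans hk).
pose x : R[i] := ee ((N%:R + 1 / 2) / z); have h2 := le_trans h1 (ge N); rewrite -/x in h2.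
have p0 : 0 <= nm (pi%:C * 'i%C : R[i]) * 2 / e.
  by rewrite divr_ge0 ?mulr_ge0 ?nm_ge0 ?ltW.
have x1 : 0 < nm (x - 1) by apply: lt_le_trans h2; rewrite ltr_wpDl.
have x1' : x - 1 != 0 by rewrite -nm_gt0.
have -> : cotc ((N%:R + 1 / 2) / z) - pi%:C * 'i%C = pi%:C * 'i%C * 2 / (x - 1).
  by rewrite /cotc -/x; field.
rewrite nmf nmM nmn ltr_pdivrMr// [e * _]mulrC -ltr_pdivrMr//.
by apply: lt_le_trans h2; rewrite ltrDl.
Qed.

Definition telcol z (n : nat) :=
  if n is n'.+1 then 2 / z * (cotc ((n'%:R + 1 / 2) / z) - cotc ((n%:R + 1 / 2) / z))
   else - (2 / z * cotc ((0%:R + 1 / 2) / z)).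

Lemma tel_col_sum z n : 0 < ip z -> csum ((fold2 tel z)^~ n)
  (telcol z n).
Proof.
move=> z0; have zn := ip_gt0_neq0 z0.
have bilz (y : R) : y != 0 -> csum (fun m => bil (fun x => ipw 1 (x * z + y%:C)) 0 m)
    (z^-1 * cotc (y%:C / z)).
  move=> y0; have i0 : ip (y%:C / z) != 0.
    have -> : y%:C / z = - (y%:C * - z^-1) by rewrite mulrN opprK.
    rewrite ipN ipM /= mul0r addr0 oppr_eq0 mulf_neq0//.
    by rewrite gt_eqF// ip_inv_gt0.
  apply: csum_ext (csumZ z^-1 (cot_sum i0)) => m; rewrite -bil_scale -[y%:C / z]add0r.
  rewrite bil_shift; congr bil; apply/funext => x.
  by rewrite /ipw !expr1 -invfM; congr (_^-1); field.
have half : 1 / 2 = (1 / 2 : R)%:C :> R[i] by rewrite rmorphM fmorphV rmorph1 rmorph_nat.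
have e1 (k : nat) : (k%:R + 1 / 2 : R)%:C = k%:R + 1 / 2 :> R[i].
  by rewrite half rmorphD rmorph_nat.
have k0 (k : nat) : (k%:R + 1 / 2 : R) != 0.
  by rewrite gt_eqF//; have : 0 <= k%:R :> R by []; lra.
case: n => [|n].
  have h1 := bilz _ (k0 0%N).
  have k0' : - (0%:R + 1 / 2 : R) != 0 by rewrite oppr_eq0.
  have h2 := bilz _ k0'.
  have eh : (- (0%:R + 1 / 2 : R))%:C = - (0%:R + 1 / 2) :> R[i] by rewrite -e1 -rmorphN.
  have := csumB h2 h1; rewrite eh e1.
  have -> : cotc (- (0%:R + 1 / 2) / z) = - cotc ((0%:R + 1 / 2) / z).
    rewrite /cotc mulNr eeN; set x := ee _.
    have x0 : x != 0 by apply: ee_neq0.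
    have x1 : x != 1.
      apply: ee_neq1_Im; rewrite -(e1 0%N).
      have -> : (0%:R + 1 / 2 : R)%:C / z = - ((0%:R + 1 / 2 : R)%:C * - z^-1) by rewrite mulrN opprK.
      rewrite ipN ipM /= mul0r addr0 oppr_eq0 mulf_neq0//.
      by rewrite gt_eqF// ip_inv_gt0.
    have x2 : x - 1 != 0 by rewrite subr_eq0.
    have x3 : 1 - x != 0 by rewrite subr_eq0 eq_sym.
    have -> : x^-1 - 1 = (1 - x) / x by field.
    by field; rewrite x0 x2 x3.
  have -> : z^-1 * - cotc ((0%:R + 1 / 2) / z) - z^-1 * cotc ((0%:R + 1 / 2) / z) =
    - (2 / z * cotc ((0%:R + 1 / 2) / z)) by field.
  apply: csum_ext => m; rewrite /fold2; case: m => [|m] /=.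
    by rewrite /tel /ipw !expr1 mul0r !add0r.
  rewrite /ipw !expr1 !add0r /tel.
  have -> : - m.+1%:R * z - (1 / 2) = - (m.+1%:R * z + 1 / 2) by ring.
  have -> : - m.+1%:R * z + (1 / 2) = - (m.+1%:R * z - 1 / 2) by ring.
  by rewrite !invrN; ring.
have kn : (n.+1%:R - 1 / 2 : R) != 0.
  by rewrite gt_eqF// -natr1; have : 0 <= n%:R :> R by []; lra.
have h1 := bilz _ kn; have h2 := bilz _ (k0 n.+1).
have := csumZ 2 (csumB h1 h2).
have -> : (n.+1%:R - 1 / 2 : R)%:C = n%:R + 1 / 2 :> R[i].
  by rewrite -e1 -natr1; congr (_%:C); field.
rewrite e1 -mulrBr mulrA; apply: csum_ext => m.
have tl x : tel x = ipw 1 (x - 1 / 2) - ipw 1 (x + 1 / 2) by rewrite /tel /ipw !expr1.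
have e3 : n%:R + 1 / 2 = n.+1%:R - 1 / 2 :> R[i] by rewrite -natr1; field.
case: m => [|m] /=.
  rewrite !mul0r !add0r e3 tel_even tl; ring.
rewrite !add0r mulNr e3.
have -> : tel (m.+1%:R * z - n.+1%:R) = tel (- (m.+1%:R * z) + n.+1%:R).
  by rewrite -tel_even opprB addrC.
by rewrite !tl !addrA; ring.
Qed.

Lemma tel_total z : 0 < ip z -> csum (telcol z) (- (2 / z * (pi%:C * 'i%C))).
Proof.
move=> z0; apply: (@lim_to_unshift _ _ _ 1).
apply: lim_to_near (lim_toN (lim_toZ (2 / z) (lim_cotc z0))).
apply: nearW => N; rewrite addn1; elim: N => [|N IH]; first by rewrite big_nat1.
by rewrite big_nat_recr//= -IH; ring.
Qed.

Lemma G2_inversion z : 0 < ip z -> exists L,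
  csum (G2row z) L /\ csum (G2row (- z^-1)) (z ^+ 2 * L - 2 * pi%:C * 'i%C * z).
Proof.
move=> z0; have [K [K0 HK]] := lattice_bounds z0.
have zn := ip_gt0_neq0 z0.
have z20 : z ^+ 2 != 0 by rewrite expf_neq0.
have gK : rsummable (fun m => 4 * K * gq m).
  by apply: rsummableZ rsummable_gq; rewrite mulr_ge0.
have bnd : forall m n, nm (fold2 err z m n) <= 4 * K * gq m * gq n.
  by apply: fold2_bound => m n x hx; have [] := HK m n x hx.
have f2B m n : fold2 err z m n = fold2 (ipw 2) z m n - fold2 tel z m n.
  by case: m => [|m]; rewrite /fold2 bil_sub// mulrBr.
have rows m : csum (fold2 err z m) (G2row z m).
  have h : csum (fold2 tel z m) 0.
    case: m => [|m]; first exact: tel_bil_sum.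
    by have := csumZ 2 (tel_bil_sum (m.+1%:R * z)); rewrite mulr0.
  have := csumB (G2row_sum m z0) h; rewrite subr0.
  by apply: csum_ext => n; rewrite f2B.
have cols n := csumB (csumZ (z ^+ 2)^-1 (G2row_sum n (ip_inv_gt0 z0))) (tel_col_sum n z0).
have {}cols n : csum ((fold2 err z)^~ n) ((z ^+ 2)^-1 * G2row (- z^-1) n - telcol z n).
  apply: csum_ext (cols n) => m.
  by rewrite f2B (@fold2_inv 0)// mulrA mulVf ?mul1r.
have [L [h1 h2 _]] := csum_exchange gK rsummable_gq bnd rows cols.
exists L; split=> //.
have := csumZ (z ^+ 2) (csumD h2 (tel_total z0)).
have -> : z ^+ 2 * (L - 2 / z * (pi%:C * 'i%C)) = z ^+ 2 * L - 2 * pi%:C * 'i%C * z.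
  by field.
apply: csum_ext => n; rewrite subrK mulrA mulfV ?mul1r//.
Qed.

End EisensteinInversion.

Section PowerSeries.
Context {R : realType}.
Implicit Types (x z : R[i]) (r : R).

Lemma geometric_partial r N : 0 <= r < 1 -> \sum_(0 <= i < N) r ^+ i <= (1 - r)^-1.
Proof.
move=> /andP[r0 r1]; have r10 : 0 < 1 - r by rewrite subr_gt0.
rewrite -[leRHS]mul1r ler_pdivlMr//.
have -> : (\sum_(0 <= i < N) r ^+ i) * (1 - r) = 1 - r ^+ N.
  elim: N => [|N IH]; first by rewrite big_geq// mul0r expr0 subrr.
  by rewrite big_nat_recr//= mulrDl IH exprS; ring.
by rewrite gerBl exprn_ge0.
Qed.

Lemma rsummable_geometric r : 0 <= r < 1 -> rsummable (fun n => r ^+ n).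
Proof.
move=> r01; have /andP[r0 _] := r01.
split=> [n|]; first by rewrite exprn_ge0.
by exists (1 - r)^-1 => N; apply: geometric_partial.
Qed.

Lemma linear_geometric_bound r n : 0 <= r < 1 -> n%:R * r ^+ n <= (1 - r)^-1.
Proof.
move=> r01; apply: le_trans (geometric_partial n r01).
have /andP[r0 r1] := r01.
have -> : n%:R * r ^+ n = \sum_(0 <= i < n) r ^+ n.
  by rewrite sumr_const_nat subn0 mulr_natl.
rewrite big_seq [leRHS]big_seq; apply: ler_sum => i.
rewrite mem_index_iota => /andP[_ /ltnW].
by apply: ler_wiXn2l => //; apply: ltW.
Qed.

Lemma sqrt_lt1 r : 0 <= r < 1 -> 0 <= Num.sqrt r < 1.
Proof.
by move=> /andP[r0 r1]; rewrite sqrtr_ge0 -[ltRHS]sqrtr1 ltr_sqrt.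
Qed.

Lemma rsummable_power k r : 0 <= r < 1 -> rsummable (fun n => n%:R ^+ k * r ^+ n).
Proof.
elim: k r => [|k IH] r r01.
  by have := rsummable_geometric r01; under eq_fun do rewrite -[_ ^+ _]mul1r.
have /andP[r0 r1] := r01; have s01 := sqrt_lt1 r01; have /andP[s0 s1] := s01.
set s := Num.sqrt r in s01 s0 s1; have rE : r = s ^+ 2 by rewrite sqr_sqrtr.
have c0 : 0 <= (1 - s)^-1 by rewrite invr_ge0 subr_ge0 ltW.
apply: rsummable_le (rsummableZ c0 (IH _ s01)) => n.
  by rewrite mulr_ge0 ?exprn_ge0.
rewrite rE -exprM mul2n -addnn exprD exprS.
have -> : n%:R * n%:R ^+ k * (s ^+ n * s ^+ n) = n%:R * s ^+ n * (n%:R ^+ k * s ^+ n).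
  by ring.
by rewrite ler_wpM2r ?mulr_ge0 ?exprn_ge0// linear_geometric_bound.
Qed.

Lemma rsummable_shift (g : nat -> R) : rsummable g -> rsummable (fun n => g n.+1).
Proof.
move=> [g0 [G HG]]; split=> //; exists G => N.
by apply: le_trans (HG N.+1); rewrite big_nat_recl//= lerDr.
Qed.

Lemma nm1B_gt0 x : nm x < 1 -> 1 - x != 0.
Proof.
move=> x1; rewrite -nm_gt0; apply: lt_le_trans (nm_subB _ _).
by rewrite nm1 subr_gt0.
Qed.

Lemma power_sum_exists k x : nm x < 1 ->
  exists l, csum (fun d => d.+1%:R ^+ k * x ^+ d.+1) l.
Proof.
move=> x1; have r01 : 0 <= nm x < 1 by rewrite nm_ge0.
apply: (csum_exists (rsummable_shift (rsummable_power k r01))) => n.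
by rewrite nmM !nmX nmn.
Qed.

Lemma power_sums x : nm x < 1 ->
  [/\ csum (fun d => x ^+ d.+1) (x / (1 - x)),
      csum (fun d => d.+1%:R * x ^+ d.+1) (x / (1 - x) ^+ 2) &
      csum (fun d => d.+1%:R ^+ 3 * x ^+ d.+1)
        (x / (1 - x) ^+ 2 + 6 * (x / (1 - x) ^+ 2) ^+ 2)].
Proof.
move=> x1; have nx := nm1B_gt0 x1.
have [S0 h0] := power_sum_exists 0 x1; have [S1 h1] := power_sum_exists 1 x1.
have [S2 h2] := power_sum_exists 2 x1; have [S3 h3] := power_sum_exists 3 x1.
have e0 : S0 - x = x * S0.
  apply: csum_unique (csumZ x h0); have := csum0 h0; rewrite expr1n mul1r expr1.
  by apply: csum_ext => d; rewrite [x ^+ d.+2]exprS; ring.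
have e1 : S1 - x = x * (S1 + S0).
  apply: csum_unique (csumZ x (csumD h1 h0)).
  have := csum0 h1; rewrite expr1n mul1r expr1.
  by apply: csum_ext => d; rewrite [x ^+ d.+2]exprS -[d.+2%:R]natr1; ring.
have e2 : S2 - x = x * (S2 + 2 * S1 + S0).
  apply: csum_unique (csumZ x (csumD (csumD h2 (csumZ 2 h1)) h0)).
  have := csum0 h2; rewrite expr1n mul1r expr1.
  by apply: csum_ext => d; rewrite [x ^+ d.+2]exprS -[d.+2%:R]natr1; ring.
have e3 : S3 - x = x * (S3 + 3 * S2 + 3 * S1 + S0).
  apply: csum_unique (csumZ x (csumD (csumD (csumD h3 (csumZ 3 h2)) (csumZ 3 h1)) h0)).
  have := csum0 h3; rewrite expr1n mul1r expr1.
  by apply: csum_ext => d; rewrite [x ^+ d.+2]exprS -[d.+2%:R]natr1; ring.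
have E0 : S0 = x / (1 - x).
  by apply: (mulIf nx); rewrite mulfVK// mulrBr mulr1 [S0 * x]mulrC -e0; ring.
have E1 : S1 = x / (1 - x) ^+ 2.
  have -> : S1 = (S1 - x - x * S1 + x) / (1 - x) by field.
  by rewrite e1 E0; field.
have E2 : S2 = x * (1 + x) / (1 - x) ^+ 3.
  have -> : S2 = (S2 - x - x * S2 + x) / (1 - x) by field.
  by rewrite e2 E0 E1; field.
have E3 : S3 = x / (1 - x) ^+ 2 + 6 * (x / (1 - x) ^+ 2) ^+ 2.
  have -> : S3 = (S3 - x - x * S3 + x) / (1 - x) by field.
  by rewrite e3 E0 E1 E2; field.
split.
- by rewrite -E0; apply: csum_ext h0 => d; rewrite expr0 mul1r.
- by rewrite -E1; apply: csum_ext h1 => d; rewrite expr1.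
- by rewrite -E3.
Qed.

Lemma nmX_lt1 x k : nm x < 1 -> nm (x ^+ k.+1) < 1.
Proof. by move=> x1; rewrite nmX exprn_ilt1// nm_ge0. Qed.

Lemma lambert_exchange k x : nm x < 1 ->
  exists (P : nat -> R[i]) L,
    [/\ forall m, csum (fun d => d.+1%:R ^+ k * (x ^+ m.+1) ^+ d.+1) (P m), csum P L &
     csum (fun d => d.+1%:R ^+ k * (x ^+ d.+1 / (1 - x ^+ d.+1))) L].
Proof.
move=> x1; set r := nm x.
have r01 : 0 <= r < 1 by rewrite nm_ge0.
have /andP[r0 r1] := r01.
have [P HP] := boolp.choice (fun m => power_sum_exists k (nmX_lt1 m x1)).
exists P; have h2 := rsummable_shift (rsummable_power k r01).
pose a (m d : nat) := d.+1%:R ^+ k * (x ^+ m.+1) ^+ d.+1.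
have bnd m d : nm (a m d) <= r ^+ m * (d.+1%:R ^+ k * r ^+ d.+1).
  rewrite /a nmM !nmX nmn mulrCA ler_wpM2l ?exprn_ge0// -/r.
  rewrite -exprM -exprD; apply: ler_wiXn2l => //; first exact: ltW.
  by rewrite mulSn [(m + _)%N]addnC leq_add2l leq_pmulr.
have cols d : csum (a^~ d) (d.+1%:R ^+ k * (x ^+ d.+1 / (1 - x ^+ d.+1))).
  have [h _ _] := power_sums (nmX_lt1 d x1).
  apply: csum_ext (csumZ (d.+1%:R ^+ k) h) => m.
  by rewrite /a -!exprM mulnC.
have [L [h1 h3 _]] := csum_exchange (rsummable_geometric r01) h2 bnd HP cols.
by exists L; split.
Qed.

Lemma csum_sparse (u : nat -> R[i]) l K : csum u l ->
  csum (fun n => if (K.+1 %| n.+1)%N then u (n.+1 %/ K.+1).-1 else 0) l.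
Proof.
move=> h; have key N : \sum_(0 <= n < N) (if (K.+1 %| n.+1)%N then u (n.+1 %/ K.+1).-1 else 0) =
    \sum_(0 <= i < N %/ K.+1) u i.
  elim: N => [|N IH]; first by rewrite div0n !big_geq.
  rewrite big_nat_recr//= IH divnS//.
  case: (K.+1 %| N.+1)%N => /=; last by rewrite addr0 add0n.
  by rewrite add1n big_nat_recr.
apply/lim_toP => e e0; have [M HM] := (lim_toP _ _).1 h e e0.
exists (M * K.+1)%N => N MN; rewrite key; apply: HM.
by rewrite leq_divRL.
Qed.

Lemma sum_divisors (F : nat -> R[i]) n : (0 < n)%N ->
  \sum_(d <- divisors n) F d = \sum_(0 <= d < n) (if (d.+1 %| n)%N then F d.+1 else 0).
Proof.
move=> n0; rewrite -(big_add1 _ _ 0 n.+1 xpredT (fun d => if (d %| n)%N then F d else 0)).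
rewrite -big_mkcond -big_filter; apply: perm_big; apply: uniq_perm.
- exact: divisors_uniq.
- by rewrite filter_uniq// iota_uniq.
- move=> d; rewrite -dvdn_divisors// mem_filter mem_index_iota ltnS.
  have [dn|//] := boolP (d %| n)%N.
  by rewrite (dvdn_gt0 n0 dn) (dvdn_leq n0 dn).
Qed.

Lemma divisor_series x : nm x < 1 -> exists L,
  csum (fun n => (sigma 3 n.+1)%:R * x ^+ n.+1) L /\
  csum (fun d => d.+1%:R ^+ 3 * (x ^+ d.+1 / (1 - x ^+ d.+1))) L.
Proof.
move=> x1; set r := nm x; have r01 : 0 <= r < 1 by rewrite nm_ge0.
have /andP[r0 r1] := r01; have s01 := sqrt_lt1 r01; have /andP[s0 s1] := s01.
set s := Num.sqrt r in s01 s0 s1; have rE : r = s ^+ 2 by rewrite sqr_sqrtr.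
pose a (d n : nat) := if (d.+1 %| n.+1)%N then d.+1%:R ^+ 3 * x ^+ n.+1 else 0.
have gs := rsummable_shift (rsummable_power 3 s01).
have hs := rsummable_shift (rsummable_geometric s01).
have bnd d n : nm (a d n) <= d.+1%:R ^+ 3 * s ^+ d.+1 * s ^+ n.+1.
  rewrite /a; case: ifP => dn; last by rewrite nm0 !mulr_ge0 ?exprn_ge0.
  rewrite nmM !nmX nmn -mulrA ler_wpM2l ?exprn_ge0// -/r rE -exprM mul2n -addnn exprD.
  rewrite ler_wpM2r ?exprn_ge0//; apply: ler_wiXn2l => //; first exact: ltW.
  exact: dvdn_leq dn.
have rows d : csum (a d) (d.+1%:R ^+ 3 * (x ^+ d.+1 / (1 - x ^+ d.+1))).
  have [h _ _] := power_sums (nmX_lt1 d x1).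
  apply: csum_ext (csum_sparse d (csumZ (d.+1%:R ^+ 3) h)) => n.
  rewrite /a; have [dn|//] := boolP (d.+1 %| n.+1)%N.
  have q0 : (0 < n.+1 %/ d.+1)%N by rewrite divn_gt0// dvdn_leq.
  congr (_ * _); rewrite -exprM; congr (_ ^+ _).
  by rewrite (prednK q0) mulnC divnK.
have cols n : csum (a^~ n) ((sigma 3 n.+1)%:R * x ^+ n.+1).
  have -> : (sigma 3 n.+1)%:R * x ^+ n.+1 = \sum_(0 <= d < n.+1) a d n.
    rewrite /sigma natr_sum mulr_suml sum_divisors//; apply: eq_bigr => d _.
    by rewrite /a; case: ifP => //; rewrite natrX.
  apply: lim_to_near (lim_to_cst _); exists n.+1 => // N /= nN.
  rewrite [RHS](@big_cat_nat _ _ _ n.+1)//=.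
  have -> : \sum_(n.+1 <= i < N) a i n = 0; last by rewrite addr0.
  rewrite big_nat_cond big1// => d; rewrite andbT => /andP[nd _].
  by rewrite /a gtnNdvd.
have [L [h1 h2 _]] := csum_exchange gs hs bnd rows cols.
by exists L; split.
Qed.

Lemma E4_series z : 0 < ip z -> exists L,
  csum (fun n => (sigma 3 n.+1)%:R * ee z ^+ n.+1) L /\ E4 z = 1 + 240 * L.
Proof.
move=> z0; have [L [h _]] := divisor_series (nm_ee_lt1 z0).
exists L; split=> //; congr (1 + 240 * _); apply: lim_to_limn.
apply: lim_to_near h; apply: nearW => N; rewrite big_add1/=.
by apply: eq_bigr => m _; rewrite ee_term.
Qed.

Lemma pi_neq0 : pi%:C != 0 :> R[i].
Proof. by apply/eqP => -[] /eqP; rewrite gt_eqF// pi_gt0. Qed.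

Lemma E4_G4 z L : 0 < ip z -> csum (G4row z) L -> L = pi%:C ^+ 4 / 45 * E4 z.
Proof.
move=> z0 hL; have z1 := nm_ee_lt1 z0.
have [L1 [h1 h2]] := divisor_series z1.
have [P [L2 [HP h3 h4]]] := @lambert_exchange 3 _ z1.
have L12 := csum_unique h2 h4; rewrite -L12 in h3.
have [L1' [h1' ->]] := E4_series z0; rewrite (csum_unique h1' h1).
have PE m : 2 * qtc (m.+1%:R * z) = 16 * pi%:C ^+ 4 / 3 * P m.
  have [_ _ h] := power_sums (nmX_lt1 m z1).
  rewrite (csum_unique (HP m) h) /qtc /sqc eeMn.
  by set A := ee z ^+ m.+1 / (1 - ee z ^+ m.+1) ^+ 2; field.
apply: (csum_unique hL).
have -> : pi%:C ^+ 4 / 45 * (1 + 240 * L1) = G4row z 0 + 16 * pi%:C ^+ 4 / 3 * L1.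
  by rewrite /=; field.
apply: csum_recl; apply: csum_ext (csumZ (16 * pi%:C ^+ 4 / 3) h3) => m.
by rewrite -PE.
Qed.

Lemma E4_inversion z : 0 < ip z -> E4 (- z^-1) = z ^+ 4 * E4 z.
Proof.
move=> z0; have [L [h1 h2]] := G4_inversion z0.
have e1 := E4_G4 z0 h1; have e2 := E4_G4 (ip_inv_gt0 z0) h2.
have p0 : pi%:C ^+ 4 / 45 != 0 :> R[i].
  by rewrite mulf_neq0 ?invr_eq0 ?pnatr_eq0// expf_neq0// pi_neq0.
by apply: (mulfI p0); rewrite -e2 e1; ring.
Qed.

Lemma cexp_nat_period z m : cexp (2 * pi%:C * 'i%C * m%:R * (z + 1)) =
  cexp (2 * pi%:C * 'i%C * m%:R * z).
Proof. by rewrite !ee_term eeD ee1 mulr1. Qed.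

Lemma E4_period z : E4 (z + 1) = E4 z.
Proof.
pose u x (N : nat) : R[i]^o := \sum_(1 <= m < N.+1)
  (sigma 3 m)%:R * cexp (2 * pi%:C * 'i%C * m%:R * x).
suff E : u (z + 1) = u z by rewrite /E4 -/(u (z + 1)) -/(u z) E.
by apply/funext => N; apply: eq_bigr => m _; rewrite cexp_nat_period.
Qed.

Lemma G2_lambert z L : 0 < ip z -> csum (G2row z) L ->
  exists A, csum (fun d => d.+1%:R * (ee z ^+ d.+1 / (1 - ee z ^+ d.+1))) A /\
    L = pi%:C ^+ 2 / 3 - 8 * pi%:C ^+ 2 * A.
Proof.
move=> z0 hL; have z1 := nm_ee_lt1 z0.
have [P [A [HP h3 h4]]] := @lambert_exchange 1 _ z1.
exists A; split; first by apply: csum_ext h4 => d; rewrite expr1.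
have PE m : 2 * sqc (m.+1%:R * z) = - (8 * pi%:C ^+ 2) * P m.
  have [_ h _] := power_sums (nmX_lt1 m z1).
  have h' : csum (fun d => d.+1%:R ^+ 1 * (ee z ^+ m.+1) ^+ d.+1)
      (ee z ^+ m.+1 / (1 - ee z ^+ m.+1) ^+ 2).
    by apply: csum_ext h => d; rewrite expr1.
  by rewrite (csum_unique (HP m) h') /sqc eeMn; set B := _ / _; ring.
apply: (csum_unique hL).
have -> : pi%:C ^+ 2 / 3 - 8 * pi%:C ^+ 2 * A = G2row z 0 + - (8 * pi%:C ^+ 2) * A.
  by rewrite /=; ring.
apply: csum_recl; apply: csum_ext (csumZ (- (8 * pi%:C ^+ 2)) h3) => m.
by rewrite -PE.
Qed.

End PowerSeries.

(** * The Dedekind eta function *)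

Section EulerProduct.
Context {R : realType}.
Implicit Types (x z h : R[i]) (r s : R).

Definition eprod x N : R[i] := \prod_(0 <= m < N) (1 - x ^+ m.+1).
Definition epr x : R[i] := limn (eprod x : nat -> R[i]^o).

Lemma eprodS x N : eprod x N.+1 = eprod x N * (1 - x ^+ N.+1).
Proof. by rewrite /eprod big_nat_recr. Qed.

Lemma eprod_upper x N : nm x < 1 -> nm (eprod x N) <= expR ((1 - nm x)^-1).
Proof.
move=> x1; have r01 : 0 <= nm x < 1 by rewrite nm_ge0.
suff h : nm (eprod x N) <= expR (\sum_(0 <= m < N) nm x ^+ m.+1).
  apply: le_trans h _; rewrite ler_expR.
  apply: le_trans (geometric_partial N.+1 r01).
  by rewrite big_nat_recl//= lerDr.
elim: N => [|N IH]; first by rewrite /eprod !big_geq// nm1 expR0.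
rewrite eprodS nmM big_nat_recr//= expRD; apply: ler_pM; rewrite ?nm_ge0//.
apply: le_trans (nmB _ _) _; rewrite nm1 nmX.
exact: expR_ge1Dx.
Qed.

Lemma eprod_lower x N : nm x < 1 -> expR (- (1 - nm x) ^- 2) <= nm (eprod x N).
Proof.
move=> x1; have r01 : 0 <= nm x < 1 by rewrite nm_ge0.
set r := nm x in x1 r01 *; have /andP[r0 _] := r01.
have r10 : 0 < 1 - r by rewrite subr_gt0.
suff h : expR (- ((1 - r)^-1 * \sum_(0 <= m < N) r ^+ m.+1)) <= nm (eprod x N).
  apply: le_trans h; rewrite ler_expR lerN2 expr2 invfM ler_wpM2l ?invr_ge0 ?(ltW r10)//.
  apply: le_trans (geometric_partial N.+1 r01).
  by rewrite big_nat_recl//= lerDr.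
elim: N => [|N IH]; first by rewrite /eprod !big_geq// nm1 mulr0 oppr0 expR0.
rewrite eprodS nmM big_nat_recr//= mulrDr opprD expRD.
apply: ler_pM; rewrite ?expR_ge0//; apply: le_trans (nm_subB _ _).
rewrite nm1 nmX -/r; set t := r ^+ N.+1.
have t0 : 0 <= t by rewrite exprn_ge0.
have tr : t <= r by rewrite /t exprS ler_piMr// exprn_ile1// ltW.
have t1 : 0 < 1 - t by lra.
rewrite expRN -[leRHS]invrK lef_pV2 ?posrE ?expR_gt0 ?invr_gt0//.
apply: le_trans (expR_ge1Dx _).
have -> : (1 - t)^-1 = 1 + t / (1 - t) by field; rewrite gt_eqF.
by rewrite lerD2l mulrC ler_wpM2r// lef_pV2 ?posrE//; lra.
Qed.

Lemma eprod_cvg x : nm x < 1 -> lim_to (eprod x) (epr x).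
Proof.
move=> x1; have r01 : 0 <= nm x < 1 by rewrite nm_ge0.
have B0 := expR_ge0 ((1 - nm x)^-1).
have hs := rsummableZ B0 (rsummable_shift (rsummable_geometric r01)).
have [l hl] : exists l, csum (fun N => - (eprod x N * x ^+ N.+1)) l.
  apply: (csum_exists hs) => N; rewrite nmN nmM nmX ler_wpM2r ?exprn_ge0 ?nm_ge0//.
  exact: eprod_upper.
have h : lim_to (eprod x) (1 + l).
  apply: lim_to_near (lim_toD (lim_to_cst 1) hl); apply: nearW => N /=.
  elim: N => [|N IH]; first by rewrite /eprod !big_geq// addr0.
  by rewrite big_nat_recr//= addrA IH eprodS; ring.
by rewrite /epr (lim_to_limn h).
Qed.

Lemma epr_lower x : nm x < 1 -> expR (- (1 - nm x) ^- 2) <= nm (epr x).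
Proof.
move=> x1; apply/ler_addgt0Pr => e e0.
have [N HN] := (lim_toP _ _).1 (eprod_cvg x1) e e0.
apply: le_trans (eprod_lower N x1) _; have := HN N (leqnn N) => h.
rewrite -[eprod x N](subrK (epr x)) (le_trans (nmD _ _))// addrC lerD2l ltW//.
Qed.

Lemma epr_upper x : nm x < 1 -> nm (epr x) <= expR ((1 - nm x)^-1).
Proof.
move=> x1; rewrite -[epr x]subr0; apply: lim_to_le (eprod_cvg x1).
by apply: nearW => N; rewrite subr0 eprod_upper.
Qed.

Lemma epr_neq0 x : nm x < 1 -> epr x != 0.
Proof.
by move=> x1; rewrite -nm_gt0 (lt_le_trans _ (epr_lower x1))// expR_gt0.
Qed.

Lemma prod_expansion (v : nat -> R[i]) (w : nat -> R) N : (forall n, nm (v n) <= w n) ->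
  \sum_(0 <= i < N) w i <= 1 ->
  nm (\prod_(0 <= i < N) (1 + v i) - 1 - \sum_(0 <= i < N) v i) <=
    (\sum_(0 <= i < N) w i) ^+ 2.
Proof.
move=> vw; have w0 n : 0 <= w n by apply: le_trans (vw n); apply: nm_ge0.
suff H : \sum_(0 <= i < N) w i <= 1 ->
  nm (\prod_(0 <= i < N) (1 + v i) - 1 - \sum_(0 <= i < N) v i) <=
    (\sum_(0 <= i < N) w i) ^+ 2 /\
  nm (\prod_(0 <= i < N) (1 + v i) - 1) <= 2 * \sum_(0 <= i < N) w i by case/H.
elim: N => [|N IH].
  by rewrite !big_geq// !subrr nm0 expr0n mulr0.
rewrite !big_nat_recr//=.
set P := \prod_(_ <= _ < _) _ in IH *; set S := \sum_(_ <= _ < _) v _ in IH *.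
set W := \sum_(_ <= _ < _) w _ in IH *.
have W0 : 0 <= W by apply: sumr_ge0.
move=> hW; have [|h1 h2] := IH; first by apply: le_trans hW; rewrite lerDl.
have wN := w0 N; have vN := vw N.
have h3 : nm (P * (1 + v N) - 1 - (S + v N)) <= (W + w N) ^+ 2.
  have -> : P * (1 + v N) - 1 - (S + v N) = (P - 1 - S) + v N * (P - 1) by ring.
  apply: le_trans (nmD _ _) _; rewrite nmM.
  have := ler_pM (nm_ge0 _) (nm_ge0 _) vN h2.
  by have := sqr_ge0 (w N); rewrite sqrrD mulr2n; lra.
split=> //; rewrite -(subrK (S + v N) (_ - 1)); apply: le_trans (nmD _ _) _.
have h4 : nm (S + v N) <= W + w N.
  apply: le_trans (nmD _ _) (lerD _ vN); apply: le_trans (nm_sum _ _ _) _.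
  exact: ler_sum.
have : (W + w N) ^+ 2 <= W + w N by rewrite expr2 ler_piMr// addr_ge0.
lra.
Qed.

Lemma power_increment x y s n : nm x <= s -> nm y <= s -> 0 < s ->
  nm (y ^+ n - x ^+ n) <= n%:R * (s ^+ n / s) * nm (y - x) /\
  nm (y ^+ n.+1 - x ^+ n.+1 - n.+1%:R * x ^+ n * (y - x)) <=
    n.+1%:R ^+ 2 * (s ^+ n / s) * nm (y - x) ^+ 2.
Proof.
move=> xs ys s0; set k := nm (y - x); have k0 : 0 <= k by apply: nm_ge0.
have xn m : nm (x ^+ m) <= s ^+ m by rewrite nmX lerXn2r ?nnegrE ?nm_ge0 ?(ltW s0).
have D m : nm (y ^+ m - x ^+ m) <= m%:R * (s ^+ m / s) * k.
  elim: m => [|m IH]; first by rewrite subrr nm0 !mul0r.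
  have -> : y ^+ m.+1 - x ^+ m.+1 = y * (y ^+ m - x ^+ m) + (y - x) * x ^+ m.
    by rewrite !exprS; ring.
  apply: le_trans (nmD _ _) _; rewrite !nmM -/k.
  have e1 : nm y * nm (y ^+ m - x ^+ m) <= s * (m%:R * (s ^+ m / s) * k).
    by apply: ler_pM; rewrite ?nm_ge0.
  have e2 : k * nm (x ^+ m) <= k * s ^+ m by rewrite ler_wpM2l.
  apply: le_trans (lerD e1 e2) _; rewrite le_eqVlt; apply/orP; left; apply/eqP.
  by rewrite exprS -natr1; field; rewrite gt_eqF.
split=> //; elim: n => [|m IH].
  by rewrite expr0 mulr1 mul1r !expr1 subrr nm0 !mulr_ge0 ?exprn_ge0 ?invr_ge0 ?(ltW s0).
have -> : y ^+ m.+2 - x ^+ m.+2 - m.+2%:R * x ^+ m.+1 * (y - x) =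
  x * (y ^+ m.+1 - x ^+ m.+1 - m.+1%:R * x ^+ m * (y - x)) +
  (y - x) * (y ^+ m.+1 - x ^+ m.+1).
  by rewrite -[m.+2%:R]natr1 !exprS; ring.
apply: le_trans (nmD _ _) _; rewrite !nmM -/k.
have e1 := ler_pM (nm_ge0 _) (nm_ge0 _) xs IH.
have e2 := ler_wpM2l k0 (D m.+1).
apply: le_trans (lerD e1 e2) _.
have -> : s * (m.+1%:R ^+ 2 * (s ^+ m / s) * k ^+ 2) + k * (m.+1%:R * (s ^+ m.+1 / s) * k) =
  (m.+1%:R ^+ 2 + m.+1%:R) * (s ^+ m * k ^+ 2).
  by rewrite [s ^+ m.+1]exprS; field; rewrite gt_eqF.
have -> : m.+2%:R ^+ 2 * (s ^+ m.+1 / s) * k ^+ 2 = m.+2%:R ^+ 2 * (s ^+ m * k ^+ 2).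
  by rewrite [s ^+ m.+1]exprS; field; rewrite gt_eqF.
rewrite ler_wpM2r ?mulr_ge0 ?exprn_ge0 ?(ltW s0)//.
have : 0 <= m.+1%:R :> R by [].
rewrite -[m.+2%:R]natr1; nra.
Qed.

Lemma cder_epr x A : nm x < 1 ->
  csum (fun m => m.+1%:R * (x ^+ m / (1 - x ^+ m.+1))) A ->
  cder epr x (- (epr x * A)).
Proof.
move=> x1 hA; set r := nm x; have r0 : 0 <= r by apply: nm_ge0.
pose s := (1 + r) / 2.
have r1 : r < 1 := x1.
have rs : r < s by rewrite /s; lra.
have s0 : 0 < s by rewrite /s; lra.
have s1 : s < 1 by rewrite /s; lra.
have s01 : 0 <= s < 1 by rewrite (ltW s0).
have r10 : 0 < 1 - r by rewrite subr_gt0.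
have D0 : 0 <= (s * (1 - r))^-1 by rewrite invr_ge0 mulr_ge0// ltW.
have [W1 [_ W10 HW1]] := rsummableP (rsummableZ D0 (rsummable_shift (rsummable_power 1 s01))).
have [W2 [_ W20 HW2]] := rsummableP (rsummableZ D0 (rsummable_shift (rsummable_power 2 s01))).
set B := expR ((1 - s)^-1).
have W11 : 0 < W1 + 1 by rewrite ltr_wpDl.
have B0 : 0 <= B by apply: expR_ge0.
exists (B * (W1 ^+ 2 + W2 / s)), (Num.min ((1 - r) / 2) (W1 + 1)^-1); split.
- by rewrite lt_min divr_gt0//= invr_gt0.
- by rewrite mulr_ge0// addr_ge0 ?exprn_ge0// divr_ge0// ltW.
move=> h; rewrite le_min => /andP[h1 h2]; set k := nm h in h1 h2 *.
have k0 : 0 <= k by apply: nm_ge0.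
set y := x + h; have yx : y - x = h by rewrite /y addrC addKr.
have xs : nm x <= s by rewrite ltW.
have ys : nm y <= s by apply: le_trans (nmD _ _) _; rewrite -/r -/k /s; lra.
have y1 : nm y < 1 by apply: le_lt_trans ys _.
have nz m : 1 - x ^+ m.+1 != 0 by apply: nm1B_gt0; apply: nmX_lt1.
have nlow m : 1 - r <= nm (1 - x ^+ m.+1).
  apply: le_trans (nm_subB _ _); rewrite nm1 nmX -/r lerD2l lerN2.
  by rewrite exprS ler_piMr// exprn_ile1// ltW.
have nlowV m : nm (1 - x ^+ m.+1)^-1 <= (1 - r)^-1.
  by rewrite nmV lef_pV2 ?posrE// (lt_le_trans r10).
pose v m := (x ^+ m.+1 - y ^+ m.+1) / (1 - x ^+ m.+1).
pose c m := - (m.+1%:R * (x ^+ m / (1 - x ^+ m.+1))).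
have ratio N : eprod y N = eprod x N * \prod_(0 <= m < N) (1 + v m).
  rewrite /eprod -big_split/=; apply: eq_bigr => m _.
  by rewrite /v; field; apply: nz.
pose w m := (s * (1 - r))^-1 * (m.+1%:R ^+ 1 * s ^+ m.+1) * k.
have vw m : nm (v m) <= w m.
  have [e _] := power_increment m.+1 xs ys s0; rewrite yx -/k in e.
  rewrite /v nmM nmBC; apply: le_trans (ler_pM (nm_ge0 _) (nm_ge0 _) e (nlowV m)) _.
  rewrite /w le_eqVlt; apply/orP; left; apply/eqP; field.
  by rewrite ?(gt_eqF s0) ?(gt_eqF r10).
have v2 m : nm (v m - c m * h) <= ((s * (1 - r))^-1 * (m.+1%:R ^+ 2 * s ^+ m.+1)) * (k ^+ 2 / s).
  have [_ e] := power_increment m xs ys s0; rewrite yx -/k in e.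
  have -> : v m - c m * h = - (y ^+ m.+1 - x ^+ m.+1 - m.+1%:R * x ^+ m * h) / (1 - x ^+ m.+1).
    by rewrite /v /c; field; apply: nz.
  rewrite nmM nmN; apply: le_trans (ler_pM (nm_ge0 _) (nm_ge0 _) e (nlowV m)) _.
  rewrite le_eqVlt; apply/orP; left; apply/eqP; rewrite [s ^+ m.+1]exprS; field.
  by rewrite ?(gt_eqF s0) ?(gt_eqF r10).
have wS N : \sum_(0 <= m < N) w m <= W1 * k.
  by rewrite -mulr_suml ler_wpM2r.
have Wk1 : W1 * k <= 1.
  move: h2; rewrite -[(W1 + 1)^-1]div1r ler_pdivlMr// mulrDr mulr1 mulrC; lra.
have main N : nm (eprod y N - eprod x N - eprod x N * (\sum_(0 <= m < N) c m) * h) <=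
    B * (W1 ^+ 2 + W2 / s) * k ^+ 2.
  have -> : eprod y N - eprod x N - eprod x N * (\sum_(0 <= m < N) c m) * h =
    eprod x N * ((\prod_(0 <= m < N) (1 + v m) - 1 - \sum_(0 <= m < N) v m) +
      \sum_(0 <= m < N) (v m - c m * h)).
    by rewrite ratio sumrB -mulr_suml; ring.
  rewrite nmM -mulrA; apply: ler_pM; rewrite ?nm_ge0//.
    apply: le_trans (eprod_upper _ x1) _; rewrite ler_expR lef_pV2 ?posrE; rewrite -/r; lra.
  apply: le_trans (nmD _ _) _; rewrite mulrDl lerD//.
    apply: le_trans (prod_expansion vw (le_trans (wS N) Wk1)) _.
    rewrite -exprMn lerXn2r ?nnegrE ?mulr_ge0//.
    by apply: sumr_ge0 => m _; apply: le_trans (vw m); apply: nm_ge0.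
  apply: le_trans (nm_sum _ _ _) _.
  apply: (@le_trans _ _ (\sum_(0 <= m < N) ((s * (1 - r))^-1 * (m.+1%:R ^+ 2 * s ^+ m.+1)) * (k ^+ 2 / s))).
    exact: ler_sum.
  rewrite -mulr_suml -mulrA [s^-1 * _]mulrC ler_wpM2r//.
  by rewrite mulr_ge0 ?exprn_ge0// invr_ge0 ltW.
have hc : csum c (- A) by exact: csumN hA.
have L1 := lim_toB (lim_toB (eprod_cvg y1) (eprod_cvg x1))
  (lim_toM (lim_toM (eprod_cvg x1) hc) (lim_to_cst h)).
have -> : - (epr x * A) * h = epr x * - A * h by ring.
rewrite -[X in nm X]subr0; apply: lim_to_le L1.
by apply: nearW => N; rewrite subr0; apply: main.
Qed.

End EulerProduct.

Section EtaInversion.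
Context {R : realType}.
Implicit Types (x z h : R[i]).

Lemma etaE z : eta z = cexp (pi%:C * 'i%C * z / 12) * epr (ee z).
Proof.
pose u (N : nat) : R[i]^o := \prod_(1 <= m < N.+1) (1 - cexp (2 * pi%:C * 'i%C * m%:R * z)).
suff E : u = eprod (ee z) by rewrite /eta -/u E.
apply/funext => N; rewrite /u /eprod big_add1/=.
by apply: eq_bigr => m _; rewrite ee_term.
Qed.

Lemma eta_neq0 z : 0 < ip z -> eta z != 0.
Proof. by move=> /nm_ee_lt1 z1; rewrite etaE mulf_neq0 ?cexp_neq0// epr_neq0. Qed.

Lemma cder_eta z L : 0 < ip z -> csum (G2row z) L ->
  cder (@eta R) z (eta z * ('i%C / (4 * pi%:C) * L)).
Proof.
move=> z0 hL; have z1 := nm_ee_lt1 z0; have [A [hA LE]] := G2_lambert z0 hL.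
have e0 : ee z != 0 by apply: ee_neq0.
have hA' : csum (fun m => m.+1%:R * (ee z ^+ m / (1 - ee z ^+ m.+1))) ((ee z)^-1 * A).
  apply: csum_ext (csumZ (ee z)^-1 hA) => m.
  have := nm1B_gt0 (nmX_lt1 m z1); rewrite !exprS => nz.
  by field; rewrite e0 nz.
have h1 := cder_comp (cder_linear (pi%:C * 'i%C / 12) 0 z) (@cder_cexp R _).
have h2 := cder_comp (@cder_ee R z) (cder_epr z1 hA').
have h3 := cderM h1 h2.
have -> : @eta R = fun x => cexp (pi%:C * 'i%C / 12 * x + 0) * epr (ee x).
  by apply/funext => x; rewrite etaE addr0; congr (cexp _ * _); ring.
apply: cder_eq h3 _; rewrite addr0 LE.
set X := cexp _; set Y := epr _.
by move: (@pi_neq0 R); move: (pi%:C) => p p0; field; rewrite e0 p0.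
Qed.

Lemma ipi_gt0 : 0 < ip ('i%C : R[i]). Proof. exact: ltr01. Qed.

Lemma invi : - ('i%C : R[i])^-1 = 'i%C.
Proof.
have i0 := @i_neq0 R; apply: (mulIf i0); rewrite mulNr mulVf// i2 //.
Qed.

(* By the quasi-modularity of G2, the logarithmic derivative of
   eta (-1/z)^2 / (z eta(z)^2) vanishes. *)
Lemma eta_inversion z : 0 < ip z -> eta (- z^-1) ^+ 2 = - 'i%C * z * eta z ^+ 2.
Proof.
move=> z0; pose F (x : R[i]) := eta (- x^-1) * eta (- x^-1) * (x * (eta x * eta x))^-1.
have dF x : 0 < ip x -> cder F x 0.
  move=> x0; have xn := ip_gt0_neq0 x0; have ex := eta_neq0 x0.
  have [L [h1 h2]] := G2_inversion x0.
  have d1 := cder_eta x0 h1; have d2 := cder_eta (ip_inv_gt0 x0) h2.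
  have d3 := cder_comp (cderN (cderV xn)) d2.
  have nz : x * (eta x * eta x) != 0 by rewrite mulf_neq0// mulf_neq0.
  have d4 := cder_comp (cderM (cder_id x) (cderM d1 d1)) (cderV nz).
  apply: cder_eq (cderM (cderM d3 d3) d4) _.
  set e1 := eta x in ex *; set e2 := eta _.
  have i2' := @i2 R.
  have p0 := @pi_neq0 R; move: (pi%:C) p0 => p p0.
  have -> : ('i%C : R[i]) / (4 * p) * (x ^+ 2 * L - 2 * p * 'i%C * x) =
    'i%C / (4 * p) * x ^+ 2 * L + x / 2.
    have -> : 'i%C / (4 * p) * (x ^+ 2 * L - 2 * p * 'i%C * x) =
      'i%C / (4 * p) * x ^+ 2 * L - ('i%C * 'i%C) * x / 2.
      by field; exact: p0.
    by rewrite i2; field; exact: p0.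
  by rewrite /=; field; rewrite ?xn ?ex ?p0.
have FE : F z = F 'i%C.
  apply: cder0_cst => t /andP[t0 t1]; apply: dF.
  rewrite ipD ipM ipD ipN /= mul0r addr0.
  have [->|t1'] := eqVneq t 1; first by rewrite mul1r addrC subrK.
  have : 0 < 1 - t by rewrite subr_gt0 lt_neqAle t1'.
  have : 0 <= t * ip z by rewrite mulr_ge0// ltW.
  lra.
have ei : eta ('i%C : R[i]) != 0 by apply: eta_neq0; apply: ipi_gt0.
have Fi : F 'i%C = - 'i%C.
  rewrite /F invi; have i0 := @i_neq0 R.
  have -> : eta 'i%C * eta 'i%C * ('i%C * (eta 'i%C * eta 'i%C))^-1 = ('i%C : R[i])^-1.
    by field; rewrite ei i0.
  by rewrite -[LHS]opprK invi.
rewrite Fi /F in FE; have ez := eta_neq0 z0; have zn := ip_gt0_neq0 z0.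
have nz : z * (eta z * eta z) != 0 by rewrite mulf_neq0// mulf_neq0.
by move: FE => /(canRL (mulfVK nz)); rewrite -!expr2 => ->; ring.
Qed.

Definition zeta12 : R[i] := cexp (pi%:C * 'i%C / 6).

Lemma eta_period z : eta (z + 1) ^+ 2 = zeta12 * eta z ^+ 2.
Proof.
have <- : cexp (pi%:C * 'i%C / 12) ^+ 2 = zeta12.
  by rewrite -cexpMn; congr cexp; field.
rewrite !etaE eeD ee1 mulr1.
have -> : pi%:C * 'i%C * (z + 1) / 12 = pi%:C * 'i%C * z / 12 + pi%:C * 'i%C / 12.
  by ring.
by rewrite cexpD; move: (cexp _) (cexp _) (epr _) => a b c; ring.
Qed.

Lemma zeta12_3 : zeta12 ^+ 3 = 'i%C.
Proof.
rewrite /zeta12 -cexpMn.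
have -> : 3%:R * (pi%:C * 'i%C / 6) = (pi / 2)%:C * 'i%C :> R[i].
  by rewrite rmorphM fmorphV rmorph_nat; field.
rewrite cexpE rpM ipM /= !(mul0r, mulr0, mulr1, add0r, subrr, addr0, oppr0).
by rewrite expR0 mul1r cos_pihalf sin_pihalf.
Qed.

Lemma zeta12_12 : zeta12 ^+ 12 = 1.
Proof. by rewrite (exprM _ 3 4) zeta12_3 (exprM _ 2 2) sqr_i sqrrN expr1n. Qed.

End EtaInversion.

(** * Modularity and Atkin-Lehner involutions *)

Section ModularGroup.

Lemma sl2_ind (P : int -> int -> int -> int -> Prop) :
  P 1 0 0 1 ->
  (forall a b c d, a * d - b * c = 1 -> P a b c d <-> P a (a + b) c (c + d)) ->
  (forall a b c d, a * d - b * c = 1 -> P a b c d -> P b (- a) d (- c)) ->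
  forall a b c d, a * d - b * c = 1 -> P a b c d.
Proof.
move=> H1 HT HS.
have HN a b c d : a * d - b * c = 1 -> P a b c d -> P (- a) (- b) (- c) (- d).
  move=> e h; apply: (HS b (- a) d (- c)); last exact: (HS a b c d e h).
  by rewrite -e; ring.
have HS' a b c d : a * d - b * c = 1 -> P b (- a) d (- c) -> P a b c d.
  have e1 : b * - c - - a * d = 1 -> a * d - b * c = 1 by move=> <-; ring.
  move=> e h; have e2 : b * - c - - a * d = 1 by rewrite -e; ring.
  have e3 : - a * - d - - b * - c = 1 by rewrite -e; ring.
  by have := HN _ _ _ _ e3 (HS _ _ _ _ e2 h); rewrite !opprK.
have HTn (k : nat) a b c d : a * d - b * c = 1 ->
    P a b c d <-> P a (b + k%:Z * a) c (d + k%:Z * c).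
  move=> e; elim: k => [|k IH]; first by rewrite !mul0r !addr0.
  rewrite IH HT; last by rewrite -e; ring.
  have -> : a + (b + k%:Z * a) = b + k.+1%:Z * a by rewrite intS; ring.
  by have -> : c + (d + k%:Z * c) = d + k.+1%:Z * c by rewrite intS; ring.
have HTz (k : int) a b c d : a * d - b * c = 1 ->
    P a b c d <-> P a (b + k * a) c (d + k * c).
  move=> e; case: k => k; first exact: HTn.
  rewrite (HTn k.+1 a (b + Negz k * a) c (d + Negz k * c)); last by rewrite -e; ring.
  have -> : b + Negz k * a + k.+1%:Z * a = b by rewrite NegzE; ring.
  by have -> : d + Negz k * c + k.+1%:Z * c = d by rewrite NegzE; ring.
move=> a b c; move: {2}(absz c).+1 (ltnSn (absz c)) => n.
elim: n a b c => // n IH a b c cn d e.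
have [c0|c0] := eqVneq c 0.
  rewrite c0 in e *; rewrite mulr0 subr0 in e.
  have base (x : int) : P 1 x 0 1.
    by have := (HTz x 1 0 0 1 erefl).1 H1; rewrite mulr1 mulr0 addr0 add0r.
  have /eqP : (absz a * absz d = 1)%N by rewrite -abszM e.
  rewrite muln_eq1 => /andP[/eqP ha /eqP hd].
  have [[-> ->]|[-> ->]] : (a = 1 /\ d = 1) \/ (a = -1 /\ d = -1).
    have [ea|ea] : a = 1 \/ a = -1 by lia.
      by left; split=> //; rewrite ea in e; lia.
    by right; split=> //; rewrite ea in e; lia.
    exact: base.
  have := HN _ _ _ _ _ (base (- b)); rewrite opprK oppr0; apply; ring.
apply/(HTz (- (d %/ c)%Z) _ _ _ _ e); apply: HS'; first by rewrite -e; ring.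
have -> : d + - (d %/ c)%Z * c = (d %% c)%Z by rewrite /modz; ring.
apply: IH; last by rewrite /modz -e; ring.
have := ltz_mod d c0; have := modz_ge0 d c0; lia.
Qed.

End ModularGroup.

Section Character.

(* eta^2 is multiplied by zeta12 ^ psi (c z + d) under (a, b; c, d).  As psi is
   only needed mod 12, its identities are decided by enumeration. *)
Definition psi (A : comNzRingType) (a b c d : A) : A :=
  (1 - c ^+ 2) * (b * d + 3 * (c - 1) * d + c + 3) + c * (a + d - 3).

Definition all12 (p : 'Z_12 -> bool) := all (fun i => p (inZp i)) (iota 0 12).

Lemma all12P (p : 'Z_12 -> bool) : all12 p -> forall x, p x.
Proof.
move=> /allP h x; have := h (nat_of_ord x); rewrite valZpK; apply.
by rewrite mem_iota ltn_ord.
Qed.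

Lemma all12P4 (det : 'Z_12 -> 'Z_12 -> 'Z_12 -> 'Z_12 -> 'Z_12)
    (p : 'Z_12 -> 'Z_12 -> 'Z_12 -> 'Z_12 -> bool) :
  all12 (fun a => all12 (fun b => all12 (fun c => all12 (fun d =>
    if det a b c d == 1 then p a b c d else true)))) ->
  forall a b c d, det a b c d = 1 -> p a b c d.
Proof.
move=> /all12P h a b c d e.
by have := all12P (all12P (all12P (h a) b) c) d; rewrite e eqxx.
Qed.

Lemma psi_T (a b c d : 'Z_12) : a * d - b * c = 1 ->
  psi a (a + b) c (c + d) = psi a b c d + 1.
Proof.
move=> e; apply/eqP; move: a b c d e.
by apply: (@all12P4 (fun a b c d => a * d - b * c)); vm_compute.
Qed.

Lemma psi_S (a b c d : 'Z_12) : a * d - b * c = 1 ->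
  psi b (- a) d (- c) = psi a b c d + 9.
Proof.
move=> e; apply/eqP; move: a b c d e.
by apply: (@all12P4 (fun a b c d => a * d - b * c)); vm_compute.
Qed.

Lemma psi_AL1 (a b c d : 'Z_12) : a * d - 6 * (b * c) = 1 ->
  psi a b (6 * c) d + psi a (2 * b) (3 * c) d +
  psi a (3 * b) (2 * c) d + psi a (6 * b) c d = 0.
Proof.
move=> e; apply/eqP; move: a b c d e.
by apply: (@all12P4 (fun a b c d => a * d - 6 * (b * c))); vm_compute.
Qed.

Lemma psi_AL2 (a b c d : 'Z_12) : 2 * (a * d) - 3 * (b * c) = 1 ->
  psi a b (3 * c) (2 * d) + psi (2 * a) b (3 * c) d +
  psi a (3 * b) c (2 * d) + psi (2 * a) (3 * b) c d = 0.
Proof.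
move=> e; apply/eqP; move: a b c d e.
by apply: (@all12P4 (fun a b c d => 2 * (a * d) - 3 * (b * c))); vm_compute.
Qed.

Lemma psi_AL3 (a b c d : 'Z_12) : 3 * (a * d) - 2 * (b * c) = 1 ->
  psi a b (2 * c) (3 * d) + psi a (2 * b) c (3 * d) +
  psi (3 * a) b (2 * c) d + psi (3 * a) (2 * b) c d = 0.
Proof.
move=> e; apply/eqP; move: a b c d e.
by apply: (@all12P4 (fun a b c d => 3 * (a * d) - 2 * (b * c))); vm_compute.
Qed.

Lemma psi_AL6 (a b c d : 'Z_12) : 6 * (a * d) - b * c = 1 ->
  psi a b c (6 * d) + psi (2 * a) b c (3 * d) +
  psi (3 * a) b c (2 * d) + psi (6 * a) b c d = 0.
Proof.
move=> e; apply/eqP; move: a b c d e.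
by apply: (@all12P4 (fun a b c d => 6 * (a * d) - b * c)); vm_compute.
Qed.

End Character.

Section ModularLaws.
Context {R : realType}.
Implicit Types (z : R[i]) (a b c d : int).

Definition toZ12 (k : int) : 'Z_12 := k%:~R.
Definition chi (x : 'Z_12) : R[i] := zeta12 ^+ x.

Lemma chiD x y : chi (x + y) = chi x * chi y.
Proof. by rewrite /chi -exprD -(expr_mod (x + y)%N zeta12_12). Qed.

Lemma chi1 : chi 1 = zeta12. Proof. by rewrite /chi expr1. Qed.

Lemma chi9 : chi 9 = - 'i%C.
Proof.
have -> : chi 9 = zeta12 ^+ (3 * 3) by [].
by rewrite exprM zeta12_3 exprS sqr_i mulrN1.
Qed.

Definition psiZ a b c d := psi (toZ12 a) (toZ12 b) (toZ12 c) (toZ12 d).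

Lemma det12 a b c d : a * d - b * c = 1 ->
  toZ12 a * toZ12 d - toZ12 b * toZ12 c = 1.
Proof. by move=> e; rewrite -!rmorphM -rmorphB e. Qed.

Lemma ip_intM a z : ip (a%:~R * z) = a%:~R * ip z.
Proof.
have -> : (a%:~R : R[i]) = (a%:~R : R)%:C by rewrite rmorph_int.
by rewrite ipM /= mul0r addr0.
Qed.

Lemma cocycle_neq0 a b c d z : a * d - b * c = 1 -> 0 < ip z ->
  c%:~R * z + d%:~R != 0 :> R[i].
Proof.
move=> e z0; apply/eqP => h.
have : ip (c%:~R * z + d%:~R) = 0 by rewrite h.
rewrite ipD ip_intM ip_int addr0 => /eqP.
rewrite mulf_eq0 (gt_eqF z0) orbF intr_eq0 => /eqP c0.
move: h; rewrite c0 mul0r add0r => /eqP; rewrite intr_eq0 => /eqP d0.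
by rewrite c0 d0 !mulr0 subrr in e.
Qed.

Definition mob a b c d z : R[i] := (a%:~R * z + b%:~R) / (c%:~R * z + d%:~R).

Lemma mob_T a b c d z : mob a (a + b) c (c + d) z = mob a b c d (z + 1).
Proof. by rewrite /mob !intrD; congr (_ / _); ring. Qed.

Lemma mob_S a b c d z : a * d - b * c = 1 -> 0 < ip z ->
  mob b (- a) d (- c) z = mob a b c d (- z^-1).
Proof.
move=> e z0; have zn := ip_gt0_neq0 z0; rewrite /mob !mulrNz.
have -> : a%:~R * - z^-1 + b%:~R = (b%:~R * z - a%:~R) / z by field.
have -> : c%:~R * - z^-1 + d%:~R = (d%:~R * z - c%:~R) / z by field.
by rewrite invf_div mulrA mulfVK.
Qed.

Lemma E4_modular a b c d : a * d - b * c = 1 -> forall z, 0 < ip z ->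
  E4 (mob a b c d z) = (c%:~R * z + d%:~R) ^+ 4 * E4 z.
Proof.
move: a b c d; apply: sl2_ind.
- by move=> z _; rewrite /mob mul1r !mul0r addr0 add0r divr1 expr1n mul1r.
- move=> a b c d e; split=> h z z0.
    rewrite mob_T h ?ipD ?addr0// E4_period intrD; congr (_ ^+ 4 * _); ring.
  have z1 : 0 < ip (z - 1) by rewrite ipD ipN subr0.
  have := h _ z1; rewrite mob_T subrK => ->.
  by rewrite -(E4_period (z - 1)) subrK intrD; congr (_ ^+ 4 * _); ring.
- move=> a b c d e h z z0; have zn := ip_gt0_neq0 z0.
  rewrite mob_S// h ?ip_inv_gt0// E4_inversion// mulrA -exprMn mulrNz.
  by congr (_ ^+ 4 * _); field.
Qed.

Lemma eta_modular a b c d : a * d - b * c = 1 -> forall z, 0 < ip z ->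
  eta (mob a b c d z) ^+ 2 =
    chi (psiZ a b c d) * (c%:~R * z + d%:~R) * eta z ^+ 2.
Proof.
have zz : zeta12 != 0 :> R[i] by apply: cexp_neq0.
move: a b c d; apply: sl2_ind.
- move=> z _; have -> : psiZ 1 0 0 1 = 0 by apply: val_inj.
  by rewrite /mob mul1r !mul0r addr0 add0r divr1 /chi expr0 !mul1r.
- move=> a b c d e.
  have pT : chi (psiZ a (a + b) c (c + d)) = chi (psiZ a b c d) * zeta12.
    rewrite -chi1 -chiD; congr chi.
    by rewrite /psiZ /toZ12 !intrD; apply: psi_T; apply: det12.
  split=> h z z0.
    rewrite mob_T h ?ipD ?addr0// eta_period pT intrD; ring.
  have z1 : 0 < ip (z - 1) by rewrite ipD ipN subr0.
  have := h _ z1; rewrite mob_T subrK => ->.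
  have pe : eta z ^+ 2 = zeta12 * eta (z - 1) ^+ 2 by rewrite -eta_period subrK.
  by rewrite pe pT intrD; ring.
- move=> a b c d e h z z0; have zn := ip_gt0_neq0 z0.
  have pS : chi (psiZ b (- a) d (- c)) = chi (psiZ a b c d) * - 'i%C.
    rewrite -chi9 -chiD; congr chi.
    by rewrite /psiZ /toZ12 !mulrNz; apply: psi_S; apply: det12.
  rewrite mob_S// h ?ip_inv_gt0// eta_inversion// pS mulrNz.
  by field.
Qed.

Lemma ip_natM (n : nat) z : 0 < ip z -> 0 < ip (n.+1%:R * z).
Proof. by move=> z0; rewrite ipMn mulr_gt0. Qed.

End ModularLaws.

Section AtkinLehner.
Context {R : realType}.
Implicit Types (z u v J e : R[i]) (a b c d : int).

Lemma intr_natC (n : nat) : ((n%:R : int)%:~R : R[i]) = n%:R.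
Proof. by rewrite rmorph_nat. Qed.

Lemma intr_natZ (n : nat) : toZ12 (n%:R : int) = n%:R.
Proof. by rewrite /toZ12 rmorph_nat. Qed.

Lemma toZ12M a b : toZ12 (a * b) = toZ12 a * toZ12 b.
Proof. by rewrite /toZ12 rmorphM. Qed.

Lemma scaled_modular a b c d (t N D e v : R[i]) :
  a * d - b * c = 1 -> 0 < ip v -> e != 0 ->
  t * N = e * (a%:~R * v + b%:~R) -> D = e * (c%:~R * v + d%:~R) ->
  E4 (t * (N / D)) = (D / e) ^+ 4 * E4 v /\
  eta (t * (N / D)) ^+ 2 = chi (psiZ a b c d) * (D / e) * eta v ^+ 2.
Proof.
move=> det v0 e0 hN hD.
have De : D / e = c%:~R * v + d%:~R by rewrite hD mulrC mulKf.
have -> : t * (N / D) = mob a b c d v.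
  by rewrite mulrA hN hD /mob -mulf_div divff// mul1r.
by rewrite De; split; [apply: E4_modular|apply: eta_modular].
Qed.

Lemma chi_sum4 x1 x2 x3 x4 : x1 + x2 + x3 + x4 = 0 ->
  chi x1 * chi x2 * chi x3 * chi x4 = 1 :> R[i].
Proof. by rewrite -!chiD => ->; rewrite /chi expr0. Qed.

(* The A's and B's stand for values of E4, the h's and k's for squares of values
   of eta. *)
Lemma quotient_transform (s J x1 x2 x3 x6 A1 A2 A3 A6 B1 B2 B3 B6 h1 h2 h3 h6 k1 k2 k3 k6 : R[i]) :
  x1 * x2 * x3 * x6 = 1 -> J != 0 -> s != 0 ->
  h1 * h2 * h3 * h6 != 0 ->
  B1 - 4 * B2 - 9 * B3 + 36 * B6 = s * J ^+ 4 * (A1 - 4 * A2 - 9 * A3 + 36 * A6) ->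
  k1 * k2 * k3 * k6 = `|s| * J ^+ 4 * (x1 * x2 * x3 * x6) * (h1 * h2 * h3 * h6) ->
  24^-1 * ((B1 - 4 * B2 - 9 * B3 + 36 * B6) / (k1 * k2 * k3 * k6)) =
  s / `|s| * (24^-1 * ((A1 - 4 * A2 - 9 * A3 + 36 * A6) / (h1 * h2 * h3 * h6))).
Proof.
move=> x1E J0 s0 h0 -> ->; rewrite x1E mulr1.
have s1 : `|s| != 0 by rewrite normr_eq0.
set A := A1 - _ - _ + _; move: h0; set H := h1 * h2 * h3 * h6 => h0.
by move: (`|s|) s1 => n n0; field; rewrite J0 n0 h0.
Qed.

Lemma sq4 (x1 x2 x3 x4 : R[i]) :
  (x1 * x2 * x3 * x4) ^+ 2 = x1 ^+ 2 * x2 ^+ 2 * x3 ^+ 2 * x4 ^+ 2.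
Proof. by ring. Qed.

Lemma eta4_neq0 z : 0 < ip z ->
  eta z ^+ 2 * eta (2 * z) ^+ 2 * eta (3 * z) ^+ 2 * eta (6 * z) ^+ 2 != 0.
Proof.
move=> z0; have h (n : nat) : eta (n.+1%:R * z) ^+ 2 != 0.
  by rewrite expf_neq0// eta_neq0// ip_natM.
have h1 : eta z ^+ 2 != 0 by rewrite expf_neq0// eta_neq0.
exact: mulf_neq0 (mulf_neq0 (mulf_neq0 h1 (h 1%N)) (h 2%N)) (h 5%N).
Qed.

(* The image of z under the matrix (w a, b; 6 c, w d), of determinant w. *)
Definition ALpt (w : int) a b c d z : R[i] :=
  (w%:~R * a%:~R * z + b%:~R) / (6 * c%:~R * z + w%:~R * d%:~R).

Lemma AL_den_neq0 (w v a b c d : int) z : w * v = 6 ->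
  w * (a * d) - v * (b * c) = 1 -> 0 < ip z ->
  6 * c%:~R * z + w%:~R * d%:~R != 0 :> R[i].
Proof.
move=> wv e z0; have w0 : w != 0 by apply/eqP => h; rewrite h mul0r in wv.
have -> : 6 * c%:~R * z + w%:~R * d%:~R = w%:~R * ((v * c)%:~R * z + d%:~R) :> R[i].
  by rewrite -(intr_natC 6) -[6%:R]/(6 : int) -wv !intrM; ring.
rewrite mulf_neq0 ?intr_eq0//; apply: (@cocycle_neq0 R (w * a) b) => //.
by rewrite -e; ring.
Qed.

Lemma f_AL1 a b c d z : a * d - 6 * (b * c) = 1 -> 0 < ip z ->
  f (ALpt 1 a b c d z) = f z.
Proof.
move=> e z0; rewrite /ALpt; set N := _ + _; set D := 6 * _ * _ + _.
have D0 : D != 0 by apply: (@AL_den_neq0 1 6 a b c d) => //; rewrite ?mul1r.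
have i0 n := ip_natM n z0.
have [p1 q1] : E4 (1 * (N / D)) = (D / 1) ^+ 4 * E4 z /\ eta (1 * (N / D)) ^+ 2 =
    chi (psiZ a b (6 * c) d) * (D / 1) * eta z ^+ 2.
  apply: scaled_modular; rewrite ?oner_eq0 ?pnatr_eq0 /N /D ?intrM ?intr_natC ?i0//;
      first [by ring|by apply: (etrans _ e); ring].
have [p2 q2] : E4 (2 * (N / D)) = (D / 1) ^+ 4 * E4 (2 * z) /\ eta (2 * (N / D)) ^+ 2 =
    chi (psiZ a (2 * b) (3 * c) d) * (D / 1) * eta (2 * z) ^+ 2.
  apply: scaled_modular; rewrite ?oner_eq0 ?pnatr_eq0 /N /D ?intrM ?intr_natC ?i0//;
      first [by ring|by apply: (etrans _ e); ring].
have [p3 q3] : E4 (3 * (N / D)) = (D / 1) ^+ 4 * E4 (3 * z) /\ eta (3 * (N / D)) ^+ 2 =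
    chi (psiZ a (3 * b) (2 * c) d) * (D / 1) * eta (3 * z) ^+ 2.
  apply: scaled_modular; rewrite ?oner_eq0 ?pnatr_eq0 /N /D ?intrM ?intr_natC ?i0//;
      first [by ring|by apply: (etrans _ e); ring].
have [p6 q6] : E4 (6 * (N / D)) = (D / 1) ^+ 4 * E4 (6 * z) /\ eta (6 * (N / D)) ^+ 2 =
    chi (psiZ a (6 * b) c d) * (D / 1) * eta (6 * z) ^+ 2.
  apply: scaled_modular; rewrite ?oner_eq0 ?pnatr_eq0 /N /D ?intrM ?intr_natC ?i0//;
      first [by ring|by apply: (etrans _ e); ring].
have pE : toZ12 a * toZ12 d - 6 * (toZ12 b * toZ12 c) = 1.
  by rewrite -(intr_natZ 6) -!toZ12M /toZ12 -rmorphB e.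
have := chi_sum4 (psi_AL1 pE).
rewrite mul1r in p1 q1; rewrite /f !sq4 p1 p2 p3 p6 q1 q2 q3 q6 /psiZ !toZ12M !intr_natZ => h.
have s0 : 1 != 0 :> R[i] by rewrite ?oppr_eq0 ?invr_eq0 ?oner_eq0 ?pnatr_eq0.
have sn : `|1 : R[i]| = 1 by rewrite ?normrN ger0_norm ?invr_ge0.
apply: etrans (@quotient_transform 1 D _ _ _ _ (E4 z) (E4 (2 * z)) (E4 (3 * z))
  (E4 (6 * z)) _ _ _ _ _ _ _ _ _ _ _ _ h D0 s0 (eta4_neq0 z0) _ _) _.
- by field.
- by rewrite sn; field.
- by rewrite sn; move: (24^-1 * _) => y; field.
Qed.

Lemma f_AL2 a b c d z : 2 * (a * d) - 3 * (b * c) = 1 -> 0 < ip z ->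
  f (ALpt 2 a b c d z) = - f z.
Proof.
move=> e z0; rewrite /ALpt; set N := _ + _; set D := 6 * _ * _ + _.
have D0 : D != 0 by apply: (@AL_den_neq0 2 3 a b c d) => //; rewrite ?mul1r.
have i0 n := ip_natM n z0.
have [p1 q1] : E4 (1 * (N / D)) = (D / 1) ^+ 4 * E4 (2 * z) /\ eta (1 * (N / D)) ^+ 2 =
    chi (psiZ a b (3 * c) (2 * d)) * (D / 1) * eta (2 * z) ^+ 2.
  apply: scaled_modular; rewrite ?oner_eq0 ?pnatr_eq0 /N /D ?intrM ?intr_natC ?i0//;
      first [by ring|by apply: (etrans _ e); ring].
have [p2 q2] : E4 (2 * (N / D)) = (D / 2) ^+ 4 * E4 z /\ eta (2 * (N / D)) ^+ 2 =
    chi (psiZ (2 * a) b (3 * c) d) * (D / 2) * eta z ^+ 2.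
  apply: scaled_modular; rewrite ?oner_eq0 ?pnatr_eq0 /N /D ?intrM ?intr_natC ?i0//;
      first [by ring|by apply: (etrans _ e); ring].
have [p3 q3] : E4 (3 * (N / D)) = (D / 1) ^+ 4 * E4 (6 * z) /\ eta (3 * (N / D)) ^+ 2 =
    chi (psiZ a (3 * b) c (2 * d)) * (D / 1) * eta (6 * z) ^+ 2.
  apply: scaled_modular; rewrite ?oner_eq0 ?pnatr_eq0 /N /D ?intrM ?intr_natC ?i0//;
      first [by ring|by apply: (etrans _ e); ring].
have [p6 q6] : E4 (6 * (N / D)) = (D / 2) ^+ 4 * E4 (3 * z) /\ eta (6 * (N / D)) ^+ 2 =
    chi (psiZ (2 * a) (3 * b) c d) * (D / 2) * eta (3 * z) ^+ 2.
  apply: scaled_modular; rewrite ?oner_eq0 ?pnatr_eq0 /N /D ?intrM ?intr_natC ?i0//;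
      first [by ring|by apply: (etrans _ e); ring].
have pE : 2 * (toZ12 a * toZ12 d) - 3 * (toZ12 b * toZ12 c) = 1.
  by rewrite -(intr_natZ 2) -(intr_natZ 3) -!toZ12M /toZ12 -rmorphB e.
have := chi_sum4 (psi_AL2 pE).
rewrite mul1r in p1 q1; rewrite /f !sq4 p1 p2 p3 p6 q1 q2 q3 q6 /psiZ !toZ12M !intr_natZ => h.
have s0 : (- 4^-1) != 0 :> R[i] by rewrite ?oppr_eq0 ?invr_eq0 ?oner_eq0 ?pnatr_eq0.
have sn : `|(- 4^-1) : R[i]| = 4^-1 by rewrite ?normrN ger0_norm ?invr_ge0.
apply: etrans (@quotient_transform (- 4^-1) D _ _ _ _ (E4 z) (E4 (2 * z)) (E4 (3 * z))
  (E4 (6 * z)) _ _ _ _ _ _ _ _ _ _ _ _ h D0 s0 (eta4_neq0 z0) _ _) _.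
- by field.
- by rewrite sn; field.
- by rewrite sn; move: (24^-1 * _) => y; field.
Qed.

Lemma f_AL3 a b c d z : 3 * (a * d) - 2 * (b * c) = 1 -> 0 < ip z ->
  f (ALpt 3 a b c d z) = - f z.
Proof.
move=> e z0; rewrite /ALpt; set N := _ + _; set D := 6 * _ * _ + _.
have D0 : D != 0 by apply: (@AL_den_neq0 3 2 a b c d) => //; rewrite ?mul1r.
have i0 n := ip_natM n z0.
have [p1 q1] : E4 (1 * (N / D)) = (D / 1) ^+ 4 * E4 (3 * z) /\ eta (1 * (N / D)) ^+ 2 =
    chi (psiZ a b (2 * c) (3 * d)) * (D / 1) * eta (3 * z) ^+ 2.
  apply: scaled_modular; rewrite ?oner_eq0 ?pnatr_eq0 /N /D ?intrM ?intr_natC ?i0//;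
      first [by ring|by apply: (etrans _ e); ring].
have [p2 q2] : E4 (2 * (N / D)) = (D / 1) ^+ 4 * E4 (6 * z) /\ eta (2 * (N / D)) ^+ 2 =
    chi (psiZ a (2 * b) c (3 * d)) * (D / 1) * eta (6 * z) ^+ 2.
  apply: scaled_modular; rewrite ?oner_eq0 ?pnatr_eq0 /N /D ?intrM ?intr_natC ?i0//;
      first [by ring|by apply: (etrans _ e); ring].
have [p3 q3] : E4 (3 * (N / D)) = (D / 3) ^+ 4 * E4 z /\ eta (3 * (N / D)) ^+ 2 =
    chi (psiZ (3 * a) b (2 * c) d) * (D / 3) * eta z ^+ 2.
  apply: scaled_modular; rewrite ?oner_eq0 ?pnatr_eq0 /N /D ?intrM ?intr_natC ?i0//;
      first [by ring|by apply: (etrans _ e); ring].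
have [p6 q6] : E4 (6 * (N / D)) = (D / 3) ^+ 4 * E4 (2 * z) /\ eta (6 * (N / D)) ^+ 2 =
    chi (psiZ (3 * a) (2 * b) c d) * (D / 3) * eta (2 * z) ^+ 2.
  apply: scaled_modular; rewrite ?oner_eq0 ?pnatr_eq0 /N /D ?intrM ?intr_natC ?i0//;
      first [by ring|by apply: (etrans _ e); ring].
have pE : 3 * (toZ12 a * toZ12 d) - 2 * (toZ12 b * toZ12 c) = 1.
  by rewrite -(intr_natZ 3) -(intr_natZ 2) -!toZ12M /toZ12 -rmorphB e.
have := chi_sum4 (psi_AL3 pE).
rewrite mul1r in p1 q1; rewrite /f !sq4 p1 p2 p3 p6 q1 q2 q3 q6 /psiZ !toZ12M !intr_natZ => h.
have s0 : (- 9^-1) != 0 :> R[i] by rewrite ?oppr_eq0 ?invr_eq0 ?oner_eq0 ?pnatr_eq0.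
have sn : `|(- 9^-1) : R[i]| = 9^-1 by rewrite ?normrN ger0_norm ?invr_ge0.
apply: etrans (@quotient_transform (- 9^-1) D _ _ _ _ (E4 z) (E4 (2 * z)) (E4 (3 * z))
  (E4 (6 * z)) _ _ _ _ _ _ _ _ _ _ _ _ h D0 s0 (eta4_neq0 z0) _ _) _.
- by field.
- by rewrite sn; field.
- by rewrite sn; move: (24^-1 * _) => y; field.
Qed.

Lemma f_AL6 a b c d z : 6 * (a * d) - b * c = 1 -> 0 < ip z ->
  f (ALpt 6 a b c d z) = f z.
Proof.
move=> e z0; rewrite /ALpt; set N := _ + _; set D := 6 * _ * _ + _.
have D0 : D != 0 by apply: (@AL_den_neq0 6 1 a b c d) => //; rewrite ?mul1r.
have i0 n := ip_natM n z0.
have [p1 q1] : E4 (1 * (N / D)) = (D / 1) ^+ 4 * E4 (6 * z) /\ eta (1 * (N / D)) ^+ 2 =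
    chi (psiZ a b c (6 * d)) * (D / 1) * eta (6 * z) ^+ 2.
  apply: scaled_modular; rewrite ?oner_eq0 ?pnatr_eq0 /N /D ?intrM ?intr_natC ?i0//;
      first [by ring|by apply: (etrans _ e); ring].
have [p2 q2] : E4 (2 * (N / D)) = (D / 2) ^+ 4 * E4 (3 * z) /\ eta (2 * (N / D)) ^+ 2 =
    chi (psiZ (2 * a) b c (3 * d)) * (D / 2) * eta (3 * z) ^+ 2.
  apply: scaled_modular; rewrite ?oner_eq0 ?pnatr_eq0 /N /D ?intrM ?intr_natC ?i0//;
      first [by ring|by apply: (etrans _ e); ring].
have [p3 q3] : E4 (3 * (N / D)) = (D / 3) ^+ 4 * E4 (2 * z) /\ eta (3 * (N / D)) ^+ 2 =
    chi (psiZ (3 * a) b c (2 * d)) * (D / 3) * eta (2 * z) ^+ 2.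
  apply: scaled_modular; rewrite ?oner_eq0 ?pnatr_eq0 /N /D ?intrM ?intr_natC ?i0//;
      first [by ring|by apply: (etrans _ e); ring].
have [p6 q6] : E4 (6 * (N / D)) = (D / 6) ^+ 4 * E4 z /\ eta (6 * (N / D)) ^+ 2 =
    chi (psiZ (6 * a) b c d) * (D / 6) * eta z ^+ 2.
  apply: scaled_modular; rewrite ?oner_eq0 ?pnatr_eq0 /N /D ?intrM ?intr_natC ?i0//;
      first [by ring|by apply: (etrans _ e); ring].
have pE : 6 * (toZ12 a * toZ12 d) - toZ12 b * toZ12 c = 1.
  by rewrite -(intr_natZ 6)  -!toZ12M /toZ12 -rmorphB e.
have := chi_sum4 (psi_AL6 pE).
rewrite mul1r in p1 q1; rewrite /f !sq4 p1 p2 p3 p6 q1 q2 q3 q6 /psiZ !toZ12M !intr_natZ => h.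
have s0 : 36^-1 != 0 :> R[i] by rewrite ?oppr_eq0 ?invr_eq0 ?oner_eq0 ?pnatr_eq0.
have sn : `|36^-1 : R[i]| = 36^-1 by rewrite ?normrN ger0_norm ?invr_ge0.
apply: etrans (@quotient_transform 36^-1 D _ _ _ _ (E4 z) (E4 (2 * z)) (E4 (3 * z))
  (E4 (6 * z)) _ _ _ _ _ _ _ _ _ _ _ _ h D0 s0 (eta4_neq0 z0) _ _) _.
- by field.
- by rewrite sn; field.
- by rewrite sn; move: (24^-1 * _) => y; field.
Qed.

End AtkinLehner.

(** * Behaviour at the cusp *)

Section Bound.
Context {R : realType}.
Implicit Types (x z : R[i]).

Lemma expRN1_ge : 1 / 3 <= expR (- 1) :> R.
Proof.
have h : 9 / 10 <= expR (- (1 / 10)) :> R.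
  by apply: le_trans (expR_ge1Dx _); lra.
have -> : expR (- 1) = expR (- (1 / 10)) ^+ 10 :> R.
  by rewrite -expRM_natl; congr expR; field.
have h10 : (9 / 10) ^+ 10 <= expR (- (1 / 10)) ^+ 10 :> R.
  by rewrite lerXn2r ?nnegrE ?expR_ge0//; lra.
apply: le_trans h10; rewrite !exprS expr0; lra.
Qed.

Lemma expR_le3 (n : nat) (y : R) : y <= n%:R -> expR y <= 3 ^+ n.
Proof.
move=> yn; have h1 : expR 1 <= 3 :> R.
  by rewrite -lef_pV2 ?posrE ?expR_gt0// -expRN -div1r expRN1_ge.
apply: (@le_trans _ _ (expR n%:R)); first by rewrite ler_expR.
rewrite -[n%:R]mulr1 expRM_natl lerXn2r ?nnegrE ?expR_ge0//.
Qed.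

Lemma expR_ge3 (n : nat) (y : R) : y <= n%:R -> (3 ^+ n)^-1 <= expR (- y).
Proof.
by move=> yn; rewrite expRN lef_pV2 ?posrE ?exprn_gt0 ?expR_gt0// expR_le3.
Qed.

Lemma nm_ee_small z : Num.sqrt 3 / 12 <= ip z -> nm (ee z) <= 61 / 100.
Proof.
move=> hz; have pi2 := @pi_ge2 R.
have s3 : 173 / 100 <= Num.sqrt 3 :> R.
  rewrite -[leLHS]ger0_norm; last lra.
  by rewrite -sqrtr_sqr ler_wsqrtr// expr2; lra.
rewrite nm_ee; have h : 173 / 300 <= 2 * pi * ip z.
  have : 2 * 2 * (173 / 1200) <= 2 * pi * ip z.
    by apply: ler_pM; lra.
  lra.
apply: (@le_trans _ _ (expR (- (173 / 300)))); first by rewrite ler_expR; lra.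
have h1 : 1 + 173 / 600 <= expR (173 / 600) :> R by apply: expR_ge1Dx.
have p : 0 < (61 / 100 : R)^-1 by rewrite invr_gt0; lra.
rewrite expRN -[61 / 100]invrK lef_pV2 ?posrE ?expR_gt0 ?p//.
have -> : 173 / 300 = 2%:R * (173 / 600) :> R by field.
rewrite expRM_natl invf_div.
apply: (@le_trans _ _ ((1 + 173 / 600) ^+ 2)); first by rewrite expr2; lra.
have q0 : 0 <= 1 + 173 / 600 :> R by lra.
by apply: lerXn2r; rewrite ?nnegrE ?expR_ge0 ?q0.
Qed.

Lemma divisor_series_bound x L : nm x <= 61 / 100 ->
  csum (fun n => (sigma 3 n.+1)%:R * x ^+ n.+1) L -> nm L <= (200 * 200) * nm x.
Proof.
move=> xr hL; set r := nm x in xr *; have r0 : 0 <= r by apply: nm_ge0.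
have x1 : nm x < 1 by rewrite -/r; lra.
have [L' [h1 h2]] := divisor_series x1; rewrite (csum_unique hL h1).
pose t : R := 9 / 10.
have t01 : 0 <= t < 1 by rewrite /t; lra.
have t0 : 0 <= t by rewrite /t; lra.
have rt : r <= t ^+ 4 by rewrite /t !exprS expr0; lra.
have term d : nm (d.+1%:R ^+ 3 * (x ^+ d.+1 / (1 - x ^+ d.+1))) <= (50 * 79) * r * t ^+ d.
  rewrite nmM nmf !nmX nmn -/r.
  have den : 39 / 100 <= nm (1 - x ^+ d.+1).
    apply: le_trans (nm_subB _ _); rewrite nm1 nmX -/r.
    have : r ^+ d.+1 <= r by rewrite exprS ler_piMr// exprn_ile1//; lra.
    lra.
  have den0 : 0 < nm (1 - x ^+ d.+1) by lra.
  have deni : (nm (1 - x ^+ d.+1))^-1 <= 100 / 39.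
    by rewrite -[100 / 39]invrK lef_pV2 ?posrE ?invr_gt0 ?invf_div//; lra.
  have lin : d.+1%:R * t ^+ d <= 100 / 9.
    have := linear_geometric_bound d.+1 t01; rewrite exprS mulrCA.
    have -> : (1 - t)^-1 = 10 by rewrite /t; field.
    by rewrite /t; lra.
  have rd : r ^+ d <= (t ^+ d) ^+ 4.
    by rewrite -exprM mulnC exprM lerXn2r ?nnegrE ?exprn_ge0.
  have l0 : 0 <= d.+1%:R * t ^+ d by rewrite mulr_ge0 ?exprn_ge0.
  have cube : (d.+1%:R * t ^+ d) ^+ 3 <= (100 / 9) ^+ 3.
    by rewrite lerXn2r ?nnegrE//; lra.
  have main : d.+1%:R ^+ 3 * r ^+ d <= (100 / 9) ^+ 3 * t ^+ d.
    apply: (@le_trans _ _ ((d.+1%:R * t ^+ d) ^+ 3 * t ^+ d)).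
      have -> : (d.+1%:R * t ^+ d) ^+ 3 * t ^+ d = d.+1%:R ^+ 3 * (t ^+ d) ^+ 4.
        by ring.
      by rewrite ler_wpM2l ?exprn_ge0.
    by rewrite ler_wpM2r ?exprn_ge0.
  have -> : d.+1%:R ^+ 3 * (r ^+ d.+1 / nm (1 - x ^+ d.+1)) =
    r * (d.+1%:R ^+ 3 * r ^+ d) * (nm (1 - x ^+ d.+1))^-1 by rewrite [r ^+ d.+1]exprS; ring.
  apply: (@le_trans _ _ (r * ((100 / 9) ^+ 3 * t ^+ d) * (100 / 39))).
    apply: ler_pM => //.
    - by rewrite mulr_ge0// mulr_ge0 ?exprn_ge0.
    - by rewrite invr_ge0 ltW.
    - by rewrite ler_wpM2l.
  have : 0 <= r * t ^+ d by rewrite mulr_ge0 ?exprn_ge0.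
  rewrite !exprS expr0; lra.
apply: (csum_le term) h2 => N; rewrite -mulr_sumr.
have := geometric_partial N t01.
have -> : (1 - t)^-1 = 10 by rewrite /t; field.
move=> h; have := ler_wpM2l r0 h; lra.
Qed.

Lemma epr_near1 x : nm x <= 61 / 100 -> nm (epr x - 1) <= 70 * nm x.
Proof.
move=> xr; set r := nm x in xr *; have r0 : 0 <= r by apply: nm_ge0.
have x1 : nm x < 1 by rewrite -/r; lra.
have r01 : 0 <= r < 1 by apply/andP; split=> //; lra.
apply: lim_to_le (eprod_cvg x1); apply: nearW => N.
have i39 : (1 - r)^-1 <= 100 / 39.
  by rewrite -[100 / 39]invrK lef_pV2 ?posrE ?invr_gt0 ?invf_div//; lra.
have up k : nm (eprod x k) <= 27.
  apply: le_trans (eprod_upper k x1) _; rewrite -/r.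
  have -> : 27 = 3 ^+ 3 :> R by ring.
  by apply: expR_le3; lra.
have -> : eprod x N - 1 = \sum_(0 <= i < N) - (eprod x i * x ^+ i.+1).
  elim: N => [|N IH]; first by rewrite /eprod !big_geq// subrr.
  by rewrite big_nat_recr//= -IH eprodS; ring.
apply: le_trans (nm_sum _ _ _) _.
apply: (@le_trans _ _ (\sum_(0 <= i < N) 27 * r * r ^+ i)).
  apply: ler_sum => i _; rewrite nmN nmM nmX -/r exprS -mulrA.
  by rewrite ler_wpM2r// mulr_ge0 ?exprn_ge0.
rewrite -mulr_sumr; have := geometric_partial N r01 => h.
have := ler_wpM2l r0 (le_trans h i39); lra.
Qed.

Lemma ee_nat n z : ee (n%:R * z) = ee z ^+ n. Proof. exact: eeMn. Qed.

Lemma eta_product z : (eta z * eta (2 * z) * eta (3 * z) * eta (6 * z)) ^+ 2 =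
  ee z * (epr (ee z) * epr (ee z ^+ 2) * epr (ee z ^+ 3) * epr (ee z ^+ 6)) ^+ 2.
Proof.
rewrite !etaE !ee_nat.
have <- : (cexp (pi%:C * 'i%C * z / 12) * cexp (pi%:C * 'i%C * (2 * z) / 12) *
  cexp (pi%:C * 'i%C * (3 * z) / 12) * cexp (pi%:C * 'i%C * (6 * z) / 12)) ^+ 2 = ee z.
  by rewrite -!cexpD -cexpMn /ee; congr cexp; field.
move: (epr _) (epr _) (epr _) (epr _) => e1 e2 e3 e4.
move: (cexp _) (cexp _) (cexp _) (cexp _) => c1 c2 c3 c4; ring.
Qed.

Lemma prod4_near1 (p1 p2 p3 p4 : R[i]) (u : R) : 0 <= u ->
  nm (p1 - 1) <= u -> nm (p2 - 1) <= u -> nm (p3 - 1) <= u -> nm (p4 - 1) <= u ->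
  nm p1 <= 27 -> nm p2 <= 9 -> nm p3 <= 9 -> nm p4 <= 9 ->
  nm ((p1 * p2 * p3 * p4) ^+ 2 - 1) <= (50 * 50) * (141 * 140) * u.
Proof.
move=> u0 h1 h2 h3 h4 b1 b2 b3 b4.
have P12 : nm (p1 * p2) <= 27 * 9 by rewrite nmM ler_pM ?nm_ge0.
have P123 : nm (p1 * p2 * p3) <= 27 * 9 * 9 by rewrite nmM ler_pM ?nm_ge0.
have P : nm (p1 * p2 * p3 * p4) <= 27 * 9 * 9 * 9 by rewrite nmM ler_pM ?nm_ge0.
have -> : (p1 * p2 * p3 * p4) ^+ 2 - 1 =
  ((p1 - 1) + p1 * (p2 - 1) + p1 * p2 * (p3 - 1) + p1 * p2 * p3 * (p4 - 1)) *
  (p1 * p2 * p3 * p4 + 1) by ring.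
have A : nm ((p1 - 1) + p1 * (p2 - 1) + p1 * p2 * (p3 - 1) + p1 * p2 * p3 * (p4 - 1))
    <= (50 * 50) * u.
  apply: (@le_trans _ _ (u + 27 * u + 27 * 9 * u + 27 * 9 * 9 * u)); last lra.
  apply: le_trans (nmD _ _) (lerD _ _); last by rewrite nmM ler_pM ?nm_ge0.
  apply: le_trans (nmD _ _) (lerD _ _); last by rewrite nmM ler_pM ?nm_ge0.
  apply: le_trans (nmD _ _) (lerD _ _) => //; by rewrite nmM ler_pM ?nm_ge0.
have B : nm (p1 * p2 * p3 * p4 + 1) <= (141 * 140).
  by apply: le_trans (nmD _ _) _; rewrite nm1; lra.
have -> : (50 * 50) * (141 * 140) * u = (50 * 50) * u * (141 * 140) by ring.
by rewrite nmM ler_pM ?nm_ge0.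
Qed.

Lemma epr_bounds x (rho c : R) n : nm x <= rho -> rho < 1 -> 1 <= c * (1 - rho) ->
  c <= n%:R -> nm (epr x) <= 3 ^+ n /\ expR (- (c ^+ 2)) <= nm (epr x).
Proof.
move=> xr r1 hc cn; have x1 : nm x < 1 by apply: le_lt_trans r1.
have r0 : 0 < 1 - rho by rewrite subr_gt0.
have x0 : 0 < 1 - nm x by rewrite subr_gt0.
have ic : (1 - nm x)^-1 <= c.
  apply: (@le_trans _ _ (1 - rho)^-1); first by rewrite lef_pV2 ?posrE// lerD2l lerN2.
  by rewrite -[leLHS]div1r ler_pdivrMr.
have i0 : 0 <= (1 - nm x)^-1 by rewrite invr_ge0 ltW.
split.
  by apply: le_trans (epr_upper x1) _; apply: expR_le3; apply: le_trans cn.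
apply: le_trans (epr_lower x1); rewrite ler_expR lerN2 -exprVn.
by apply: lerXn2r; rewrite ?nnegrE// (le_trans i0).
Qed.

Lemma power_bounds (r : R) : 0 <= r -> r <= 61 / 100 ->
  [/\ r ^+ 2 <= 373 / 1000, r ^+ 3 <= 23 / 100 & r ^+ 6 <= 6 / 100].
Proof.
move=> r0 xr.
have r2 : r ^+ 2 <= 373 / 1000 by have := ler_pM r0 r0 xr xr; rewrite -expr2; lra.
have r20 : 0 <= r ^+ 2 by exact: exprn_ge0.
have r3 : r ^+ 3 <= 23 / 100.
  by have := ler_pM r0 r20 xr r2; rewrite -exprS; lra.
have r30 : 0 <= r ^+ 3 by exact: exprn_ge0.
split=> //; by have := ler_pM r30 r30 r3 r3; rewrite -exprD; lra.
Qed.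

Lemma euler_bounds1 x : nm x <= 61 / 100 ->
  nm (epr x) <= 27 /\ expR (- ((257 / 100) ^+ 2)) <= nm (epr x).
Proof.
move=> h; have -> : 27 = 3 ^+ 3 :> R by ring.
by apply: (epr_bounds h); lra.
Qed.

Lemma euler_bounds2 x : nm x <= 373 / 1000 ->
  nm (epr x) <= 9 /\ expR (- ((16 / 10) ^+ 2)) <= nm (epr x).
Proof.
move=> h; have -> : 9 = 3 ^+ 2 :> R by ring.
by apply: (epr_bounds h); lra.
Qed.

Lemma euler_bounds3 x : nm x <= 23 / 100 ->
  nm (epr x) <= 9 /\ expR (- ((13 / 10) ^+ 2)) <= nm (epr x).
Proof.
move=> h; have -> : 9 = 3 ^+ 2 :> R by ring.
by apply: (epr_bounds h); lra.
Qed.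

Lemma euler_bounds6 x : nm x <= 6 / 100 ->
  nm (epr x) <= 9 /\ expR (- ((107 / 100) ^+ 2)) <= nm (epr x).
Proof.
move=> h; have -> : 9 = 3 ^+ 2 :> R by ring.
by apply: (epr_bounds h); lra.
Qed.

Lemma square_sum12 : (257 / 100) ^+ 2 + (16 / 10) ^+ 2 + (13 / 10) ^+ 2 +
  (107 / 100) ^+ 2 <= 12%:R :> R.
Proof. by rewrite !expr2; lra. Qed.

Definition eulerQ x : R[i] := epr x * epr (x ^+ 2) * epr (x ^+ 3) * epr (x ^+ 6).

Lemma nm_power_le x k : nm x < 1 -> nm (x ^+ k.+1) <= nm x.
Proof.
by move=> x1; rewrite nmX exprS ler_piMr ?nm_ge0// exprn_ile1 ?nm_ge0// ltW.
Qed.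

Lemma lt61 x : nm x <= 61 / 100 -> nm x < 1. Proof. by lra. Qed.

Lemma eulerQ_bounds x : nm x <= 61 / 100 ->
  nm (eulerQ x ^+ 2 - 1) <= (50 * 50) * (141 * 140) * (70 * nm x) /\
  (3 ^+ 12)^-1 <= nm (eulerQ x).
Proof.
move=> xr; have x1 := lt61 xr.
have [r2 r3 r6] := power_bounds (nm_ge0 x) xr; rewrite -!nmX in r2 r3 r6.
have [u1 v1] := euler_bounds1 xr; have [u2 v2] := euler_bounds2 r2.
have [u3 v3] := euler_bounds3 r3; have [u6 v6] := euler_bounds6 r6.
have near k : nm (epr (x ^+ k.+1) - 1) <= 70 * nm x.
  have h := nm_power_le k x1; apply: le_trans (epr_near1 (le_trans h xr)) _.
  by apply: ler_wpM2l; [exact: ler0n|].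
have n1 := near 0%N; rewrite expr1 in n1; split.
  apply: prod4_near1 n1 (near 1%N) (near 2%N) (near 5%N) u1 u2 u3 u6.
  by apply: mulr_ge0; [exact: ler0n|exact: nm_ge0].
apply: le_trans (expR_ge3 square_sum12) _.
rewrite !opprD !expRD /eulerQ !nmM.
have e0 := @expR_ge0 R.
apply: ler_pM v6; rewrite ?mulr_ge0 ?e0//.
apply: ler_pM v3; rewrite ?mulr_ge0 ?e0//.
by apply: ler_pM v2; rewrite ?e0.
Qed.

Lemma lambda_bound (L1 L2 L3 L6 : R[i]) (b : R) :
  nm L1 <= b -> nm L2 <= b -> nm L3 <= b -> nm L6 <= b ->
  nm (L1 - 4 * L2 - 9 * L3 + 36 * L6) <= 50 * b.
Proof.
move=> l1 l2 l3 l6.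
have c (n : nat) L : nm L <= b -> nm (n%:R * L) <= n%:R * b.
  by move=> hl; rewrite nmM nmn; apply: ler_wpM2l; [exact: ler0n|].
apply: (@le_trans _ _ (b + 4%:R * b + 9%:R * b + 36%:R * b)); last lra.
apply: le_trans (nmD _ _) (lerD _ (c 36%N _ l6)).
apply: le_trans (nmB _ _) (lerD _ (c 9%N _ l3)).
by apply: le_trans (nmB _ _) (lerD l1 (c 4%N _ l2)).
Qed.

Lemma E4_bound n z : 0 < ip z -> nm (ee z) <= 61 / 100 -> exists L,
  E4 (n.+1%:R * z) = 1 + 240 * L /\ nm L <= (200 * 200) * nm (ee z).
Proof.
move=> z0 xr; have [L [hL E]] := E4_series (ip_natM n z0); exists L; split=> //.
rewrite ee_nat in hL; have h := nm_power_le n (lt61 xr).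
apply: le_trans (divisor_series_bound (le_trans h xr) hL) _.
by apply: ler_wpM2l h; apply: mulr_ge0; exact: ler0n.
Qed.

Lemma final_num1 (r A B : R) : 0 <= r -> A <= 50 * (200 * 200 * r) ->
  B <= (50 * 50) * (141 * 140) * (70 * r) -> 10 * A + B <= (59 * 59) * 10 ^+ 6 * r.
Proof. by rewrite !exprS expr0; lra. Qed.

Lemma final_num2 : (59 * 59) * 10 ^+ 6 <= 2 * 10 ^+ 21 * ((3 ^+ 12)^-1) ^+ 2 :> R.
Proof.
have h : 3 ^+ 12 <= 54 * 10 ^+ 4 :> R by rewrite !exprS expr0; lra.
have p : 0 < 3 ^+ 12 :> R by exact: exprn_gt0.
rewrite exprVn ler_pdivlMr ?exprn_gt0//.
move: (3 ^+ 12) h p => X h p; have := ler_pM (ltW p) (ltW p) h h.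
rewrite -expr2; move: (X ^+ 2) => Y; rewrite !exprS expr0; lra.
Qed.

Lemma f_near_pole z : Num.sqrt 3 / 12 <= ip z ->
  nm (f z - ee (- z)) <= 2 * 10 ^+ 21.
Proof.
move=> hz; have xr := nm_ee_small hz.
have s3 : 0 < Num.sqrt 3 / 12 :> R by rewrite divr_gt0// sqrtr_gt0.
have z0 : 0 < ip z by apply: lt_le_trans hz.
have x0 : ee z != 0 by apply: ee_neq0.
have [L1 [e1 l1]] := E4_bound 0 z0 xr; have [L2 [e2 l2]] := E4_bound 1 z0 xr.
have [L3 [e3 l3]] := E4_bound 2 z0 xr; have [L6 [e6 l6]] := E4_bound 5 z0 xr.
rewrite mul1r in e1.
have [Q1 Qlow] := eulerQ_bounds xr; set Q := eulerQ (ee z) in Q1 Qlow.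
have Q0 : 0 < nm Q by apply: lt_le_trans Qlow; rewrite invr_gt0; exact: exprn_gt0.
have Q0' : Q != 0 by rewrite -nm_gt0.
have LamB := lambda_bound l1 l2 l3 l6.
set Lam := L1 - 4 * L2 - 9 * L3 + 36 * L6 in LamB.
have fE : f z - ee (- z) = (10 * Lam - (Q ^+ 2 - 1)) / (ee z * Q ^+ 2).
  rewrite eeN /f eta_product -/(eulerQ _) -/Q e1 e2 e3 e6 /Lam.
  by move: (ee z) x0 => x x0; field; rewrite x0 Q0'.
have num : nm (10 * Lam - (Q ^+ 2 - 1)) <= (59 * 59) * 10 ^+ 6 * nm (ee z).
  apply: le_trans (nmB _ _) _; rewrite nmM nmn.
  exact: final_num1 (nm_ge0 _) LamB Q1.
have rp : 0 < nm (ee z) by rewrite nm_gt0.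
rewrite fE nmf ler_pdivrMr; last by rewrite nmM mulr_gt0// nmX exprn_gt0.
apply: le_trans num _; rewrite nmM nmX [nm (ee z) * _]mulrC [leRHS]mulrA.
suff h : (59 * 59) * 10 ^+ 6 <= 2 * 10 ^+ 21 * nm Q ^+ 2.
  exact: (ler_wpM2r (ltW rp) h).
apply: le_trans final_num2 _; apply: ler_wpM2l.
  by apply: mulr_ge0; [exact: ler0n|exact: exprn_ge0].
have i0 : 0 <= (3 ^+ 12 : R)^-1 by rewrite invr_ge0; exact: exprn_ge0.
by apply: lerXn2r Qlow; rewrite nnegrE ?nm_ge0.
Qed.

End Bound.

(** * Quadratic forms *)

Section Forms.
Implicit Types (a b c p q r s w v al be ga de n : int).

Definition qv (a b c x y : int) : int := a * x ^+ 2 + b * x * y + c * y ^+ 2.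

Lemma qv_gt0 a b c x y : 0 < a -> 0 < 4 * a * c - b ^+ 2 -> (x, y) <> (0, 0) ->
  0 < qv a b c x y.
Proof.
move=> a0 D0 xy; set D := _ - _ in D0.
have e : 4 * a * qv a b c x y = (2 * a * x + b * y) ^+ 2 + D * y ^+ 2.
  by rewrite /qv /D; ring.
have h : 0 < 4 * a * qv a b c x y.
  rewrite e; have [y0|y0] := eqVneq y 0.
    have x0 : x != 0 by apply/eqP => x0; apply: xy; rewrite x0 y0.
    rewrite y0 mulr0 addr0 expr0n mulr0 addr0 exprn_even_gt0//=.
    by rewrite !mulf_neq0// gt_eqF.
  apply: ltr_wpDl; first exact: sqr_ge0.
  by rewrite mulr_gt0// exprn_even_gt0.
by move: h; rewrite pmulr_rgt0// mulr_gt0.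
Qed.

Lemma sl2_reduce a b c : 0 < a -> 0 < 4 * a * c - b ^+ 2 ->
  exists p q r s, [/\ p * s - q * r = 1, 0 < qv a b c p r &
    3 * qv a b c p r ^+ 2 <= 4 * a * c - b ^+ 2].
Proof.
move=> a0 D0; set D := 4 * a * c - b ^+ 2 in D0 *.
have pos x y : (x, y) <> (0, 0) -> 0 < qv a b c x y by apply: qv_gt0.
have nz p q r s : p * s - q * r = 1 -> (p, r) <> (0, 0).
  by move=> e [p0 r0]; move: e; rewrite p0 r0 mul0r mulr0 subrr.
suff H N : forall p q r s, p * s - q * r = 1 -> qv a b c p r <= N%:Z ->
    exists p q r s, [/\ p * s - q * r = 1, 0 < qv a b c p r & 3 * qv a b c p r ^+ 2 <= D].
  by apply: (H (absz (qv a b c 1 0)) 1 0 0 1) => //; lia.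
elim: N => [|N IH] p q r s e hN.
  by have := pos _ _ (nz _ _ _ _ e); lia.
have A0 := pos _ _ (nz _ _ _ _ e); set A := qv a b c p r in hN A0.
set B := 2 * a * p * q + b * (p * s + q * r) + 2 * c * r * s.
set t := ((B + A) %/ (2 * A))%Z.
have tE := divz_eq (B + A) (2 * A); rewrite -/t in tE.
have A2 : 2 * A != 0 by lia.
have m1 := modz_ge0 (B + A) A2; have m2 := @ltz_pmod (B + A) (2 * A) ltac:(lia).
set rho := ((B + A) %% (2 * A))%Z in tE m1 m2.
pose q' := q - t * p; pose s' := s - t * r.
have e' : p * s' - q' * r = 1 by rewrite -e /q' /s'; ring.
set C := qv a b c q' s'.
have DE : D = 4 * A * C - (rho - A) ^+ 2.
  have -> : rho - A = B - t * (2 * A) by lia.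
  have -> : D = D * (p * s - q * r) ^+ 2 by rewrite e expr1n mulr1.
  by rewrite /D /C /A /B /qv /q' /s'; ring.
have [AC|CA] := leP A C.
  exists p, q', r, s'; split=> //; rewrite -/A DE.
  have h1 : (rho - A) ^+ 2 <= A ^+ 2.
    have : 0 <= rho * (2 * A - rho) by apply: mulr_ge0; lia.
    by have -> : (rho - A) ^+ 2 = A ^+ 2 - rho * (2 * A - rho) by [ring]; lia.
  have h2 : A * A <= A * C by apply: ler_wpM2l => //; apply: ltW.
  by rewrite expr2 in h1 *; lia.
have e2 : q' * - r - - p * s' = 1 by rewrite -e'; ring.
apply: (IH q' (- p) s' (- r)) => //; rewrite -/C; lia.
Qed.

Definition iform : Type := int * int * int.

(* The form [6 a, b, c] is encoded by (a, b, c); alf is the action of the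
   Atkin-Lehner matrix (w al, be; w v ga, w de), w v = 6, divided by w. *)
Definition alf w v (X : iform) al be ga de : iform :=
  let: (a, b, c) := X in
  (a * w * al ^+ 2 + b * al * ga + v * c * ga ^+ 2,
   2 * w * v * a * al * be + b * (w * al * de + v * be * ga) + 2 * w * v * c * ga * de,
   a * v * be ^+ 2 + b * be * de + c * w * de ^+ 2).

Definition discf (X : iform) : int := let: (a, b, c) := X in 24 * a * c - b ^+ 2.

Definition al_pair w v := (w, v) \in [:: (1, 6); (2, 3); (3, 2); (6, 1) : int * int].

Lemma al_pairM w v : al_pair w v -> w * v = 6.
Proof. by rewrite /al_pair !inE => /or4P[] /eqP[-> ->]. Qed.

Lemma al_pairP w v : al_pair w v ->
  [\/ w = 1 /\ v = 6, w = 2 /\ v = 3, w = 3 /\ v = 2 | w = 6 /\ v = 1].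
Proof.
rewrite /al_pair !inE => /or4P[] /eqP[-> ->].
- by apply: Or41.
- by apply: Or42.
- by apply: Or43.
- by apply: Or44.
Qed.

Lemma alf_comp w v X al be ga de al' be' ga' de' :
  alf w v (alf w v X al be ga de) de' (- be') (- ga') al' =
  alf 1 (w * v) X (w * al * de' - v * be * ga') (be * al' - al * be')
    (ga * de' - de * ga') (w * de * al' - v * ga * be').
Proof. by case: X => [[a b] c]; rewrite /alf; congr (_, _, _); ring. Qed.

Lemma alf_id v X : alf 1 v X 1 0 0 1 = X.
Proof. by case: X => [[a b] c]; rewrite /alf; congr (_, _, _); ring. Qed.

Lemma alf_adj w v X al be ga de : w * al * de - v * be * ga = 1 ->
  alf w v (alf w v X al be ga de) de (- be) (- ga) al = X.
Proof.
move=> e; rewrite alf_comp e.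
have -> : be * al - al * be = 0 by ring.
have -> : ga * de - de * ga = 0 by ring.
have -> : w * de * al - v * ga * be = 1 by rewrite -e; ring.
exact: alf_id.
Qed.

Lemma discf_alf w v X al be ga de : w * v = 6 ->
  w * al * de - v * be * ga = 1 -> discf (alf w v X al be ga de) = discf X.
Proof.
case: X => [[a b] c] wv e; rewrite /discf /alf.
have h (D : int) : D * (w * al * de - v * be * ga) ^+ 2 = D by rewrite e expr1n mulr1.
apply: etrans (h _).
have key (k : int) : k = 4 * (w * v) ->
    k * (a * w * al ^+ 2 + b * al * ga + v * c * ga ^+ 2) *
      (a * v * be ^+ 2 + b * be * de + c * w * de ^+ 2) -
    (2 * w * v * a * al * be + b * (w * al * de + v * be * ga) + 2 * w * v * c * ga * de) ^+ 2 =
    (k * a * c - b ^+ 2) * (w * al * de - v * be * ga) ^+ 2 by move=> ->; ring.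
by apply: key; rewrite wv.
Qed.

Lemma al_exists p q r s : p * s - q * r = 1 -> exists w v al be ga de,
  [/\ al_pair w v, w * al * de - v * be * ga = 1, al = p & r = v * ga].
Proof.
move=> e.
suff [w [v [ga [k [wv rv kw]]]]] : exists w v ga k,
    [/\ al_pair w v, r = v * ga & 1 - r ^+ 2 = w * k].
  exists w, v, p, (q - p * (r * s)), ga, (s * k); split=> //.
  have -> : w * p * (s * k) = p * s * (w * k) by ring.
  by apply: (etrans _ e); rewrite -kw rv; ring.
have rE := divz_eq r 6; set k := (r %/ 6)%Z in rE.
have m1 : 0 <= (r %% 6)%Z by apply: modz_ge0.
have m2 : (r %% 6)%Z < 6 by apply: ltz_pmod.
have [h|[h|[h|[h|[h|h]]]]] : (r %% 6)%Z = 0 \/ (r %% 6)%Z = 1 \/ (r %% 6)%Z = 2 \/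
  (r %% 6)%Z = 3 \/ (r %% 6)%Z = 4 \/ (r %% 6)%Z = 5 by lia.
- by exists 1, 6, k, (1 - r ^+ 2); split=> //; rewrite ?mul1r// rE h; ring.
- by exists 6, 1, r, (- (6 * k ^+ 2 + 2 * k)); split=> //; rewrite ?mul1r// rE h; ring.
- by exists 3, 2, (3 * k + 1), (- (12 * k ^+ 2 + 8 * k + 1)); split=> //; rewrite rE h; ring.
- by exists 2, 3, (2 * k + 1), (- (18 * k ^+ 2 + 18 * k + 4)); split=> //; rewrite rE h; ring.
- by exists 3, 2, (3 * k + 2), (- (12 * k ^+ 2 + 16 * k + 5)); split=> //; rewrite rE h; ring.
- by exists 6, 1, r, (- (6 * k ^+ 2 + 10 * k + 4)); split=> //; rewrite ?mul1r// rE h; ring.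
Qed.

Lemma alf_reduce X : 0 < X.1.1 -> 0 < discf X ->
  exists w v al be ga de A B C, [/\ al_pair w v, w * al * de - v * be * ga = 1,
    alf w v X al be ga de = (A, B, C), 0 < A /\ 3 * A ^+ 2 <= discf X &
    0 <= B < 12 * A].
Proof.
case: X => [[a b] c]; rewrite /discf [_.1.1]/= => a0 D0.
have a60 : 0 < 6 * a by lia.
have DE : 4 * (6 * a) * c - b ^+ 2 = 24 * a * c - b ^+ 2 by ring.
have D60 : 0 < 4 * (6 * a) * c - b ^+ 2 by rewrite DE.
have [p [q [r [s [e A0 A3]]]]] := sl2_reduce a60 D60.
have [w [v [al [be [ga [de [wv det alp rv]]]]]]] := al_exists e.
have wv6 := al_pairM wv.
set A0' := qv (6 * a) b c p r in A0 A3.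
set A := a * w * al ^+ 2 + b * al * ga + v * c * ga ^+ 2.
have AE : 6 * A = w * A0'.
  by rewrite /A /A0' /qv rv alp -wv6; ring.
set B0 := 2 * w * v * a * al * be + b * (w * al * de + v * be * ga) + 2 * w * v * c * ga * de.
have w06 : 0 < w /\ w <= 6 by case: (al_pairP wv) => -[-> _].
have AA : 0 < A by have : 0 < w * A0' by [apply: mulr_gt0; lia]; lia.
pose k := - (B0 %/ (12 * A))%Z.
have tE := divz_eq B0 (12 * A).
have A12 : 12 * A != 0 by lia.
have m1 := modz_ge0 B0 A12; have m2 := @ltz_pmod B0 (12 * A) ltac:(lia).
have hA : A <= A0' by case: (al_pairP wv) => -[w1 _]; rewrite w1 in AE; lia.
have h12 (x : int) : 12 * x = 2 * (w * v) * x by rewrite wv6.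
exists w, v, al, (be + w * al * k), ga, (de + v * ga * k), A, (B0 %% (12 * A))%Z.
exists (alf w v (a, b, c) al (be + w * al * k) ga (de + v * ga * k)).2.
split=> //.
- by apply: (etrans _ det); ring.
- rewrite /alf; congr (_, _, _).
  have -> : (B0 %% (12 * A))%Z = B0 + 12 * A * k by rewrite /k; lia.
  by rewrite -[12 * A * k]mulrA h12 /B0 /A; ring.
- split=> //; rewrite -DE; apply: le_trans A3.
  by rewrite ler_pM2l// ler_sqr ?nnegrE//; apply: ltW.
- by rewrite m1.
Qed.

End Forms.

Section Classes.
Implicit Types (a b c p q r s w v al be ga de x y : int) (n : nat) (X Y Z : iform).

Definition six X : bqf := let: (a, b, c) := X in (6 * a, b, c).

Lemma six_inj : injective six.
Proof. by move=> [[a b] c] [[a' b'] c'] /= [h -> ->]; congr (_, _, _); lia. Qed.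

Definition good n X := [/\ 0 < X.1.1, discf X = 24 * n%:Z - 1 & (X.1.2 = 1 %[mod 12])%Z].

Lemma QformsP n Q : (1 <= n)%N -> Qforms n Q <-> exists2 X, Q = six X & good n X.
Proof.
move=> n1; split.
  case: Q => [[a b] c] [/= pd D d6 b12]; have /dvdzP[k ak] := d6.
  have a0 : 0 < a by have := pd 1 0 ltac:(done); rewrite /= expr1n expr0n /=; lia.
  exists (k, b, c); first by rewrite ak mulrC.
  split=> //=; first by lia.
  rewrite /discf; have := D; rewrite ak.
  have -> : 4 * (k * 6) * c = 24 * k * c by ring.
  by lia.
case=> [[[a b] c]] -> [/= a0 D b12]; split=> //=.
- move=> x y xy; apply: qv_gt0 => //; first by lia.
  by have -> : 4 * (6 * a) * c = 24 * a * c by [ring]; lia.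
- by have -> : 4 * (6 * a) * c = 24 * a * c by [ring]; lia.
- exact: dvdz_mulr.
Qed.

Lemma det_mx22 (s : 'M[int]_2) : \det s = s 0 0 * s 1 1 - s 0 1 * s 1 0.
Proof.
rewrite (expand_det_row _ 0) !big_ord_recl big_ord0 addr0 /cofactor !det_mx11 !mxE /=.
rewrite (_ : lift ord0 ord0 = 1); last exact/val_inj.
by rewrite (_ : lift 1 0 = 0); [rewrite /=; ring|exact/val_inj].
Qed.

Definition eqv X Y := exists al be ga de, 1 * al * de - 6 * be * ga = 1 /\
  Y = alf 1 6 X al be ga de.

Definition mx2 (a b c d : int) : 'M[int]_2 :=
  \matrix_(i, j) if i == 0 then (if j == 0 then a else b) else (if j == 0 then c else d).

Lemma Gamma0_6_classP X Q : Gamma0_6_class (six X) Q <-> exists2 Y, Q = six Y & eqv X Y.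
Proof.
case: X => [[a b] c]; split.
  case=> s [sdet /dvdzP[k sk]] <-.
  exists (alf 1 6 (a, b, c) (s 0 0) (s 0 1) k (s 1 1)).
    by rewrite /= sk; congr (_, _, _); ring.
  exists (s 0 0), (s 0 1), k, (s 1 1); split=> //.
  by apply: (etrans _ sdet); rewrite det_mx22 sk; ring.
case=> _ -> [al [be [ga [de [det ->]]]]].
exists (mx2 al be (6 * ga) de).
  split; last by rewrite mxE /= dvdz_mulr.
  by rewrite det_mx22 !mxE /=; apply: (etrans _ det); ring.
by rewrite /= !mxE /=; congr (_, _, _); ring.
Qed.

Lemma eqv_refl X : eqv X X.
Proof. by exists 1, 0, 0, 1; split=> //; rewrite alf_id. Qed.

Lemma eqv_sym X Y : eqv X Y -> eqv Y X.
Proof.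
case=> al [be [ga [de [det ->]]]]; exists de, (- be), (- ga), al.
by rewrite alf_adj//; split=> //; apply: (etrans _ det); ring.
Qed.

Lemma alf_eqv w v X Y al be ga de al' be' ga' de' : w * v = 6 ->
  w * al * de - v * be * ga = 1 -> w * al' * de' - v * be' * ga' = 1 ->
  alf w v X al be ga de = alf w v Y al' be' ga' de' -> eqv X Y.
Proof.
move=> wv d d' e; rewrite -(alf_adj Y d') -e alf_comp wv.
do 4 eexists; split; last by reflexivity.
rewrite -wv; have : (w * al * de - v * be * ga) * (w * al' * de' - v * be' * ga') = 1.
  by rewrite d d' mulr1.
by apply: etrans; ring.
Qed.

Lemma eqv_trans X Y Z : eqv X Y -> eqv Y Z -> eqv X Z.
Proof.
case=> al [be [ga [de [d ->]]]] /eqv_sym[al' [be' [ga' [de' [d' e]]]]].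
exact: (@alf_eqv 1 6 X Z _ _ _ _ _ _ _ _ _ d d' e).
Qed.

Lemma Gamma0_6_class_eq X Y : Gamma0_6_class (six X) = Gamma0_6_class (six Y) <-> eqv X Y.
Proof.
split=> [e|e].
  have : Gamma0_6_class (six Y) (six Y).
    by apply/Gamma0_6_classP; exists Y => //; apply: eqv_refl.
  by rewrite -e => /Gamma0_6_classP[Z /six_inj ->].
apply/seteqP; split=> Q /Gamma0_6_classP[Z -> h]; apply/Gamma0_6_classP; exists Z => //.
  exact: eqv_trans (eqv_sym e) h.
exact: eqv_trans e h.
Qed.

Definition mid w : int := if w == 1 then 1 else if w == 2 then 7 else if w == 3 then 5 else 11.

Lemma alf_mid w v X al be ga de : al_pair w v -> w * al * de - v * be * ga = 1 ->
  (X.1.2 = 1 %[mod 12])%Z -> ((alf w v X al be ga de).1.2 = mid w %[mod 12])%Z.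
Proof.
case: X => [[a b] c] wv d /= b12; set B := (X in (X %% 12)%Z).
have [k bk] : exists k, b = 12 * k + 1 by exists (b %/ 12)%Z; lia.
have -> : B = 12 * (a * al * be + c * ga * de + k * (1 + 2 * v * (be * ga))) + (1 + 2 * v * (be * ga)).
  have h x : 2 * w * v * x = 12 * x by rewrite -[2 * w * v]mulrA (al_pairM wv).
  have -> : B = 2 * w * v * (a * al * be + c * ga * de) + b * (1 + 2 * v * (be * ga)).
    have -> : 1 + 2 * v * (be * ga) = w * al * de + v * be * ga by lia.
    by rewrite /B; ring.
  by rewrite h bk; ring.
have {}d : w * (al * de) - v * (be * ga) = 1 by apply: (etrans _ d); ring.
move: d; move: (al * de) (be * ga) (_ + _ + _) => P G T.
by case: (al_pairP wv) => -[-> ->]; rewrite /mid /=; lia.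
Qed.

(* Xmain n w has an Atkin-Lehner image [6, mid w, c]: its Heegner point is moved
   to the largest possible height. *)
Definition Xmain n w : iform :=
  if w == 1 then (1, 1, n%:Z) else if w == 2 then (3 * n%:Z, 1 - 12 * n%:Z, 2 * n%:Z)
  else if w == 3 then (2 * n%:Z, 1 - 12 * n%:Z, 3 * n%:Z) else (n%:Z, 1, 1).

Lemma Xmain_good n w v : (1 <= n)%N -> al_pair w v -> good n (Xmain n w).
Proof.
move=> n1 wv.
by case: (al_pairP wv) => -[-> _]; rewrite /Xmain /=; split=> //=; rewrite /discf; try lia; ring.
Qed.

Lemma Xmain_alf n w v : al_pair w v -> exists al be ga de c,
  w * al * de - v * be * ga = 1 /\ alf w v (Xmain n w) al be ga de = (1, mid w, c).
Proof.
move=> wv; case: (al_pairP wv) => -[-> ->].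
- by exists 1, 0, 0, 1, n%:Z; split=> //; rewrite /Xmain /mid /=; congr (_, _, _); ring.
- by exists (-1), (-1), (-1), (-2), (n%:Z + 2); split=> //; rewrite /Xmain /mid /=; congr (_, _, _); ring.
- by exists 1, 1, 1, 1, (n%:Z + 1); split=> //; rewrite /Xmain /mid /=; congr (_, _, _); ring.
- by exists 0, (-1), 1, 1, (n%:Z + 5); split=> //; rewrite /Xmain /mid /=; congr (_, _, _); ring.
Qed.

Lemma discf_inj a b c c' : 0 < a -> discf (a, b, c) = discf (a, b, c') -> c = c'.
Proof.
rewrite /discf => a0 h; have a24 : 24 * a != 0 by lia.
by apply: (mulfI a24); lia.
Qed.

Lemma eqv_lead w v X Y al ga : w * v = 6 -> eqv X Y ->
  Y.1.1 * w * al ^+ 2 + Y.1.2 * al * ga + v * Y.2 * ga ^+ 2 = 1 ->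
  exists x y, X.1.1 * w * x ^+ 2 + X.1.2 * x * y + v * X.2 * y ^+ 2 = 1.
Proof.
case: X => [[a b] c] wv [p [q [r [s [_ ->]]]]] /= h.
exists (p * al + v * q * ga), (w * r * al + s * ga).
apply: (etrans _ h); move: (h) => _.
rewrite -wv; ring.
Qed.

Lemma small_sqr (D y k : int) : 0 <= k -> k < D -> D * y ^+ 2 <= k -> y = 0.
Proof.
move=> k0 kD h; apply/eqP; apply: contraT => y0.
have : 0 < y ^+ 2 by rewrite exprn_even_gt0.
move=> h0; have : D * 1 <= D * y ^+ 2 by apply: ler_wpM2l; lia.
lia.
Qed.

Lemma int_sqr_ne (k x y : int) : 1 < k -> k * x ^+ 2 = 1 -> False.
Proof.
move=> k1 e; have : (k %| 1)%Z by apply/dvdzP; exists (x ^+ 2); rewrite mulrC e.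
by rewrite dvdz1; lia.
Qed.

Lemma Xmain_distinct n w v w' v' : (2 <= n)%N -> al_pair w v -> al_pair w' v' ->
  eqv (Xmain n w) (Xmain n w') -> w = w'.
Proof.
move=> n2.
have rep u t X : al_pair u t -> eqv X (Xmain n u) ->
    exists x y, X.1.1 * u * x ^+ 2 + X.1.2 * x * y + t * X.2 * y ^+ 2 = 1.
  move=> ut e; have [al [be [ga [de [c [_ h]]]]]] := Xmain_alf n ut.
  apply: (@eqv_lead _ _ _ _ al ga (al_pairM ut) e).
  by have := congr1 (fun Z => Z.1.1) h; case: (Xmain n u) => [[a b] c'].
have s1 u t : al_pair u t -> u != 1 -> ~ eqv (Xmain n 1) (Xmain n u).
  move=> ut u1 /(rep _ _ _ ut)[x [y]]; rewrite /Xmain /= => h.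
  have h2 : (24 * n%:Z - 1) * y ^+ 2 = 4 * u - (2 * u * x + y) ^+ 2.
    have h24 (m : int) : 24 * m = 4 * (u * t) * m by rewrite (al_pairM ut).
    have := congr1 (fun m => 4 * u * m) h; rewrite mulr1 => <-.
    by rewrite mulrBl h24; ring.
  have u6 : 0 < u <= 6 by case: (al_pairP ut) => -[-> _].
  have y0 : y = 0.
    by apply: (@small_sqr (24 * n%:Z - 1) y 24) => //; [lia|rewrite h2; have := sqr_ge0 (2 * u * x + y); lia].
  by apply: (@int_sqr_ne u x y); [lia|rewrite -[RHS]h y0; ring].
have s6 u t : al_pair u t -> u != 6 -> ~ eqv (Xmain n 6) (Xmain n u).
  move=> ut u1 /(rep _ _ _ ut)[x [y]]; rewrite /Xmain /= => h.
  have h2 : (24 * n%:Z - 1) * x ^+ 2 = 4 * t - (2 * t * y + x) ^+ 2.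
    have h24 (m : int) : 24 * m = 4 * (u * t) * m by rewrite (al_pairM ut).
    have := congr1 (fun m => 4 * t * m) h; rewrite [4 * t * 1]mulr1 => <-.
    by rewrite mulrBl h24; ring.
  have u6 : 1 < t <= 6 by move: u1; case: (al_pairP ut) => -[-> ->].
  have y0 : x = 0.
    by apply: (@small_sqr (24 * n%:Z - 1) x 24) => //; [lia|rewrite h2; have := sqr_ge0 (2 * t * y + x); lia].
  by apply: (@int_sqr_ne t y x); [lia|rewrite -[RHS]h y0; ring].
have s3 : ~ eqv (Xmain n 3) (Xmain n 2).
  move=> /(rep 2 3 _ isT)[x [y]]; rewrite /Xmain /= => h.
  have h2 : (24 * n%:Z - 1) * (2 * x - 3 * y) ^+ 2 = 24 - (2 * x + 3 * y) ^+ 2.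
    have := congr1 (fun m => 24 * m) h; rewrite [24 * 1]mulr1 => {2}<-; ring.
  have y0 : 2 * x - 3 * y = 0.
    by apply: (@small_sqr (24 * n%:Z - 1) _ 24) => //; [lia|rewrite h2; have := sqr_ge0 (2 * x + 3 * y); lia].
  have [k yk] : exists k, y = 2 * k by exists (y %/ 2)%Z; lia.
  have xk : x = 3 * k by lia.
  by apply: (@int_sqr_ne 6 k y); [lia|rewrite -[RHS]h yk xk; ring].
move=> wv wv' e; have e' := eqv_sym e; move: e e' (wv) (wv').
case: (al_pairP wv) => -[-> ->]; case: (al_pairP wv') => -[-> ->] // e e' h h'; exfalso.
all: first [exact: (s1 _ _ h' isT e) | exact: (s1 _ _ h isT e')
  | exact: (s6 _ _ h' isT e) | exact: (s6 _ _ h isT e') | exact: s3].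
Qed.

(* Every class is represented, through an Atkin-Lehner matrix of determinant
   w, by a reduced form [6 A, B, C]; the triple (w, A, B) determines it. *)
Definition reduced_by n w X Y := exists v al be ga de, [/\ al_pair w v,
  w * al * de - v * be * ga = 1, alf w v X al be ga de = Y, good n X &
  [/\ 0 < Y.1.1, 3 * Y.1.1 ^+ 2 <= 24 * n%:Z - 1 & 0 <= Y.1.2 < 12 * Y.1.1]].

Lemma reduced_ex n X : (1 <= n)%N -> good n X -> exists w Y, reduced_by n w X Y.
Proof.
move=> n1 g; have [X0 XD Xm] := g.
have D0 : 0 < discf X by rewrite XD; lia.
have [w [v [al [be [ga [de [A [B [C [wv d e [A0 A3] B0]]]]]]]]]] := alf_reduce X0 D0.
exists w, (A, B, C), v, al, be, ga, de; split=> //; split=> //=.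
by rewrite -XD.
Qed.

Lemma reduced_disc n w X Y : reduced_by n w X Y -> discf Y = 24 * n%:Z - 1.
Proof.
by case=> v [al [be [ga [de [wv d <- [_ <- _] _]]]]]; rewrite discf_alf ?(al_pairM wv).
Qed.

Lemma reduced_inj n w X Y X' Y' : reduced_by n w X Y -> reduced_by n w X' Y' ->
  Y.1 = Y'.1 -> eqv X X'.
Proof.
move=> h h' e; have : Y = Y'.
  have := reduced_disc h; have := reduced_disc h'.
  case: h => v [al [be [ga [de [_ _ _ _ [Y0 _ _]]]]]].
  case: Y Y' e Y0 {h'} => [[a b] c] [[a' b'] c'] /= [<- <-] a0 <- e.
  by rewrite (discf_inj a0 e).
case: h => v [al [be [ga [de [wv d <- _ _]]]]].
case: h' => v' [al' [be' [ga' [de' [wv' d' <- _ _]]]]].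
have w0 : w != 0 by case: (al_pairP wv) => -[-> _].
have -> : v' = v by apply: (mulfI w0); rewrite !al_pairM.
apply: alf_eqv => //; first exact: al_pairM.
have <- : v' = v by apply: (mulfI w0); rewrite !al_pairM.
exact: d'.
Qed.

Lemma reduced_main n w X Y : (1 <= n)%N -> reduced_by n w X Y -> Y.1.1 = 1 ->
  eqv X (Xmain n w) /\ Y.1.2 = mid w.
Proof.
move=> n1 h Y1.
have [v [al [be [ga [de [wv d e [_ XD Xm] [_ _ B0]]]]]]] := h.
have := alf_mid wv d Xm; rewrite e Y1 mulr1 in B0 * => Bm.
have YB : Y.1.2 = mid w.
  have mw : 0 <= mid w < 12 by case: (al_pairP wv) => -[-> _].
  by move: Bm; rewrite !modz_small.
split=> //.
have [al' [be' [ga' [de' [c' [d' e']]]]]] := Xmain_alf n wv.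
apply: (reduced_inj (Y' := (1, mid w, c')) h) => /=; last first.
  by move: Y1 YB; case: Y.1 => ? ? /= -> ->.
exists v, al', be', ga', de'; split=> //; first exact: Xmain_good wv.
by split=> //=; [lia|case: (al_pairP wv) => -[-> _]].
Qed.

End Classes.

(** * Traces of Heegner points *)

Section HeegnerPoints.
Context {R : realType}.
Implicit Types (z t u v : R[i]) (a b c w al be ga de : int) (n : nat) (X Y : iform).

Lemma rc_int (k : int) : (k%:~R : R)%:C = k%:~R :> R[i].
Proof. by rewrite rmorph_int. Qed.

Lemma intrC_neq0 a : 0 < a -> a%:~R != 0 :> R[i].
Proof. by move=> a0; rewrite intr_eq0 gt_eqF. Qed.

Lemma heegner_parts a b c : 0 < a ->
  rp (heegner R (a, b, c)) = - b%:~R / (2 * a%:~R) /\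
  ip (heegner R (a, b, c)) = Num.sqrt ((4 * a * c - b ^+ 2)%:~R) / (2 * a%:~R).
Proof.
move=> a0; have ha : a%:~R != 0 :> R by rewrite intr_eq0 gt_eqF.
have -> : heegner R (a, b, c) = (- b%:~R / (2 * a%:~R)) +i*
    (Num.sqrt ((4 * a * c - b ^+ 2)%:~R) / (2 * a%:~R)); last by [].
rewrite /heegner /= -[- (_ - _)%:~R]mulrNz opprB; set s := Num.sqrt _.
have h : 2 * a%:~R != 0 :> R[i] by rewrite mulf_neq0// ?pnatr_eq0// intrC_neq0.
apply: (mulIf h); rewrite divfK//; apply: complex_eqP;
  rewrite -!rc_int -real_complex_nat !(rpM, ipM, rpD, ipD, rpN, ipN) /=; by field.
Qed.

Lemma heegner_root a b c t : 0 < a -> 0 < 4 * a * c - b ^+ 2 -> 0 < ip t ->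
  a%:~R * t ^+ 2 + b%:~R * t + c%:~R = 0 -> t = heegner R (a, b, c).
Proof.
move=> a0 D0 t0 e; have ha := intrC_neq0 a0.
rewrite /heegner /= -[- (_ - _)%:~R]mulrNz opprB; set s := Num.sqrt _.
have s2 : s%:C ^+ 2 = (4 * a * c - b ^+ 2)%:~R.
  by rewrite -rmorphXn /= sqr_sqrtr ?rc_int// ler0z (ltW D0).
have : (2 * a%:~R * t + b%:~R - 'i%C * s%:C) * (2 * a%:~R * t + b%:~R + 'i%C * s%:C) = 0.
  have -> : (2 * a%:~R * t + b%:~R - 'i%C * s%:C) * (2 * a%:~R * t + b%:~R + 'i%C * s%:C) =
    4 * a%:~R * (a%:~R * t ^+ 2 + b%:~R * t + c%:~R) - (4 * a%:~R * c%:~R - b%:~R ^+ 2)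
     - ('i%C * 'i%C) * s%:C ^+ 2 by ring.
  rewrite e i2 s2 rmorphB rmorphXn !rmorphM /= -[4%:~R]/(4%:R : R[i]); ring.
move=> /eqP; rewrite mulf_eq0 => /orP[]/eqP h.
  apply: (mulfI (mulf_neq0 (_ : 2 != 0) ha)); first by rewrite pnatr_eq0.
  rewrite [RHS]mulrC divfK ?mulf_neq0 ?pnatr_eq0//.
  by apply/eqP; rewrite -subr_eq0; apply/eqP; rewrite -h; ring.
exfalso; have := congr1 ip h; rewrite -!rc_int -real_complex_nat !(rpM, ipM, rpD, ipD, rpN, ipN) /=.
have a1 : (0 : R) < a%:~R by rewrite ltr0z.
have : 0 <= s := sqrtr_ge0 _.
have := mulr_gt0 a1 t0; rewrite !(mul0r, mulr0, add0r, addr0, subr0, mul1r).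
move: (ip t) (a%:~R : R) (s : R) => x y z; clear; rewrite -mulrA; move: (y * x) => m; lra.
Qed.

Lemma heegner_eq0 a b c : 0 < a -> 0 < 4 * a * c - b ^+ 2 ->
  a%:~R * heegner R (a, b, c) ^+ 2 + b%:~R * heegner R (a, b, c) + c%:~R = 0.
Proof.
move=> a0 D0; have ha := intrC_neq0 a0.
rewrite /heegner /= -[- (_ - _)%:~R]mulrNz opprB; set s := Num.sqrt _.
have s2 : s%:C ^+ 2 = (4 * a * c - b ^+ 2)%:~R.
  by rewrite -rmorphXn /= sqr_sqrtr ?rc_int// ler0z (ltW D0).
move: s2; rewrite rmorphB rmorphXn !rmorphM /= -[4%:~R]/(4%:R : R[i]) => s2.
have -> : a%:~R * ((- b%:~R + 'i%C * s%:C) / (2 * a%:~R)) ^+ 2 +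
    b%:~R * ((- b%:~R + 'i%C * s%:C) / (2 * a%:~R)) + c%:~R =
    (('i%C * 'i%C) * s%:C ^+ 2 + (4 * a%:~R * c%:~R - b%:~R ^+ 2)) / (4 * a%:~R) by field.
by rewrite i2 s2 mulN1r addNr mul0r.
Qed.

Lemma ip_div u v : ip (u / v) * nm v ^+ 2 = ip u * rp v - rp u * ip v.
Proof.
have [->|v0] := eqVneq v 0; first by rewrite nm0 expr0n !mulr0 subrr.
have {2 3}-> : u = u / v * v by rewrite divfK.
by rewrite nm_sqr; move: (u / v) => t; rewrite rpM ipM; ring.
Qed.

Lemma alf_quadratic (s a b c w v al be ga de t : R[i]) : s = w * v ->
  s * a * (w * al * t + be) ^+ 2 + b * (w * al * t + be) * (s * ga * t + w * de) +
    c * (s * ga * t + w * de) ^+ 2 =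
  w * (s * (a * w * al ^+ 2 + b * al * ga + v * c * ga ^+ 2) * t ^+ 2 +
   (2 * w * v * a * al * be + b * (w * al * de + v * be * ga) + 2 * w * v * c * ga * de) * t +
   (a * v * be ^+ 2 + b * be * de + c * w * de ^+ 2)).
Proof. by move=> ->; ring. Qed.

Lemma discf_disc a b c : 4 * (6 * a) * c - b ^+ 2 = discf (a, b, c).
Proof. by rewrite /discf; ring. Qed.

Lemma ip_heegner_gt0 Y : 0 < Y.1.1 -> 0 < discf Y -> 0 < ip (heegner R (six Y)).
Proof.
case: Y => [[a b] c] a0 D0; have a60 : 0 < 6 * a by rewrite mulr_gt0.
rewrite /six (heegner_parts b c a60).2 discf_disc.
by rewrite divr_gt0 ?sqrtr_gt0 ?ltr0z// mulr_gt0 ?ltr0z.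
Qed.

Lemma ALpt_heegner w (v : int) X al be ga de : al_pair w v ->
  w * al * de - v * be * ga = 1 -> 0 < X.1.1 -> 0 < discf X ->
  0 < (alf w v X al be ga de).1.1 ->
  ALpt w al be ga de (heegner R (six (alf w v X al be ga de))) = heegner R (six X).
Proof.
move=> wv d X0 D0 Y0; set Y := alf _ _ _ _ _ _ _ in Y0 *.
have DY : discf Y = discf X by rewrite discf_alf// (al_pairM wv).
have DY0 : 0 < discf Y by rewrite DY.
have t0 := ip_heegner_gt0 Y0 DY0; set t := heegner _ _ in t0 *.
have den0 : 6 * ga%:~R * t + w%:~R * de%:~R != 0 :> R[i].
  by apply: (@AL_den_neq0 R w v al be) => //; [exact: al_pairM|rewrite -d; ring].
have w0 : 0 < w by case: (al_pairP wv) => -[-> _].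
have six' : 6 = w%:~R * v%:~R :> R[i].
  by rewrite -intrM (al_pairM wv).
have te : 6 * Y.1.1%:~R * t ^+ 2 + Y.1.2%:~R * t + Y.2%:~R = 0.
  move: Y0 DY0; rewrite /t; case: (Y) => [[A B] C] A0; rewrite -discf_disc => D1.
  have A6 : 0 < 6 * A by rewrite mulr_gt0.
  by rewrite -(heegner_eq0 A6 D1) intrM.
have ipt : 0 < ip (ALpt w al be ga de t).
  have h := ip_div (w%:~R * al%:~R * t + be%:~R) (6 * ga%:~R * t + w%:~R * de%:~R).
  have n0 : 0 < nm (6 * ga%:~R * t + w%:~R * de%:~R) ^+ 2 by rewrite exprn_gt0// nm_gt0.
  rewrite -(pmulr_lgt0 _ n0) /ALpt h.
  have : 0 < (w * (w * al * de - v * be * ga))%:~R * ip t :> R.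
    by rewrite d mulr1 mulr_gt0// ltr0z.
  move: (t) => z; rewrite six' -!rc_int !(rpM, ipM, rpD, ipD) /= !(mul0r, mulr0, add0r, addr0, subr0).
  rewrite !(rmorphM, rmorphB) /=; congr (0 < _); ring.
move: X0 D0 ipt te den0; rewrite /Y; case: (X) => [[a b] c] a0; rewrite -discf_disc => D0 ipt te den0.
apply: heegner_root => //; first by rewrite mulr_gt0.
have te' : 6 * (a%:~R * w%:~R * al%:~R ^+ 2 + b%:~R * al%:~R * ga%:~R +
     v%:~R * c%:~R * ga%:~R ^+ 2) * t ^+ 2 +
   (2 * w%:~R * v%:~R * a%:~R * al%:~R * be%:~R +
     b%:~R * (w%:~R * al%:~R * de%:~R + v%:~R * be%:~R * ga%:~R) +
     2 * w%:~R * v%:~R * c%:~R * ga%:~R * de%:~R) * t +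
   (a%:~R * v%:~R * be%:~R ^+ 2 + b%:~R * be%:~R * de%:~R + c%:~R * w%:~R * de%:~R ^+ 2) = 0 :> R[i].
  by apply: (etrans _ te); rewrite /= !(rmorphD, rmorphM, rmorphXn) /=; ring.
have := alf_quadratic a%:~R b%:~R c%:~R al%:~R be%:~R ga%:~R de%:~R t six'.
rewrite te' mulr0 /ALpt intrM -[6%:~R]/(6%:R : R[i]).
move: den0; move: (6 * ga%:~R * t + _) (_ * t + _) => den num den0 h.
have -> : 6 * a%:~R * (num / den) ^+ 2 + b%:~R * (num / den) + c%:~R =
  (6 * a%:~R * num ^+ 2 + b%:~R * num * den + c%:~R * den ^+ 2) / den ^+ 2 by field.
by rewrite h mul0r.
Qed.

Definition al_sign w : R[i] := if (w == 2) || (w == 3) then -1 else 1.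

Lemma nm_al_sign w : nm (al_sign w) = 1.
Proof. by rewrite /al_sign; case: ifP; rewrite ?nmN nm1. Qed.

Definition fX X : R[i] := f (heegner R (six X)).

Lemma fX_alf w (v : int) X al be ga de : al_pair w v ->
  w * al * de - v * be * ga = 1 -> 0 < X.1.1 -> 0 < discf X ->
  0 < (alf w v X al be ga de).1.1 -> fX X = al_sign w * fX (alf w v X al be ga de).
Proof.
move=> wv d X0 D0 Y0; rewrite /fX -(ALpt_heegner wv d X0 D0 Y0).
have z0 : 0 < ip (heegner R (six (alf w v X al be ga de))).
  by apply: ip_heegner_gt0; rewrite // discf_alf// (al_pairM wv).
move: z0; move: (heegner _ _) => z z0; move: d; rewrite /al_sign.
by case: (al_pairP wv) => -[-> ->] d; rewrite /= ?mul1r ?mulN1r;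
 [apply: f_AL1|apply: f_AL2|apply: f_AL3|apply: f_AL6] => //; apply: (etrans _ d); ring.
Qed.

Lemma fX_eqv X Y : 0 < X.1.1 -> 0 < Y.1.1 -> 0 < discf X -> eqv X Y -> fX X = fX Y.
Proof.
move=> X0 Y0 D0 [al [be [ga [de [d e]]]]]; rewrite e in Y0 *.
by rewrite (@fX_alf 1 6 X _ _ _ _ isT d X0 D0 Y0) /al_sign /= mul1r.
Qed.

End HeegnerPoints.

Section Assembly.
Context {R : realType}.
Implicit Types (z t u : R[i]) (a b c w v al be ga de : int) (n : nat) (X Y : iform) (C : set bqf).

Lemma zeta12_cos : zeta12 = cos (pi / 6) +i* sin (pi / 6) :> R[i].
Proof.
rewrite /zeta12; have -> : pi%:C * 'i%C / 6 = (pi / 6)%:C * 'i%C :> R[i].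
  by rewrite rmorphM fmorphV rmorph_nat; field.
by rewrite cexpE rpM ipM /= !(mul0r, mulr0, mulr1, add0r, subrr, addr0, oppr0) expR0 mul1r.
Qed.

(* With c = zeta + 1/zeta = 2 cos(pi/6), zeta^3 = i gives c^3 = 3 c. *)
Lemma zeta12_trace : zeta12 - zeta12 ^+ 7 - zeta12 ^+ 5 + zeta12 ^+ 11 = (2 * Num.sqrt 3)%:C :> R[i].
Proof.
set k := cos (pi / 6 : R).
have pi0 := pi_gt0 R.
have k0 : 0 < k by apply: cos_gt0_pihalf; apply/andP; split; lra.
have z3 := @zeta12_3 R; have z12 := @zeta12_12 R; set x := zeta12 in z3 z12 *.
have i21 := @i2 R.
have x6 : x ^+ 6 = -1 by rewrite (exprM _ 3 2) z3 expr2.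
have x11 : x ^+ 11 = k -i* sin (pi / 6).
  have x0 : x != 0 by apply: cexp_neq0.
  apply: (mulfI x0); rewrite -exprS z12 /x zeta12_cos; apply: complex_eqP => /=.
    by rewrite mulrN opprK -!expr2 cos2Dsin2.
  by rewrite mulrN mulrC addNr.
have xk : x + x ^+ 11 = (2 * k)%:C.
  by rewrite x11 /x zeta12_cos -/k; apply: complex_eqP => /=; ring.
have -> : x - x ^+ 7 - x ^+ 5 + x ^+ 11 = 2 * (x + x ^+ 11).
  have -> : x ^+ 7 = - x by rewrite exprS x6 mulrN1.
  have -> : x ^+ 11 = - x ^+ 5 by rewrite (exprD _ 6 5) x6 mulN1r.
  by ring.
rewrite xk -real_complex_nat -rmorphM /=; congr (_%:C).
have k2 : (2 * k) ^+ 2 = 3.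
  have h : (2 * k)%:C ^+ 3 = 3 * (2 * k)%:C.
    rewrite -xk; have -> : (x + x ^+ 11) ^+ 3 = x ^+ 3 + 3 * x * (x ^+ 12) + 3 * (x ^+ 11) * x ^+ 12
       + (x ^+ 12) ^+ 2 * x ^+ 6 * x ^+ 3 by ring.
    by rewrite z12 x6; ring.
  have kk : (2 * k)%:C != 0 by rewrite -nm_eq0 nmC normr_eq0 gt_eqF// mulr_gt0.
  have : (2 * k)%:C ^+ 2 = 3%:R%:C.
    by apply: (mulIf kk); rewrite -exprSr h real_complex_nat.
  by rewrite -rmorphXn => /(congr1 rp).
by rewrite -k2 sqrtr_sqr ger0_norm// mulr_ge0// ltW.
Qed.

Lemma disc_ge1 n : (1 <= n)%N -> 23 <= 24 * n%:R - 1 :> R.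
Proof. by rewrite -(ler1n R); lra. Qed.

Lemma discC n Y : discf Y = 24 * n%:Z - 1 -> (discf Y)%:~R = 24 * n%:R - 1 :> R.
Proof. by move=> ->; rewrite rmorphB rmorphM. Qed.

Lemma ip_heegner_reduced n Y : (1 <= n)%N -> 0 < Y.1.1 -> discf Y = 24 * n%:Z - 1 ->
  ip (heegner R (six Y)) = Num.sqrt (24 * n%:R - 1) / (12 * Y.1.1%:~R).
Proof.
case: Y => [[a b] c] n1 a0 D.
have a60 : 0 < 6 * a by rewrite mulr_gt0.
rewrite /six (heegner_parts b c a60).2 discf_disc (discC D) rmorphM /=.
have ha : (0 : R) < a%:~R by rewrite ltr0z.
have -> : (6 : int)%:~R = 6 :> R by [].
have ha0 := lt0r_neq0 ha; by field.
Qed.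

Lemma heegner_reduced_high n Y : (1 <= n)%N -> 0 < Y.1.1 -> discf Y = 24 * n%:Z - 1 ->
  3 * Y.1.1 ^+ 2 <= 24 * n%:Z - 1 -> Num.sqrt 3 / 12 <= ip (heegner R (six Y)).
Proof.
move=> n1 Y0 D Y3; rewrite (ip_heegner_reduced n1 Y0 D).
have ha : (0 : R) < Y.1.1%:~R by rewrite ltr0z.
have D23 := disc_ge1 n1; have D0 : 0 <= 24 * n%:R - 1 :> R by lra.
have h : Num.sqrt 3 * Y.1.1%:~R <= Num.sqrt (24 * n%:R - 1) :> R.
  rewrite -(@ler_pXn2r _ 2)// ?nnegrE ?mulr_ge0 ?sqrtr_ge0 ?(ltW ha)//.
  rewrite exprMn !sqr_sqrtr//.
  move: Y3; rewrite -(ler_int R) rmorphM rmorphXn /= -D (discC D).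
  by have -> : (3 : int)%:~R = 3 :> R by [].
have -> : Num.sqrt (24 * n%:R - 1) / (12 * Y.1.1%:~R) = Num.sqrt (24 * n%:R - 1) / Y.1.1%:~R / 12 :> R.
  have ha0 := lt0r_neq0 ha; by field.
by rewrite ler_pM2r ?invr_gt0 ?ltr0n// ler_pdivlMr.
Qed.

Lemma nm_fX_le n Y : (1 <= n)%N -> 0 < Y.1.1 -> discf Y = 24 * n%:Z - 1 ->
  3 * Y.1.1 ^+ 2 <= 24 * n%:Z - 1 ->
  nm (fX Y : R[i]) <= 2 * 10 ^+ 21 + expR (lambda R n / Y.1.1%:~R).
Proof.
move=> n1 Y0 D Y3; have := f_near_pole (heegner_reduced_high n1 Y0 D Y3).
have := nm_subB (f (heegner R (six Y))) (ee (- heegner R (six Y))).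
have -> : nm (ee (- heegner R (six Y))) = expR (lambda R n / Y.1.1%:~R).
  rewrite nm_ee ipN (ip_heegner_reduced n1 Y0 D) /lambda; congr expR.
  have ha : (0 : R) < Y.1.1%:~R by rewrite ltr0z.
  have ha0 := lt0r_neq0 ha; by field.
rewrite -/(fX Y) lerBlDr => h1 h2; apply: le_trans h1 _.
by rewrite lerD2r.
Qed.

Lemma ee_heegner_lead1 n (m : nat) c : (1 <= n)%N -> discf (1, m%:Z, c) = 24 * n%:Z - 1 ->
  ee (- heegner R (six (1, m%:Z, c))) = (expR (lambda R n))%:C * zeta12 ^+ m.
Proof.
move=> n1 D; set t := heegner _ _.
have ipt : ip t = Num.sqrt (24 * n%:R - 1) / 12.
  by rewrite /t (ip_heegner_reduced n1 _ D)//= mulr1.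
have rpt : rp t = - m%:R / 12.
  rewrite /t /six (heegner_parts _ _ (_ : 0 < 6 * 1)).1//.
  by have -> : (6 * 1 : int)%:~R = 6 :> R by []; field.
have te : t = rp t +i* ip t by case: (t).
rewrite /ee /zeta12 -cexpMn.
have -> : 2 * pi%:C * 'i%C * - t = (lambda R n)%:C + m%:R * (pi%:C * 'i%C / 6).
  rewrite te rpt ipt /lambda; apply: complex_eqP;
  by rewrite -!real_complex_nat -fmorphV !(rpM, ipM, rpD, ipD, rpN, ipN) /=; field.
by rewrite cexpD; congr (_ * _); rewrite cexpE /= cos0 sin0 mulr1.
Qed.

Definition main_term n w : R[i] := al_sign w * ((expR (lambda R n))%:C * zeta12 ^+ absz (mid w)).

Lemma fX_main n w v : (1 <= n)%N -> al_pair w v ->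
  nm (fX (Xmain n w) - main_term n w) <= 2 * 10 ^+ 21.
Proof.
move=> n1 wv; have [X0 XD _] := Xmain_good n1 wv.
have [al [be [ga [de [c [d e]]]]]] := Xmain_alf n wv.
have D0 : 0 < discf (Xmain n w) by rewrite XD; lia.
have Y0 : 0 < (alf w v (Xmain n w) al be ga de).1.1 by rewrite e.
rewrite (fX_alf wv d X0 D0 Y0) e /main_term -mulrBr nmM nm_al_sign.
have mE : mid w = (absz (mid w))%:Z by case: (al_pairP wv) => -[-> _].
have YD : discf (1, mid w, c) = 24 * n%:Z - 1.
  by rewrite -e discf_alf ?(al_pairM wv).
have e1 : ee (- heegner R (six (1, mid w, c))) = (expR (lambda R n))%:C * zeta12 ^+ absz (mid w).
  by rewrite {1}mE; apply: (ee_heegner_lead1 n1); rewrite -mE.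
have Y3 : 3 * 1 ^+ 2 <= 24 * n%:Z - 1 by lia.
rewrite mul1r -e1 /fX; apply: f_near_pole.
exact: (@heegner_reduced_high n (1, mid w, c) n1 isT YD Y3).
Qed.

Lemma nm_main_term n w : nm (main_term n w) = expR (lambda R n).
Proof.
rewrite /main_term !nmM nm_al_sign nmX nmC ger0_norm ?expR_ge0//.
have -> : nm (zeta12 : R[i]) = 1.
  by rewrite zeta12_cos nm_def /= cos2Dsin2 sqrtr1.
by rewrite expr1n mulr1 mul1r.
Qed.

Definition al_dets : seq int := [:: 1; 2; 3; 6].

Lemma al_detsP w : w \in al_dets -> exists v, al_pair w v.
Proof. by rewrite !inE => /or4P[] /eqP->; [exists 6|exists 3|exists 2|exists 1]. Qed.

Lemma al_pair_dets w v : al_pair w v -> w \in al_dets.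
Proof. by move=> /al_pairP[] [-> _]. Qed.

Lemma main_term_sum n : \sum_(w <- al_dets) main_term n w =
  (2 * Num.sqrt 3 * expR (lambda R n))%:C.
Proof.
rewrite /al_dets !big_cons big_nil /main_term /al_sign /mid /=.
have -> : (2 * Num.sqrt 3 * expR (lambda R n))%:C = (2 * Num.sqrt 3)%:C * (expR (lambda R n))%:C :> R[i].
  by rewrite rmorphM.
by rewrite -zeta12_trace; ring.
Qed.

Definition main_class n w := Gamma0_6_class (six (Xmain n w)).

Definition main_part n C : R[i] :=
  \sum_(w <- al_dets) if C == main_class n w then main_term n w else 0.

Lemma fX_class n X : (1 <= n)%N -> good n X ->
  f (heegner R (xget (0, 0, 0) (Gamma0_6_class (six X)))) = fX X.
Proof.
move=> n1 [X0 XD _].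
have : Gamma0_6_class (six X) (six X).
  by apply/Gamma0_6_classP; exists X => //; apply: eqv_refl.
move=> /(xgetI (0, 0, 0)) /Gamma0_6_classP[Y -> XY].
have D0 : 0 < discf X by rewrite XD; lia.
rewrite -/(fX Y) (@fX_eqv R X Y)//.
case: XY => al [be [ga [de [d ->]]]]; case: X X0 D0 {XD} => [[a b] c] /= a0 D0.
suff : 0 < 6 * (a * 1 * al ^+ 2 + b * al * ga + 6 * c * ga ^+ 2) by rewrite pmulr_rgt0.
have -> : 6 * (a * 1 * al ^+ 2 + b * al * ga + 6 * c * ga ^+ 2) = qv (6 * a) b c al (6 * ga).
  by rewrite /qv; ring.
apply: qv_gt0; [by rewrite mulr_gt0|by rewrite discf_disc|].
by case=> al0 ga0; move: d; rewrite al0; have -> : ga = 0 by [lia]; rewrite !mulr0 ?mul0r.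
Qed.

Lemma expR_lambda1 : expR (lambda R 1 / 2) <= 9.
Proof.
have s5 : Num.sqrt (24 * 1%:R - 1) <= 5 :> R.
  have -> : 5 = Num.sqrt (5 ^+ 2) :> R by rewrite sqrtr_sqr ger0_norm.
  by apply: ler_wsqrtr; lra.
have := pihalf_02 R; have p0 := pi_gt0 R; rewrite /lambda => /andP[_ p2].
have -> : (9 : R) = 3 ^+ 2 by ring.
apply: expR_le3; move: p2 s5 (sqrtr_ge0 (24 * 1%:R - 1 : R)).
move: (pi : R) (Num.sqrt _) p0; clear; move=> x y x0 x2 y5 y0.
have : x * y <= 4 * 5 by apply: ler_pM; lra.
by lra.
Qed.

Lemma class_bound n X : (1 <= n)%N -> good n X ->
  nm (fX X - main_part n (Gamma0_6_class (six X))) <= (2 * 10 ^+ 21 + 45) * expR (lambda R n / 2).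
Proof.
move=> n1 gX; have [X0 XD _] := gX; set C := Gamma0_6_class _.
have D0 : 0 < discf X by rewrite XD; lia.
have l0 : 0 <= lambda R n by rewrite /lambda !mulr_ge0 ?pi_ge0 ?sqrtr_ge0.
have e1 : 1 <= expR (lambda R n / 2) by rewrite -expR0 ler_expR divr_ge0.
have K0 : (0 : R) <= 2 * 10 ^+ 21 by rewrite mulr_ge0// exprn_ge0.
have fm := @fX_main n; have fl := @nm_fX_le n.
move: K0 fm fl; set K := 2 * 10 ^+ 21 => K0 fm fl.
have [w [Y h]] := reduced_ex n1 gX.
have YD := reduced_disc h.
have [v [al [be [ga [de [wv d e _ [Y0 Y3 _]]]]]]] := h.
have fXY : nm (fX X : R[i]) = nm (fX Y : R[i]).
  by rewrite (fX_alf wv d X0 D0) ?e// nmM nm_al_sign mul1r.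
have bY := fl _ n1 Y0 YD Y3.
have [n2|n2] := leqP n 1.
  have ln : expR (lambda R n / 2) <= 9.
    by have -> : n = 1%N; [apply/eqP; rewrite eqn_leq n2|exact: expR_lambda1].
  have el : expR (lambda R n) = expR (lambda R n / 2) * expR (lambda R n / 2).
    by rewrite -expRD; congr expR; field.
  have elY : expR (lambda R n / Y.1.1%:~R) <= expR (lambda R n).
    rewrite ler_expR ler_pdivrMr ?ltr0z//; apply: ler_peMr => //.
    by rewrite -[1]/((1 : int)%:~R) ler_int.
  have mp : nm (main_part n C) <= 4 * expR (lambda R n).
    rewrite /main_part; apply: le_trans (nm_sum _ _ _) _.
    rewrite /al_dets !big_cons big_nil.
    have hh w' : nm (if C == main_class n w' then main_term n w' else 0) <= expR (lambda R n).
      by case: ifP; rewrite ?nm_main_term ?nm0 ?expR_ge0.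
    have := hh 1; have := hh 2; have := hh 3; have := hh 6.
    move: (nm _) (nm _) (nm _) (nm _) (expR _) => x1 x2 x3 x4 y; lra.
  apply: le_trans (nmB _ _) _; rewrite fXY.
  have e9 : expR (lambda R n) <= 9 * expR (lambda R n / 2).
    by rewrite el; apply: ler_wpM2r => //; apply: expR_ge0.
  have Ke : K <= K * expR (lambda R n / 2) by rewrite ler_peMr.
  have -> : (K + 45) * expR (lambda R n / 2) =
      K * expR (lambda R n / 2) + 9 * expR (lambda R n / 2) + 4 * (9 * expR (lambda R n / 2)).
    by ring.
  apply: lerD; first exact: le_trans bY (lerD Ke (le_trans elY e9)).
  by apply: le_trans mp _; rewrite ler_pM2l.
have [/hasP[w0 w0d /eqP Cw]|nC] := boolP (has (fun w0 => C == main_class n w0) al_dets).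
  have [v0 wv0] := al_detsP w0d.
  have -> : main_part n C = main_term n w0.
    rewrite /main_part (bigD1_seq w0)//= Cw eqxx big1_seq ?addr0// => w' /andP[ww' w'd].
    have [v' wv'] := al_detsP w'd.
    case: ifP => // /eqP/Gamma0_6_class_eq/(Xmain_distinct n2 wv0 wv') ew.
    by rewrite ew eqxx in ww'.
  have [M0 _ _] := Xmain_good n1 wv0.
  have -> : fX X = fX (Xmain n w0) :> R[i].
    by apply: (fX_eqv X0 M0 D0); apply/Gamma0_6_class_eq.
  apply: le_trans (fm _ _ n1 wv0) _.
  have : K * 1 <= K * expR (lambda R n / 2) by apply: ler_wpM2l.
  by rewrite mulrDl; lra.
have -> : main_part n C = 0.
  rewrite /main_part big1_seq// => w' /andP[_ w'd]; case: ifP => // Cw.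
  by case/hasP: nC; exists w'.
rewrite subr0 fXY; apply: le_trans bY _.
have A2 : 2 <= Y.1.1.
  have [A1|A1] := eqVneq Y.1.1 1; last by lia.
  have [ex _] := reduced_main n1 h A1.
  case/hasP: nC; exists w; first exact: al_pair_dets wv.
  by apply/eqP/Gamma0_6_class_eq.
have : expR (lambda R n / Y.1.1%:~R) <= expR (lambda R n / 2).
  rewrite ler_expR; apply: ler_wpM2l => //.
  rewrite lef_pV2 ?posrE ?ltr0z//.
  by rewrite -[2]/((2 : int)%:~R) ler_int.
have : K * 1 <= K * expR (lambda R n / 2) by apply: ler_wpM2l.
by rewrite mulrDl; lra.
Qed.

Lemma finite_count (T U : choiceType) (P : set T) (tag : T -> U) (s : seq U) :
  {in P &, injective tag} -> (forall x, P x -> tag x \in s) ->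
  finite_set P /\ (size (finmap.enum_fset (fset_set P)) <= size s)%N.
Proof.
move=> inj Ps; have fin : finite_set P.
  rewrite -(eq_finite_set (inj_card_eq inj)).
  by apply: (sub_finite_set _ (finite_seq s)) => _ [x Px <-]; apply: Ps.
split=> //; rewrite -(size_map tag); apply: uniq_leq_size.
  rewrite map_inj_in_uniq ?finmap.fset_uniq// => x y.
  by rewrite !in_fset_set//; apply: inj.
by move=> _ /mapP[x + ->]; rewrite in_fset_set// inE => /Ps.
Qed.

Lemma Qclasses_count n : (1 <= n)%N -> finite_set (Qclasses n) /\
  (size (finmap.enum_fset (fset_set (Qclasses n))) <= 7 * (24 * n) * (288 * n))%N.
Proof.
move=> n1.
have ex C : exists k : nat * nat * nat, Qclasses n C -> exists w X Y,
    [/\ C = Gamma0_6_class (six X), reduced_by n w X Y & k = (absz w, absz Y.1.1, absz Y.1.2)].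
  have [QC|QC] := pselect (Qclasses n C); last by exists (0, 0, 0)%N.
  have [Q /(QformsP _ n1)[X -> g] <-] := QC.
  have [w [Y h]] := reduced_ex n1 g.
  by exists (absz w, absz Y.1.1, absz Y.1.2) => _; exists w, X, Y.
have [tag tagP] := boolp.choice ex.
set s := [seq (ij, k) | ij <- [seq (i, j) | i <- iota 0 7, j <- iota 0 (24 * n)], k <- iota 0 (288 * n)].
have [|C QC|fin sz] := @finite_count _ _ (Qclasses n) tag s.
- move=> C C' /[!inE] QC QC'.
  have [w [X [Y [-> h ->]]]] := tagP _ QC.
  have [w' [X' [Y' [-> h' ->]]]] := tagP _ QC'.
  have [v [? [? [? [? [wv _ _ _ [Y0 _ B0]]]]]]] := h.
  have [v' [? [? [? [? [wv' _ _ _ [Y0' _ B0']]]]]]] := h'.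
  have w0 : 0 < w by case: (al_pairP wv) => -[-> _].
  have w0' : 0 < w' by case: (al_pairP wv') => -[-> _].
  case=> ew eA eB; have ww : w = w' by lia.
  apply/Gamma0_6_class_eq; rewrite -ww in h'; apply: (reduced_inj h h').
  rewrite [Y.1]surjective_pairing [Y'.1]surjective_pairing; congr (_, _); lia.
- have [w [X [Y [_ h ->]]]] := tagP _ QC.
  have [v [? [? [? [? [wv _ _ _ [Y0 Y3 B0]]]]]]] := h.
  have AA : Y.1.1 * 1 <= Y.1.1 ^+ 2 by rewrite expr2; apply: ler_wpM2l; lia.
  have m1 : (absz w, absz Y.1.1) \in [seq (i, j) | i <- iota 0 7, j <- iota 0 (24 * n)].
    apply/allpairsP; exists (absz w, absz Y.1.1); split=> //.
      by case: (al_pairP wv) => -[-> _].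
    by rewrite mem_iota /=; lia.
  apply/allpairsP; exists ((absz w, absz Y.1.1), absz Y.1.2); split=> //.
  by rewrite mem_iota /=; lia.
- split=> //; apply: leq_trans sz _; rewrite /s !size_allpairs !size_iota.
  by rewrite leqnn.
Qed.

Lemma error_bound n : (1 <= n)%N ->
  nm (Ssum R n - (2 * Num.sqrt 3 * expR (lambda R n))%:C) <=
  (7 * (24 * n) * (288 * n))%:R * ((2 * 10 ^+ 21 + 45) * expR (lambda R n / 2)).
Proof.
move=> n1; have [fin sz] := Qclasses_count n1.
rewrite /Ssum fsbig_finite//=; set s := finmap.enum_fset _ in sz *.
have us : uniq s by apply: finmap.fset_uniq.
have sP C : C \in s -> exists2 X, C = Gamma0_6_class (six X) & good n X.
  by rewrite /s in_fset_set// inE => -[Q /(QformsP _ n1)[X -> g] <-]; exists X.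
have -> : (2 * Num.sqrt 3 * expR (lambda R n))%:C = \sum_(C <- s) main_part n C.
  rewrite -main_term_sum /main_part exchange_big /=.
  apply: eq_big_seq => w wd; rewrite (bigD1_seq (main_class n w))//= ?eqxx ?big1 ?addr0// => [C /negPf -> //|].
  rewrite /s in_fset_set// inE; exists (six (Xmain n w)) => //.
  have [v wv] := al_detsP wd.
  by apply/QformsP => //; exists (Xmain n w) => //; apply: Xmain_good wv.
rewrite -sumrB; apply: le_trans (nm_sum _ _ _) _.
have K0 : (0 : R) <= 2 * 10 ^+ 21 + 45 by rewrite addr_ge0// mulr_ge0// exprn_ge0.
set B := _ * expR _.
have B0 : 0 <= B by rewrite mulr_ge0 ?expR_ge0.
apply: (@le_trans _ _ (\sum_(C <- s) B)).
  rewrite big_seq [leRHS]big_seq; apply: ler_sum => C /sP[X -> g].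
  by rewrite (fX_class n1 g); apply: class_bound.
rewrite big_const_seq count_predT iter_addr_0 -[leLHS]mulr_natl ler_wpM2r// ler_nat.
exact: sz.
Qed.

Lemma error_lt n : (1 <= n)%N ->
  (7 * (24 * n) * (288 * n))%:R * ((2 * 10 ^+ 21 + 45) * expR (lambda R n / 2)) <
  (43 / 10 * 10 ^+ 23) * 2 `^ q R n * (24 * n%:R - 1) ^+ 2 * expR (lambda R n / 2) :> R.
Proof.
move=> n1; have D23 := disc_ge1 n1.
rewrite mulrA ltr_pM2r ?expR_gt0//.
have q1 : 1 <= 2 `^ q R n :> R.
  rewrite -{1}(powRr0 (2 : R)); apply: ler_powR; first by rewrite ler1n.
  rewrite /q divr_ge0// ln_ge0//; lra.
have nn : 1 <= n%:R :> R by rewrite ler1n.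
have K1 : 100 <= (10 : R) ^+ 21.
  have -> : (10 : R) ^+ 21 = 100 * 10 ^+ 19 by rewrite (exprD 10 2 19); congr (_ * _); ring.
  by rewrite ler_peMr// exprn_ege1// ler1n.
apply: (@lt_le_trans _ _ (43 / 10 * 10 ^+ 23 * 1 * (24 * n%:R - 1) ^+ 2)); last first.
  by rewrite ler_wpM2r ?sqr_ge0// ler_wpM2l// mulr_ge0// exprn_ge0.
rewrite mulr1 (exprD 10 21 2) !natrM; move: K1 nn; clear.
move: (n%:R : R) ((10 : R) ^+ 21) => x K K1 x1.
have h : (23 * x) ^+ 2 <= (24 * x - 1) ^+ 2.
  by rewrite ler_pXn2r// ?nnegrE; lra.
have Kx : 0 < K * x ^+ 2 by rewrite mulr_gt0 ?exprn_gt0//; lra.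
apply: (@lt_le_trans _ _ (43 / 10 * (K * 10 ^+ 2) * (23 * x) ^+ 2)); last first.
  by apply: ler_wpM2l => //; rewrite !mulr_ge0//; lra.
have -> : 43 / 10 * (K * 10 ^+ 2) * (23 * x) ^+ 2 = (430 * 23 * 23) * (K * x ^+ 2).
  by field.
have -> : 7 * (24 * x) * (288 * x) * (2 * K + 45) = (7 * 24 * 288) * (2 * (K * x ^+ 2) + 45 * x ^+ 2) by ring.
have : x ^+ 2 * 100 <= x ^+ 2 * K by apply: ler_wpM2l => //; rewrite sqr_ge0.
by lra.
Qed.

End Assembly.

Theorem theorem1p5 (R : realType) :
  exists E : nat -> R[i],
    forall n : nat, (1 <= n)%N ->
      Ssum R n = (2 * Num.sqrt 3 * expR (lambda R n))%:C + E n /\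
      `|E n| < ((43 / 10 * 10 ^+ 23) * 2 `^ q R n * (24 * n%:R - 1) ^+ 2
                  * expR (lambda R n / 2))%:C.
Proof.
exists (fun n => Ssum R n - (2 * Num.sqrt 3 * expR (lambda R n))%:C) => n n1.
split; first by rewrite addrC subrK.
by rewrite nmE ltcR; apply: le_lt_trans (error_bound n1) (error_lt n1).
Qed.
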